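(* The operator $\tilde R$, defined by $\tilde R\phi(x)=\mathrm{P.V.}\int_{\mathbb T^2}\phi(x+y)R^*(y)\,dy$ with the vector-valued kernel $R^*$ given in the context, satisfies the following properties. (R1) Let $n\in\mathbb N$, $n\ge1$. Then $\tilde R\phi(x)$ is well defined (the principal value limit exists) for every $\phi\in C^1((n+1)\mathbb T^2)$ and every $x\in n\mathbb T^2$. (R2) For every $k\in\mathbb N$ and every multi-index $\alpha$ with $|\alpha|=k$, it holds that $|D^\alpha\tilde R\phi(x)|\le C\|\phi\|_{W^{k+1,\infty}(2\mathbb T^2)}$ for every $\phi\in C^{k+1}(2\mathbb T^2)$ and every $x\in\mathbb T^2$, where $C$ is a positive universal constant independent of $\phi$. (R3) There is a positive universal constant $C$ such that $\|\tilde R\phi\|_{L^2(\mathbb T^2)}\le C\|\phi\|_{L^2(2\mathbb T^2)}$ for every $\phi\in C^1(2\mathbb T^2)$.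
   Context: Notation: $\mathbb T^2=[-\pi,\pi]^2$, viewed as a box in $\mathbb R^2$, and for a positive integer $n$, $n\mathbb T^2=[-n\pi,n\pi]^2$. Functions $\phi$ are real-valued and not assumed periodic. $C^k(X)$ denotes the functions on $X$ whose derivatives up to order $k$ are continuous and bounded on $X$; $W^{k,\infty}(X)$ is the usual Sobolev space. The kernel is $$R^*(y)=\frac{y}{2\pi|y|^3}+\sum_{k\in\mathbb Z^2\setminus\{0\}}\left(\frac{y+2\pi k}{2\pi|y+2\pi k|^3}-\frac{k}{|2\pi k|^3}\right)\in\mathbb R^2,$$ and $$\tilde R\phi(x)=\mathrm{P.V.}\int_{\mathbb T^2}\phi(x+y)R^*(y)\,dy=\lim_{\epsilon\to0^+}\int_{\mathbb T^2\cap\{|y|>\epsilon\}}\phi(x+y)R^*(y)\,dy .$$ *)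

(* Defs.v *)
From HB Require Import structures.
From mathcomp Require Import all_boot all_order all_algebra.
From mathcomp Require Import all_classical all_reals all_analysis.

Set Implicit Arguments.
Unset Strict Implicit.
Unset Printing Implicit Defensive.

Import Order.TTheory GRing.Theory Num.Theory.
Import numFieldNormedType.Exports.

Local Open Scope classical_set_scope.
Local Open Scope ring_scope.

Section plane.
Context {R : realType}.

(* The library norm on [R * R] is the max norm. *)
Definition enorm (z : R * R) : R := Num.sqrt (z.1 ^+ 2 + z.2 ^+ 2).

(* [tbox n] is n T^2. *)
Definition tbox (n : nat) : set (R * R) :=
  `[- (n%:R * pi), n%:R * pi] `*` `[- (n%:R * pi), n%:R * pi].

Local Notation leb2 := ((@lebesgue_measure R) \x (@lebesgue_measure R))%E.

(* Derivatives relative to a set [X]: the increments [h] are those that keep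
   the point in [X], so that on the boundary of a box the derivatives are
   one-sided and values outside the box never matter.  For [X = setT] these
   are the library's [derivable] and ['D_v f x]. *)
Definition within_quotient (X : set (R * R)) (f : R * R -> R) (x v : R * R)
    : set_system R :=
  (fun h : R => h^-1 *: (f (x + h *: v) - f x))
    @ within [set h : R | X (x + h *: v)] 0^'.

Definition derivable_in X f x v := cvg (within_quotient X f x v).

Definition derive_in X f x v : R := lim (within_quotient X f x v).

Definition axis (i : bool) : R * R := if i then (0, 1) else (1, 0).

Definition partials (X : set (R * R)) (f : R * R -> R) (s : seq bool) :=
  foldr (fun i g x => derive_in X g x (axis i)) f s.

Fixpoint partials_exist (X : set (R * R)) (f : R * R -> R) (s : seq bool) :=
  if s is i :: t then
    partials_exist X f t /\
    (forall x, X x -> derivable_in X (partials X f t) x (axis i))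
  else True.

(* The multi-index (a, b) stands for d^a/dx1^a d^b/dx2^b. *)
Definition word (alpha : nat * nat) : seq bool :=
  nseq alpha.1 false ++ nseq alpha.2 true.

Definition Dmulti X f (alpha : nat * nat) := partials X f (word alpha).

Definition Dmulti_exists X f (alpha : nat * nat) :=
  partials_exist X f (word alpha).

(* C^k(X): the iterated partial derivatives of order at most k, taken in any
   order, exist on X and are continuous and bounded there. *)
Definition Ck (k : nat) (X : set (R * R)) (f : R * R -> R) :=
  forall s : seq bool, (size s <= k)%N ->
    [/\ partials_exist X f s,
        {within X, continuous (partials X f s)} &
        exists M : R, forall x, X x -> `|partials X f s x| <= M].

Definition Lpnorm (p : \bar R) (X : set (R * R)) (f : R * R -> R) : \bar R :=
  'N[leb2]_p[EFin \o (f \_ X)].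

(* Only meant for f in C^k(X), whose weak derivatives are the classical ones. *)
Definition Winfnorm (k : nat) (X : set (R * R)) (f : R * R -> R) : \bar R :=
  \big[maxe/0%E]_(alpha : 'I_k.+1 * 'I_k.+1 | (alpha.1 + alpha.2 <= k)%N)
     Lpnorm +oo%E X (Dmulti X f (alpha.1 : nat, alpha.2 : nat)).

(* Sum of an absolutely convergent family over Z^2 \ {0}. *)
Definition lattice_sum (u : int * int -> R) : R :=
  fine (\esum_(k in [set k : int * int | k != 0%R]) (EFin \o u)^\+ k -
        \esum_(k in [set k : int * int | k != 0%R]) (EFin \o u)^\- k)%E.

Definition riesz (z : R * R) : R * R :=
  (z.1 / (2 * pi * enorm z ^+ 3), z.2 / (2 * pi * enorm z ^+ 3)).

Definition ztwopi (k : int * int) : R * R :=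
  (2 * pi * k.1%:~R, 2 * pi * k.2%:~R).

Definition Rstar (y : R * R) : R * R :=
  ((riesz y).1 + lattice_sum (fun k =>
     (riesz (y + ztwopi k)).1 - k.1%:~R / enorm (ztwopi k) ^+ 3),
   (riesz y).2 + lattice_sum (fun k =>
     (riesz (y + ztwopi k)).2 - k.2%:~R / enorm (ztwopi k) ^+ 3)).

Definition pv_domain (eps : R) : set (R * R) :=
  tbox 1 `&` [set y | eps < enorm y].

Definition pv_trunc (K phi : R * R -> R) (x : R * R) (eps : R) : R :=
  (\int[leb2]_(y in pv_domain eps) (phi (x + y) * K y))%R.

Definition pv_integral (K phi : R * R -> R) (x : R * R) : R :=
  lim (pv_trunc K phi x eps @[eps --> 0^'+]).

(* The library's integral is total, so integrability of the truncations is
   part of the existence of the principal value. *)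
Definition pv_exists (K phi : R * R -> R) (x : R * R) :=
  (forall eps : R, 0 < eps ->
     leb2.-integrable (pv_domain eps) (fun y => (phi (x + y) * K y)%:E)) /\
  cvg (pv_trunc K phi x eps @[eps --> 0^'+]).

Definition Rtilde (phi : R * R -> R) (x : R * R) : R * R :=
  (pv_integral (fst \o Rstar) phi x, pv_integral (snd \o Rstar) phi x).

Definition Rtilde_well_defined (phi : R * R -> R) (x : R * R) :=
  pv_exists (fst \o Rstar) phi x /\ pv_exists (snd \o Rstar) phi x.

End plane.

(* Main.v *)
From HB Require Import structures.
Require Import Defs.
From mathcomp Require Import all_boot all_order all_algebra.
From mathcomp Require Import all_classical all_reals all_analysis measurable_realfun ess_sup_inf.
From mathcomp Require Import ring lra zify.
Set Implicit Arguments.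
Unset Strict Implicit.
Unset Printing Implicit Defensive.
Import Order.TTheory GRing.Theory Num.Theory.
Import numFieldNormedType.Exports.
Local Open Scope classical_set_scope.
Local Open Scope ring_scope.


(** The kernel is [Rstar = r + g], where [r y = y / (2 pi |y|^3)] is the Riesz
    kernel of the plane and [g] is the lattice sum. As [r] is homogeneous of
    degree [-2], the increment of [r] between [2 pi k] and [y + 2 pi k] is
    [O(|y| / |k|^3)], so [g] is bounded and Lipschitz on the box
    ([lattice_corr_lip], [lattice_corr_bound]) and only the odd, non-integrable
    singularity of [r] at the origin matters.

    - Existence. On the symmetric truncated domain the oddness of [r] allows
      [f (x + y)] to be replaced by [(f (x + y) - f (x - y)) / 2] in front of
      [r]. For a Lipschitz [f] the resulting integrand [sym_integrand] is
      dominated by a multiple of [1 / |y|], which is integrable in the plane;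
      hence the truncations converge to the absolutely convergent integral
      [riesz_op] ([pv_cvg]), bounded by the Lipschitz constant and the supremum
      of [f] ([riesz_op_bound]).

    - Derivatives. In [riesz_op] the point [x] enters through [f] only, and a
      difference quotient of a C^2 function is bounded and Lipschitz uniformly
      in the increment. Dominated convergence gives
      [d_j (riesz_op f) = riesz_op (d_j f)] ([riesz_op_slope]), and an induction
      on the word of derivatives [D^alpha (riesz_op f) = riesz_op (D^alpha f)].
      The bound on [riesz_op] then involves [D^alpha f] and its two first
      partial derivatives; symmetry of mixed derivatives ([mixed_slopes]) puts
      the latter in the normal order of the multi-indices in the norm, and the
      supremum of a continuous function is its essential supremum
      ([le_Lpnorm_oo]). The constant does not depend on [alpha].

    - The L^2 bound. The part of the operator with kernel [g] is handled by the
      Cauchy-Schwarz inequality. For the singular part the method of rotations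
      is used, on a function cut off outside the larger box: writing
      [y = (t, t s)], the plane integral becomes an average over the slopes [s],
      with the integrable weight [1 / (1 + s^2)], of truncated Hilbert transforms
      of [f] along lines ([riesz_op_odd_fan]). Each of these is a limit of midpoint
      sums, which are combinations of the translates of [f] by odd multiples of a
      fixed half-step, with coefficients the inverses of half-integers
      ([hilb_sum_cvg]). Their squared L^2 norm is a quadratic form in those
      coefficients with entries given by the autocorrelation of [f]; an
      elementary partial fraction computation bounds it by an absolute multiple
      of the squared norm of [f] ([hilbert_form_bound], [hilb_sum_L2]), so that
      no Fourier analysis is involved. Cauchy-Schwarz in [s], Tonelli and a
      passage to the limit conclude ([riesz_op_odd_L2]). *)

(** * Affine changes of variables *)

Section affine_change.
Context {R : realType}.
Local Notation RM := (measurableTypeR R).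
Local Notation leb := (@lebesgue_measure R).
Local Notation leb2 := (leb \x leb)%E.

Lemma measurable_affine (a b : R) :
  measurable_fun setT (fun x : RM => (a * x + b : RM)).
Proof. by apply: measurable_funD => //; apply: measurable_funM. Qed.

Lemma affine_preimage_itv (a b u v : R) : a != 0 ->
  leb ((fun x => a * x + b) @^-1` `]u, v]%classic) =
  (`|a|^-1%:E * leb (`]u, v]%classic : set R))%E.
Proof.
move=> a0; have := a0; rewrite neq_lt => /orP[an|ap].
- rewrite [X in leb X](_ : _ = `[(v - b) / a, (u - b) / a[%classic); last first.
    apply/seteqP; split=> x; rewrite /= !in_itv/= ler_ndivrMr// ltr_ndivlMr//;
      move=> /andP[h1 h2]; apply/andP; split; lra.
  rewrite !lebesgue_measure_itv/= !lte_fin ltr_nM2r ?invr_lt0// ltrD2r ltr0_norm//.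
  case: ifPn => _; last by rewrite mule0.
  by rewrite -!EFinD -EFinM; congr EFin; field.
- rewrite [X in leb X](_ : _ = `](u - b) / a, (v - b) / a]%classic); last first.
    apply/seteqP; split=> x; rewrite /= !in_itv/= ltr_pdivrMr// ler_pdivlMr//;
      move=> /andP[h1 h2]; apply/andP; split; lra.
  rewrite !lebesgue_measure_itv/= !lte_fin ltr_pM2r ?invr_gt0// ltrD2r gtr0_norm//.
  case: ifPn => _; last by rewrite mule0.
  by rewrite -!EFinD -EFinM; congr EFin; field.
Qed.

(** Both sides are measures in [A] that agree on intervals, and Lebesgue measure
    is determined by its values on intervals. *)
Lemma lebesgue_affine (a b : R) (A : set R) : a != 0 -> measurable A ->
  leb A = (`|a|%:E * leb ((fun x => (a * x + b)%R) @^-1` A))%E.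
Proof.
move=> a0 mA; have na : 0 <= `|a| by [].
have mphi := measurable_affine a b.
pose m := measure_function_mscale__canonical__measure_function_Measure (NngNum na)
  (measure_function_pushforward__canonical__measure_function_Measure leb mphi).
rewrite (@lebesgue_measure_unique _ m)// => _ [[u v] /= _ <-].
rewrite /m /= /mscale /= /pushforward affine_preimage_itv// muleA -EFinM.
by rewrite divff ?normr_eq0// mul1e.
Qed.

Lemma ge0_integral_affine (a b : R) (f : RM -> \bar R) : a != 0 ->
  measurable_fun setT f -> (forall x, 0 <= f x)%E ->
  (\int[leb]_x f x = `|a|%:E * \int[leb]_x f (a * x + b)%R)%E.
Proof.
move=> a0 mf f0; have na : 0 <= `|a| by [].
have mphi := measurable_affine a b.
have <- := @ge0_integral_pushforward _ _ _ _ _ _ mphi leb setT f measurableT mf (fun x _ => f0 x).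
pose pm := measure_function_pushforward__canonical__measure_function_Measure leb mphi.
rewrite -(@ge0_integral_mscale _ _ _ pm _ _ (NngNum na))//.
apply: eq_measure_integral => A mA _.
exact: lebesgue_affine.
Qed.

(** Plane Lebesgue measure is invariant under translations and under the
    central symmetry; Tonelli reduces both to the line. *)
Lemma ge0_integral_affine2 (e : R) (v : R * R) (f : RM * RM -> \bar R) :
  `|e| = 1 -> measurable_fun setT f -> (forall x, 0 <= f x)%E ->
  (\int[leb2]_x f (e * x.1 + v.1, e * x.2 + v.2)%R = \int[leb2]_x f x)%E.
Proof.
move=> e1 mf f0; have e0 : e != 0 by rewrite -normr_eq0 e1 oner_eq0.
have mg : measurable_fun setT (fun x : R * R => f (e * x.1 + v.1, e * x.2 + v.2)%R).
  apply: measurableT_comp => //; apply: measurable_fun_pair.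
    exact: (measurableT_comp (measurable_affine e v.1)).
  exact: (measurableT_comp (measurable_affine e v.2)).
have -> := @fubini_tonelli1 _ _ RM RM R leb leb _ mg (fun x => f0 _).
have -> := @fubini_tonelli1 _ _ RM RM R leb leb _ mf f0.
rewrite /fubini_F.
rewrite [RHS](ge0_integral_affine v.1 e0); last 2 first.
- exact: (@measurable_fun_fubini_tonelli_F _ _ RM RM R leb f).
- by move=> x; exact: integral_ge0.
rewrite e1 mul1e; apply: eq_integral => x _.
rewrite [RHS](ge0_integral_affine v.2 e0) ?e1 ?mul1e//.
exact: measurableT_comp.
Qed.

Lemma integral_affine2 (e : R) (v : R * R) (f : RM * RM -> \bar R) :
  `|e| = 1 -> measurable_fun setT f ->
  (\int[leb2]_x f (e * x.1 + v.1, e * x.2 + v.2)%R = \int[leb2]_x f x)%E.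
Proof.
move=> e1 mf; rewrite [LHS]integralE [RHS]integralE.
congr (_ - _)%E.
  rewrite -(ge0_integral_affine2 v e1 (measurable_funepos mf) (funepos_ge0 f)).
  by apply: eq_integral => x _; rewrite !funeposE.
rewrite -(ge0_integral_affine2 v e1 (measurable_funeneg mf) (funeneg_ge0 f)).
by apply: eq_integral => x _; rewrite !funenegE.
Qed.

End affine_change.

(** * Measurability in the plane *)

Section measurable_plane.
Context {R : realType}.
Local Notation leb := (@lebesgue_measure R).
Local Notation leb2 := (leb \x leb)%E.

(** Inversion is continuous off the origin, and a single point is measurable
    whatever the value there. *)
Lemma measurable_invr D : measurable_fun D (@GRing.inv R).
Proof.
apply: measurable_funTS.
rewrite -(setvU [set (0:R)]); apply/measurable_funU => //.
  exact: measurableC.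
split.
  apply: open_continuous_measurable_fun.
    by apply/closed_openC/accessible_closed_set1/hausdorff_accessible; exact: Rhausdorff.
  by move=> x /[!inE] /eqP x0; exact: inv_continuous.
move=> mD Y mY.
have [Y0|Y0] := pselect (Y 0).
  rewrite (_ : _ `&` _ = [set 0])//; apply/seteqP; split=> x /=; first by case.
  by move=> ->; rewrite invr0.
rewrite (_ : _ `&` _ = set0)//; apply/seteqP; split=> x //= [->]; rewrite invr0//.
Qed.

Lemma measurable_sqrt D : measurable_fun D (@Num.sqrt R).
Proof.
apply: measurable_funTS; apply: continuous_measurable_fun.
exact: sqrt_continuous.
Qed.

(** An open set is the union of the squares with rational centre and radius that
    it contains, and those are countably many. *)
Lemma measurable_open2 (U : set (R * R)) : open U -> measurable U.
Proof.
move=> oU.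
pose box (q : (rat * rat) * rat) : set (R * R) :=
  ball (ratr q.1.1 : R) (ratr q.2) `*` ball (ratr q.1.2 : R) (ratr q.2).
have -> : U = \bigcup_(q : (rat * rat) * rat) (if `[<box q `<=` U>] then box q else set0).
  apply/seteqP; split=> x; last first.
    by move=> [q _]; case: ifPn => // /asboolP + ?; exact.
  move=> Ux.
  have /nbhs_ballP[e /= e0 he] : nbhs x U by exact: open_nbhs_nbhs.
  have /rat_in_itvoo[r] : 0 < e / 2 by lra.
  rewrite in_itv/= => /andP[r0 re].
  have /rat_in_itvoo[a] : x.1 - ratr r < x.1 + ratr r by lra.
  have /rat_in_itvoo[b] : x.2 - ratr r < x.2 + ratr r by lra.
  rewrite !in_itv/= => /andP[b1 b2] /andP[a1 a2].
  exists ((a, b), r) => //; rewrite ifT.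
    split => /=; rewrite /ball/= ltr_norml; apply/andP; split; lra.
  apply/asboolP => -[y1 y2] [] /=; rewrite /ball/= !ltr_norml => /andP[? ?] /andP[? ?].
  apply: he; split => /=; rewrite /ball/= ltr_norml; apply/andP; split; lra.
apply: countable_bigcupT_measurable; first exact: countableP.
move=> q; case: ifPn => _ //; apply: measurableX; exact: measurable_ball.
Qed.

Lemma continuous_within_measurable2 (D : set (R * R)) (f : R * R -> R) :
  measurable D -> {within D, continuous f} -> measurable_fun D f.
Proof.
move=> mD /continuousP cf; apply: (measurability _ (RGenOpens.measurableE R)).
move=> _ [_ [a [b ->] <-]].
have /open_subspaceP [V oV VD] := cf _ (@interval_open R (BRight a) (BLeft b) isT isT).
rewrite setIC -VD; apply: measurableI => //; exact: measurable_open2.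
Qed.

Lemma measurable_tbox n : measurable (@tbox R n).
Proof. by apply: measurableX; exact: measurable_itv. Qed.

End measurable_plane.

(** * Dominated convergence and Cauchy-Schwarz for real integrals *)

Section sequential.
Context {R : realType}.

(** Dominated convergence is about sequences; this transports it to the
    filters of one-sided and punctured limits. *)
Lemma cvg_within_seq (V : pseudoMetricType R) (S : set V) (u : V -> R) (x : V)
    (l : R) :
  (forall h : nat -> V, (forall n, S (h n)) -> h n @[n --> \oo] --> x ->
    u (h n) @[n --> \oo] --> l) ->
  u z @[z --> within S (nbhs x)] --> l.
Proof.
move=> H; apply: contrapT => fpl.
have [e He] : exists e : {posnum R}, forall d : {posnum R},
    exists z : V, [/\ S z, ball x d%:num z & `|u z - l| >= e%:num].
  apply: contrapT; apply: contra_not fpl => /forallNP h.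
  apply/cvgrPdist_lt => e e0; have /existsNP[d] := h (PosNum e0).
  move=> {}h; rewrite near_withinE; apply/nbhs_ballP; exists d%:num => //= z bz Sz.
  apply: contrapT => K; apply: h; exists z; split => //.
  by rewrite leNgt distrC; apply/negP.
have invn n : 0 < n.+1%:R^-1 :> R by rewrite invr_gt0.
pose h n := sval (cid (He (PosNum (invn n)))).
have hS n : S (h n) by rewrite /h; case: cid => z [].
have hx : h n @[n --> \oo] --> x.
  apply/cvg_ballP => r r0; near=> n.
  rewrite /h; case: cid => z [/= _ bz _] /=; apply: le_ball bz.
  apply/ltW; near: n; exact: (near_infty_natSinv_lt (PosNum r0)).
move/cvgrPdist_lt: (H _ hS hx) => /(_ e%:num (ltac:(by [])))[] n _ /(_ _ (leqnn _)).
by rewrite /h; case: cid => // z [_ _ /=]; rewrite distrC leNgt => /negP.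
Unshelve. all: by end_near. Qed.

End sequential.

Section real_integrals.
Context d (T : measurableType d) {R : realType}.
Variable mu : {measure set T -> \bar R}.
Implicit Types (D : set T) (f g : T -> R).

Lemma le_norm_integrable D f g : measurable D -> measurable_fun D f ->
  mu.-integrable D (EFin \o g) -> (forall x, D x -> `|f x| <= g x) ->
  mu.-integrable D (EFin \o f).
Proof.
move=> mD mf ig fg; apply: le_integrable ig => //; first exact/measurable_EFinP.
by move=> x Dx /=; rewrite lee_fin (le_trans (fg x Dx))// ler_norm.
Qed.

Lemma bounded_integrable D f (M : R) : measurable D -> (mu D < +oo)%E ->
  measurable_fun D f -> (forall x, D x -> `|f x| <= M) ->
  mu.-integrable D (EFin \o f).
Proof.
move=> mD Dfin mf fM; apply: measurable_bounded_integrable => //.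
exists M; split; first exact: num_real.
by move=> t Mt x Dx /=; rewrite (le_trans (fM _ Dx))// ltW.
Qed.

Lemma norm_Rintegral_le D f g : measurable D -> measurable_fun D f ->
  mu.-integrable D (EFin \o g) -> (forall x, D x -> `|f x| <= g x) ->
  `|\int[mu]_(x in D) f x| <= \int[mu]_(x in D) g x.
Proof.
move=> mD mf ig fg; have If := le_norm_integrable mD mf ig fg.
apply: le_trans (le_normr_Rintegral mD If) _.
apply: le_Rintegral => //.
have := integrable_abse If.
by apply: eq_integrable.
Qed.

Lemma Rdominated_convergence D (f_ : nat -> T -> R) f g : measurable D ->
  (forall n, measurable_fun D (f_ n)) ->
  (forall x, D x -> f_ ^~ x @ \oo --> f x) ->
  mu.-integrable D (EFin \o g) -> (forall n x, D x -> `|f_ n x| <= g x) ->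
  (\int[mu]_(x in D) f_ n x) @[n --> \oo] --> \int[mu]_(x in D) f x.
Proof.
move=> mD mf_ f_f ig fg.
have mf : measurable_fun D f by apply: measurable_fun_cvg f_f.
have fle x : D x -> `|f x| <= g x.
  move=> Dx; have /cvg_norm h := f_f x Dx.
  rewrite -(cvg_lim _ h)//; apply: limr_le; first by apply/cvg_ex; eexists; exact: h.
  by apply: nearW => n; exact: fg.
have [] := @dominated_convergence _ _ _ mu D mD (fun n => EFin \o f_ n) (EFin \o f)
  (EFin \o g).
- by move=> n; exact/measurable_EFinP.
- exact/measurable_EFinP.
- by apply/aeW => x Dx; apply: cvg_EFin; [exact: nearW|exact: f_f].
- exact: ig.
- by apply/aeW => x n Dx /=; rewrite lee_fin fg.
move=> _ _ C; apply: fine_cvg.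
rewrite fineK; first exact: C.
by apply: integrable_fin_num => //; exact: (le_norm_integrable mD mf ig fle).
Qed.

(** Cauchy-Schwarz for a weight [w], from the nonnegativity of the integral of
    [w * (|h| - m)^2], [m] being the [w]-mean of [|h|]. *)
Lemma Rintegral_weighted_square D (w h : T -> R) : measurable D ->
  measurable_fun D w -> measurable_fun D h ->
  (forall x, D x -> 0 <= w x) ->
  mu.-integrable D (EFin \o w) ->
  (exists M : R, forall x, D x -> `|h x| <= M) ->
  (\int[mu]_(x in D) (w x * h x)) ^+ 2 <=
  (\int[mu]_(x in D) w x) * \int[mu]_(x in D) (w x * h x ^+ 2).
Proof.
move=> mD mw mh w0 iw [M hM].
have iwk k : mu.-integrable D (EFin \o (fun x => w x * h x ^+ k)).
  apply: (@le_norm_integrable _ _ (fun x => M ^+ k * w x)) => //.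
  - by apply: measurable_funM => //; exact: measurable_funX.
  - have := @integrableZl _ _ _ mu D mD (M ^+ k) _ iw.
    by apply: eq_integrable => // x _ /=; rewrite EFinM.
  - move=> x Dx; rewrite normrM normrX mulrC (ger0_norm (w0 x Dx)).
    by apply: ler_wpM2r; [exact: w0|]; rewrite lerXn2r ?nnegrE// ?hM// (le_trans _ (hM x Dx)).
set W := \int[mu]_(x in D) w x; set A := \int[mu]_(x in D) (w x * h x).
set B := \int[mu]_(x in D) (w x * h x ^+ 2).
have key c : 0 <= B - 2 * c * A + c ^+ 2 * W.
  have -> : B - 2 * c * A + c ^+ 2 * W =
      \int[mu]_(x in D) (w x * (h x - c) ^+ 2).
    have i1 : mu.-integrable D (EFin \o (fun x => w x * h x)).
      by have := iwk 1%N; apply: eq_integrable.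
    have i4 := iwk 2%N.
    have i2 : mu.-integrable D (EFin \o (fun x => 2 * c * (w x * h x))).
      have := @integrableZl _ _ _ mu D mD (2 * c) _ i1.
      by apply: eq_integrable => // x _ /=; rewrite EFinM.
    have i3 : mu.-integrable D (EFin \o (fun x => c ^+ 2 * w x)).
      have := @integrableZl _ _ _ mu D mD (c ^+ 2) _ iw.
      by apply: eq_integrable => // x _ /=; rewrite EFinM.
    rewrite /B /A /W -RintegralZl// -RintegralZl// -RintegralB//.
    rewrite -RintegralD//; last first.
      have := @integrableB _ _ _ mu D mD _ _ (iwk 2%N) i2.
      by apply: eq_integrable => // x _ /=; rewrite EFinB.
    by apply: eq_Rintegral => x _; ring.
  by apply: Rintegral_ge0 => x Dx; rewrite mulr_ge0 ?w0 ?sqr_ge0.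
have W0 : 0 <= W by apply: Rintegral_ge0.
move: W0; rewrite le_eqVlt => /orP[/eqP W0|Wp].
  rewrite -W0 mul0r.
  suff -> : A = 0 by rewrite expr0n.
  apply/eqP/negPn/negP => A0.
  have := key ((B + 1) / (2 * A)); rewrite -W0 mulr0 addr0.
  rewrite (_ : 2 * _ * A = B + 1); last by field.
  lra.
have := key (A / W).
have -> : B - 2 * (A / W) * A + (A / W) ^+ 2 * W = (W * B - A ^+ 2) / W.
  by field; rewrite gt_eqF.
by rewrite pmulr_lge0 ?invr_gt0// subr_ge0.
Qed.

End real_integrals.

(** * The Euclidean norm and the integrability of its inverse *)

Section plane_norm.
Context {R : realType}.
Local Notation leb := (@lebesgue_measure R).
Local Notation leb2 := (leb \x leb)%E.
Implicit Types y z : R * R.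

Lemma enorm_ge0 z : 0 <= enorm z. Proof. exact: sqrtr_ge0. Qed.

Lemma enorm_sqr z : enorm z ^+ 2 = z.1 ^+ 2 + z.2 ^+ 2.
Proof. by rewrite sqr_sqrtr// addr_ge0 ?sqr_ge0. Qed.

Lemma enormN z : enorm (- z) = enorm z.
Proof. by rewrite /enorm /= !sqrrN. Qed.

Lemma enorm_ge_coord z : `|z.1| <= enorm z /\ `|z.2| <= enorm z.
Proof.
split; rewrite -(@ler_pXn2r _ 2) ?nnegrE ?enorm_ge0// enorm_sqr real_normK ?num_real//.
  by rewrite lerDl sqr_ge0.
by rewrite lerDr sqr_ge0.
Qed.

Lemma enorm_le_sum z : enorm z <= `|z.1| + `|z.2|.
Proof.
rewrite -(@ler_pXn2r _ 2) ?nnegrE ?enorm_ge0 ?addr_ge0// enorm_sqr sqrrD !real_normK ?num_real//.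
by rewrite -addrA lerD2l lerDr mulrn_wge0 ?mulr_ge0.
Qed.

Lemma enorm_eq0 z : enorm z = 0 -> z = 0.
Proof.
have [h1 h2] := enorm_ge_coord z => z0; move: h1 h2; rewrite z0 !normr_le0.
by case: z z0 => a b _ /= /eqP -> /eqP ->.
Qed.

Lemma enorm_gt0 z : z != 0 -> 0 < enorm z.
Proof.
rewrite lt_neqAle enorm_ge0 andbT => z0; apply: contra z0 => /eqP/esym/enorm_eq0 ->//.
Qed.

Lemma measurable_enorm D : measurable_fun D (@enorm R).
Proof.
apply: measurable_funTS; apply: (measurableT_comp (@measurable_sqrt _ setT)).
apply: measurable_funD; apply: measurable_funX;
  [exact: measurable_fst|exact: measurable_snd].
Qed.

Definition sqbox (r : R) : set (R * R) := `[- r, r] `*` `[- r, r].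

Lemma measurable_sqbox r : measurable (sqbox r).
Proof. by apply: measurableX; exact: measurable_itv. Qed.

Lemma sqboxP r y : sqbox r y <-> `|y.1| <= r /\ `|y.2| <= r.
Proof. by rewrite /sqbox /= !in_itv/= -!ler_norml. Qed.

Lemma tboxE n : tbox n = sqbox (n%:R * pi) :> set (R * R). Proof. by []. Qed.

Lemma leb2_sqbox (r : R) : 0 <= r -> leb2 (sqbox r) = ((2 * r) ^+ 2)%:E.
Proof.
move=> r0; have E : leb `[- r, r]%classic = (2 * r)%:E.
  rewrite lebesgue_measure_itv/= lte_fin.
  move: r0; rewrite le_eqVlt => /orP[/eqP <-|r0].
    by rewrite oppr0 ltxx mulr0.
  by rewrite ifT; [rewrite -EFinD; congr EFin; ring|lra].
have -> : leb2 (sqbox r) = (leb `[(- r)%R, r]%classic * leb `[(- r)%R, r]%classic)%E.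
  by apply: product_measure1E; exact: measurable_itv.
by rewrite E -EFinM expr2.
Qed.

Lemma leb2_tbox n : leb2 (tbox n) = ((2 * (n%:R * pi)) ^+ 2)%:E.
Proof. by rewrite leb2_sqbox// mulr_ge0// pi_ge0. Qed.

Lemma leb2_tbox_lty n : (leb2 (tbox n) < +oo)%E.
Proof. by rewrite leb2_tbox ltry. Qed.

(** Between the squares of half-sides [pi / 2^n] and [pi / 2^(n + 1)] the function
    is at most [2^(n + 1) / pi], and the area is of order [4^-n]. *)
Lemma integrable_inv_enorm :
  leb2.-integrable (tbox 1) (EFin \o (fun y => (enorm y)^-1)).
Proof.
have p0 : 0 < pi :> R := pi_gt0 R.
have minv : measurable_fun (tbox 1) (fun y : R * R => (enorm y)^-1).
  exact: (measurableT_comp (@measurable_invr R setT) (@measurable_enorm _)).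
apply/integrableP; split; first exact/measurable_EFinP.
pose G n (y : R * R) : \bar R := ((2 ^+ n.+1 / pi)%:E * (\1_(sqbox (pi / 2 ^+ n)) y)%:E)%E.
have G0 n y : (0 <= G n y)%E.
  by rewrite mule_ge0// lee_fin// divr_ge0// ltW.
have mG n : measurable_fun (tbox 1) (G n).
  apply: emeasurable_funM => //; apply/measurable_EFinP; apply: measurable_indic.
  exact: measurable_sqbox.
have GE y : tbox 1 y -> ((enorm y)^-1%:E <= \sum_(n <oo) G n y)%E.
  move=> /[!tboxE] /sqboxP /=; rewrite mul1r => -[y1 y2].
  have [->|y0] := eqVneq y 0.
    by rewrite /enorm /= expr0n/= addr0 sqrtr0 invr0; exact: nneseries_ge0.
  pose m := Num.max `|y.1| `|y.2|.
  have m0 : 0 < m.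
    rewrite lt_max !normr_gt0; apply/orP; move: y0; rewrite -pair_eqE /= negb_and.
    by move/orP.
  have mp : m <= pi by rewrite ge_max y1 y2.
  have mE : m <= enorm y by have [h1 h2] := enorm_ge_coord y; rewrite ge_max h1 h2.
  have ex : exists n, pi / 2 ^+ n.+1 < m.
    exists (Num.bound (pi / m)); rewrite ltr_pdivrMr ?exprn_gt0// mulrC -ltr_pdivrMr//.
    have /archi_boundP h : 0 <= pi / m by rewrite divr_ge0// ltW.
    apply: (lt_trans h); rewrite exprS.
    apply: (@lt_le_trans _ _ (2 ^+ Num.bound (pi / m))).
      by rewrite -natrX ltr_nat ltn_expl.
    by rewrite ler_peMl// ?exprn_ge0// ler1n.
  have [n hn nmin] := ex_minnP ex.
  have yn : sqbox (pi / 2 ^+ n) y.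
    apply/sqboxP; suff : m <= pi / 2 ^+ n by rewrite ge_max => /andP[].
    case: n nmin {hn} => [_|n nmin]; first by rewrite expr0 divr1.
    by rewrite leNgt; apply/negP => /nmin; rewrite ltnn.
  apply: (@le_trans _ _ (G n y)).
    rewrite /G indicE mem_set// mule1 lee_fin -[leRHS]invrK invf_div.
    by rewrite lef_pV2 ?posrE ?divr_gt0 ?exprn_gt0 ?enorm_gt0// (le_trans (ltW hn)).
  apply: le_trans (@nneseries_lim_ge _ (G ^~ y) xpredT 0 n.+1 _) => //.
  by rewrite big_nat_recr//= leeDr// sume_ge0.
apply: (@le_lt_trans _ _ (\int[leb2]_(y in tbox 1) \sum_(n <oo) G n y)%E).
  apply: ge0_le_integral => //.
  - exact: measurable_tbox.
  - by apply: measurableT_comp => //; exact/measurable_EFinP.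
  - by apply: (@ge0_emeasurable_sum _ _ _ (tbox 1) G xpredT).
  - by move=> y Dy /=; rewrite ger0_norm ?invr_ge0 ?enorm_ge0// GE.
rewrite integral_nneseries//; last exact: measurable_tbox.
apply: (@le_lt_trans _ _ (\sum_(n <oo) ((16 * pi) / (2 ^ (n + 1))%:R)%:E)%E).
  apply: lee_nneseries => [n _ _|n _]; first by apply: integral_ge0 => y _.
  rewrite ge0_integralZl_EFin//; last 3 first.
  - exact: measurable_tbox.
  - by apply/measurable_EFinP; apply: measurable_indic; exact: measurable_sqbox.
  - by rewrite divr_ge0// ltW.
  rewrite integral_indic; [|exact: measurable_tbox|exact: measurable_sqbox].
  have r0 : 0 <= pi / 2 ^+ n :> R by rewrite divr_ge0// ltW.
  apply: (@le_trans _ _ ((2 ^+ n.+1 / pi)%:E * leb2 (sqbox (pi / 2 ^+ n)))%E).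
    apply: lee_wpmul2l; first by rewrite lee_fin divr_ge0// ltW.
    apply: le_measure; rewrite ?inE; last exact: subIsetl.
      by apply: measurableI; [exact: measurable_sqbox|exact: measurable_tbox].
    exact: measurable_sqbox.
  rewrite leb2_sqbox// -EFinM lee_fin addn1 natrX exprS le_eqVlt; apply/orP; left.
  have t0 : 2 ^+ n != 0 :> R by rewrite expf_neq0.
  clear - p0 t0; apply/eqP; move: pi p0 => p p0.
  by field; rewrite t0 (gt_eqF p0).
have := @cvg_geometric_eseries_half R (16 * pi) 0.
by move/cvg_lim => ->//; rewrite ltry.
Qed.

End plane_norm.

(** * The Riesz kernel *)

Section riesz_kernel.
Context {R : realType}.
Implicit Types y z a b : R * R.

(** The two components of vectors are indexed by booleans, as in [axis], so that
    each statement on components is proved once. *)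
Definition coord (i : bool) (z : R * R) : R := if i then z.2 else z.1.

Definition dist1 a b : R := `|a.1 - b.1| + `|a.2 - b.2|.

Definition riesz_coord i y : R := coord i (riesz y).

Lemma riesz_coordE i y : riesz_coord i y = coord i y / (2 * pi * enorm y ^+ 3).
Proof. by case: i. Qed.

Lemma riesz_coordN i y : riesz_coord i (- y) = - riesz_coord i y.
Proof. by rewrite !riesz_coordE enormN; case: i; rewrite /= mulNr. Qed.

Lemma coord_le_enorm i y : `|coord i y| <= enorm y.
Proof. by have [] := enorm_ge_coord y; case: i. Qed.

Lemma dist1_ge0 a b : 0 <= dist1 a b. Proof. by rewrite addr_ge0. Qed.

Lemma coord_dist1 i a b : `|coord i a - coord i b| <= dist1 a b.
Proof. by case: i; rewrite /dist1 ?lerDl ?lerDr. Qed.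

Lemma measurable_coord i D : measurable_fun D (coord i).
Proof.
by apply: measurable_funTS; case: i; [exact: measurable_snd|exact: measurable_fst].
Qed.

Lemma measurable_riesz_coord i D : measurable_fun D (riesz_coord i).
Proof.
apply: measurable_funTS.
rewrite (_ : riesz_coord i = fun y => coord i y * (2 * pi * enorm y ^+ 3)^-1); last first.
  by apply/funext => y; rewrite riesz_coordE.
apply: measurable_funM; first exact: measurable_coord.
apply: (measurableT_comp (@measurable_invr R setT)).
apply: measurable_funM => //; apply: measurable_funX; exact: measurable_enorm.
Qed.

Lemma twopi_ge1 : 1 <= 2 * pi :> R.
Proof. by have := @pi_ge2 R; lra. Qed.

Lemma riesz_coord_le i y : `|riesz_coord i y| <= (enorm y ^+ 2)^-1.
Proof.
have [->|y0] := eqVneq y 0.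
  by rewrite riesz_coordE; case: i; rewrite /= mul0r normr0 invr_ge0 exprn_ge0// enorm_ge0.
have e0 := enorm_gt0 y0; have p1 := twopi_ge1.
have q0 : 0 < 2 * pi * enorm y ^+ 3 by rewrite mulr_gt0 ?exprn_gt0//; lra.
rewrite riesz_coordE normrM normfV (gtr0_norm q0) ler_pdivrMr//.
rewrite (_ : _ * (_ * _) = 2 * pi * enorm y); last by field; rewrite gt_eqF.
by rewrite (le_trans (coord_le_enorm i y))// ler_peMl// enorm_ge0.
Qed.

Lemma coord_mul_riesz_le i j y : `|coord j y| * `|riesz_coord i y| <= (enorm y)^-1.
Proof.
have [->|y0] := eqVneq y 0.
  by rewrite (_ : coord j 0 = 0) ?normr0 ?mul0r ?invr_ge0 ?enorm_ge0//; case: j.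
have e0 := enorm_gt0 y0.
apply: le_trans (_ : enorm y * (enorm y ^+ 2)^-1 <= _).
  by apply: ler_pM => //; [exact: coord_le_enorm|exact: riesz_coord_le].
by rewrite le_eqVlt; apply/orP; left; apply/eqP; field; rewrite gt_eqF.
Qed.

Lemma enorm_lip a b : `|enorm a - enorm b| <= dist1 a b.
Proof.
have [ab0|ab0] := eqVneq (enorm a + enorm b) 0.
  have := enorm_ge0 a; have := enorm_ge0 b => b0 a0.
  have [-> ->] : enorm a = 0 /\ enorm b = 0 by split; lra.
  by rewrite subrr normr0 dist1_ge0.
have s0 : 0 < enorm a + enorm b by rewrite lt_neqAle eq_sym ab0 addr_ge0// enorm_ge0.
rewrite -(ler_pM2r s0) -[X in _ * X](gtr0_norm s0) -normrM -subr_sqr !enorm_sqr.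
have -> : a.1 ^+ 2 + a.2 ^+ 2 - (b.1 ^+ 2 + b.2 ^+ 2) =
  (a.1 - b.1) * (a.1 + b.1) + (a.2 - b.2) * (a.2 + b.2) by ring.
rewrite (le_trans (ler_normD _ _))// !normrM /dist1 mulrDl.
have [ha1 ha2] := enorm_ge_coord a; have [hb1 hb2] := enorm_ge_coord b.
by apply: lerD; apply: ler_wpM2l => //; rewrite (le_trans (ler_normD _ _))// lerD.
Qed.

(** Away from the origin the kernel, which is homogeneous of degree [-2], has
    a gradient of order [-3]. *)
Lemma riesz_coord_lip i (m : R) a b : 0 < m -> m <= enorm a -> m <= enorm b ->
  `|riesz_coord i a - riesz_coord i b| <= 4 * dist1 a b / m ^+ 3.
Proof.
move=> m0 ma mb; rewrite !riesz_coordE.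
set A := enorm a in ma *; set B := enorm b in mb *.
set D := dist1 a b; set x := coord i a; set z := coord i b.
have A0 : 0 < A by rewrite (lt_le_trans m0).
have B0 : 0 < B by rewrite (lt_le_trans m0).
have D0 : 0 <= D := dist1_ge0 a b.
have -> : x / (2 * pi * A ^+ 3) - z / (2 * pi * B ^+ 3) =
  (2 * pi)^-1 * ((x - z) / A ^+ 3 + z * (B - A) * (A ^+ 2 + A * B + B ^+ 2) / (A ^+ 3 * B ^+ 3)).
  by move: pi (pi_gt0 R) => p p0; field; rewrite ?(gt_eqF A0) ?(gt_eqF B0) (gt_eqF p0).
have p1 := twopi_ge1; rewrite normrM.
set E := (_ + _ in X in _ * X).
suff h : `|E| <= 4 * D / m ^+ 3.
  apply: le_trans h; rewrite ler_piMl// normfV ger0_norm; last lra.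
  by rewrite invf_le1//; lra.
have zB : `|z| <= B by exact: coord_le_enorm.
have BA : `|B - A| <= D by rewrite distrC; exact: enorm_lip.
have S0 : 0 <= A ^+ 2 + A * B + B ^+ 2.
  by rewrite !addr_ge0 ?mulr_ge0 ?sqr_ge0// ltW.
apply: (@le_trans _ _ (D / A ^+ 3 + B * D * (A ^+ 2 + A * B + B ^+ 2) / (A ^+ 3 * B ^+ 3))).
  apply: (le_trans (ler_normD _ _)); apply: lerD.
    rewrite normrM normfV (ger0_norm (exprn_ge0 3 (ltW A0))).
    apply: ler_wpM2r; last exact: coord_dist1.
    by rewrite invr_ge0 exprn_ge0// ltW.
  rewrite !normrM normfV (ger0_norm S0).
  have AB0 : 0 <= A ^+ 3 * B ^+ 3 by rewrite mulr_ge0// exprn_ge0// ltW.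
  rewrite (ger0_norm AB0); apply: ler_wpM2r; first by rewrite invr_ge0.
  by apply: ler_wpM2r => //; apply: ler_pM.
have inv2 (k : nat) (C : R) : m <= C -> (C ^+ k)^-1 <= (m ^+ k)^-1.
  move=> mC; rewrite lef_pV2 ?posrE ?exprn_gt0 ?(lt_le_trans m0 mC)//.
  by rewrite lerXn2r// nnegrE ltW// (lt_le_trans m0 mC).
have i0 (k : nat) (C : R) : m <= C -> 0 <= (C ^+ k)^-1.
  by move=> mC; rewrite invr_ge0 exprn_ge0// ltW// (lt_le_trans m0 mC).
have -> : D / A ^+ 3 + B * D * (A ^+ 2 + A * B + B ^+ 2) / (A ^+ 3 * B ^+ 3) =
  D * ((A ^+ 3)^-1 + (A ^+ 1)^-1 * (B ^+ 2)^-1 + (A ^+ 2)^-1 * (B ^+ 1)^-1 + (A ^+ 3)^-1).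
  by field; rewrite ?(gt_eqF A0) ?(gt_eqF B0).
have -> : 4 * D / m ^+ 3 = D * ((m ^+ 3)^-1 + (m ^+ 1)^-1 * (m ^+ 2)^-1 + (m ^+ 2)^-1 * (m ^+ 1)^-1 + (m ^+ 3)^-1).
  by field; rewrite ?(gt_eqF m0).
apply: ler_wpM2l => //; apply: lerD; [apply: lerD; [apply: lerD|]|]; rewrite ?inv2//.
  by apply: ler_pM; rewrite ?inv2 ?i0.
by apply: ler_pM; rewrite ?inv2 ?i0.
Qed.

End riesz_kernel.

(** * The lattice correction of the kernel *)

Section lattice.
Context {R : realType}.
Implicit Types (k : int * int) (y : R * R).

Definition sqrt_succ (n : nat) : R := Num.sqrt n.+1%:R.

Lemma esum_mule_le (T : choiceType) (D : set T) (a : \bar R) (f : T -> \bar R)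
    (B : R) : (0 <= a)%E -> (forall i, 0 <= f i)%E ->
  (\esum_(j in D) f j <= B%:E)%E -> (\esum_(j in D) (a * f j) <= a * B%:E)%E.
Proof.
move=> a0 f0 fB; apply: ge_ereal_sup => _ [F [finF FD] <-].
rewrite -ge0_mule_fsumr//; apply: lee_wpmul2l => //.
by apply: le_trans fB; apply: ereal_sup_ubound; exists F.
Qed.

Lemma sqrt_succ_ge1 n : 1 <= sqrt_succ n.
Proof. by rewrite -[leLHS]sqrtr1 ler_wsqrtr// ler1n. Qed.

Lemma sqrt_succ_gt0 n : 0 < sqrt_succ n.
Proof. exact: lt_le_trans ltr01 (sqrt_succ_ge1 n). Qed.

Lemma sqrt_succ_sqr n : sqrt_succ n ^+ 2 = n.+1%:R.
Proof. by rewrite sqr_sqrtr. Qed.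

(** The summand is at most six times the increment of [- 1 / sqrt (n + 1)], so
    the sum telescopes. *)
Lemma sum_sqrt_succ3 n : \sum_(i < n) (sqrt_succ i ^+ 3)^-1 <= 6 * (1 - (sqrt_succ n)^-1).
Proof.
elim: n => [|n ih].
  by rewrite big_ord0 mulr_ge0// subr_ge0 invf_le1 ?sqrt_succ_ge1 ?sqrt_succ_gt0.
rewrite big_ord_recr/=; apply: (le_trans (lerD ih (lexx _))).
have a0 := sqrt_succ_gt0 n; have b0 := sqrt_succ_gt0 n.+1.
have a1 := sqrt_succ_ge1 n.
have ba : sqrt_succ n.+1 ^+ 2 = sqrt_succ n ^+ 2 + 1 by rewrite !sqrt_succ_sqr -natr1.
move: (sqrt_succ n) (sqrt_succ n.+1) a0 b0 a1 ba => a b a0 b0 a1 ba.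
have ab : b <= 2 * a.
  by rewrite -(@ler_pXn2r _ 2) ?nnegrE ?mulr_ge0 ?ltW// ba; nra.
have E : b - a = (a + b)^-1.
  apply: (@mulIf _ (a + b)); first by rewrite gt_eqF ?addr_gt0.
  by rewrite mulVf ?gt_eqF ?addr_gt0//; nra.
rewrite -subr_ge0.
have -> : 6 * (1 - b^-1) - (6 * (1 - a^-1) + (a ^+ 3)^-1) =
    (6 * a ^+ 2 * (b - a) - b) / (a ^+ 3 * b).
  by field; rewrite (gt_eqF a0) (gt_eqF b0).
apply: divr_ge0; last by rewrite mulr_ge0 ?exprn_ge0 1?ltW.
rewrite E subr_ge0 ler_pdivlMr ?addr_gt0//.
by nra.
Qed.

(** A summable weight that dominates [1 / |y + 2 pi k|^3] for [y] in the box
    ([ztwopi_far]); unlike the latter it splits as a product. *)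
Definition lattice_weight k : R := ((sqrt_succ `|k.1|%N * sqrt_succ `|k.2|%N) ^+ 3)^-1.

Lemma lattice_weight_ge0 k : 0 <= lattice_weight k.
Proof. by rewrite invr_ge0 exprn_ge0// mulr_ge0// ltW// sqrt_succ_gt0. Qed.

Let c (n : nat) : \bar R := ((sqrt_succ n ^+ 3)^-1)%:E.

Let c_ge0 n : (0 <= c n)%E.
Proof. by rewrite lee_fin invr_ge0 exprn_ge0// ltW// sqrt_succ_gt0. Qed.

Let esum_nat : (\esum_(n in [set: nat]) c n <= 6%:E)%E.
Proof.
rewrite -nneseries_esumT//; apply: lime_le.
  by apply: is_cvg_nneseries.
apply: nearW => n; rewrite big_mkord sumEFin lee_fin (le_trans (sum_sqrt_succ3 n))//.
by rewrite ler_piMr// lerBlDr lerDl invr_ge0 ltW// sqrt_succ_gt0.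
Qed.

Let esum_int : (\esum_(n in [set: int]) c `|n|%N <= 12%:E)%E.
Proof.
rewrite (esumID (range Posz))//.
have -> : (12%:E = 6%:E + 6%:E :> \bar R)%E by rewrite -EFinD; congr EFin; ring.
apply: leeD.
  rewrite setTI (@esum_image _ _ _ _ _ (fun n : int => c `|n|%N)); last by move=> a b _ _ [].
  exact: esum_nat.
have -> : [set: int] `&` ~` range Posz = Negz @` setT.
  apply/seteqP; split=> x /=.
    by case: x => n [_ h]; [exfalso; apply: h; exists n|exists n].
  by move=> [n _ <-]; split => // -[].
rewrite (@esum_image _ _ _ _ _ (fun n : int => c `|n|%N)); last by move=> a b _ _ [].
apply: (@le_trans _ _ (\esum_(n in [set: nat]) c n)%E); last exact: esum_nat.
apply: le_esum => n _ /=; rewrite lee_fin.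
rewrite lef_pV2 ?posrE ?exprn_gt0 ?sqrt_succ_gt0// lerXn2r ?nnegrE ?(ltW (sqrt_succ_gt0 _))//.
by rewrite ler_wsqrtr// ler_nat.
Qed.

(** The weight is a product of a function of [k1] and a function of [k2], so its
    sum over the whole lattice is the square of a one-dimensional sum. *)
Lemma esum_lattice_weight_lty : (\esum_(k in [set k : int * int | k != 0%R]) (lattice_weight k)%:E < +oo)%E.
Proof.
apply: (@le_lt_trans _ _ (144%:E)%E); last by rewrite ltry.
apply: (@le_trans _ _ (\esum_(k in [set: int * int]) (lattice_weight k)%:E)%E).
  rewrite [leLHS]esum_mkcond; apply: le_esum => k _.
  by case: ifP => // _; rewrite lee_fin lattice_weight_ge0.
have -> : [set: int * int] = [set: int] `*`` (fun=> [set: int]).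
  by apply/seteqP; split.
have E : (\esum_(k in [set: int] `*`` (fun=> [set: int])) (lattice_weight k)%:E =
    \esum_(i in [set: int]) \esum_(j in [set: int]) (c `|i|%N * c `|j|%N))%E.
  rewrite esum_esum; last by move=> i j _ _; rewrite mule_ge0.
  by apply: eq_esum => k _; rewrite /lattice_weight /c -EFinM exprMn invfM.
rewrite E; apply: (@le_trans _ _ (\esum_(i in [set: int]) (12%:E * c `|i|%N))%E).
  apply: le_esum => i _; rewrite [leRHS]muleC; apply: esum_mule_le => //; exact: esum_int.
apply: (le_trans (esum_mule_le (B := 12) _ _ esum_int)) => //.
by rewrite -EFinM lee_fin -natrM.
Qed.

Definition lattice_mass : R := fine (\esum_(k in [set k : int * int | k != 0%R]) (lattice_weight k)%:E).

Lemma lattice_mass_ge0 : 0 <= lattice_mass.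
Proof. by apply: fine_ge0; apply: esum_ge0 => k _; rewrite lee_fin lattice_weight_ge0. Qed.

Lemma lattice_massE : (\esum_(k in [set k : int * int | k != 0%R]) (lattice_weight k)%:E = lattice_mass%:E)%E.
Proof.
rewrite fineK// ge0_fin_numE ?esum_lattice_weight_lty//.
by apply: esum_ge0 => k _; rewrite lee_fin lattice_weight_ge0.
Qed.

Lemma esum_lattice_weightZ (A : R) : 0 <= A ->
  (\esum_(k in [set k : int * int | k != 0%R]) (A * lattice_weight k)%:E <= (A * lattice_mass)%:E)%E.
Proof.
move=> A0; have -> : (\esum_(k in [set k : int * int | k != 0%R]) (A * lattice_weight k)%:E =
   \esum_(k in [set k : int * int | k != 0%R]) (A%:E * (lattice_weight k)%:E))%E.
  by apply: eq_esum => k _; rewrite EFinM.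
rewrite EFinM; apply: esum_mule_le; rewrite ?lee_fin//.
  by move=> k; rewrite lee_fin lattice_weight_ge0.
by rewrite lattice_massE.
Qed.

Let lattice_le (p q : int * int -> \bar R) (A : R) : 0 <= A ->
  (forall k, 0 <= p k)%E -> (forall k, 0 <= q k)%E ->
  (forall k, k != 0%R -> (p k <= q k + (A * lattice_weight k)%:E))%E ->
  (\esum_(k in [set k : int * int | k != 0%R]) p k <=
   \esum_(k in [set k : int * int | k != 0%R]) q k + (A * lattice_mass)%:E)%E.
Proof.
move=> A0 p0 q0 pq; apply: (@le_trans _ _
  (\esum_(k in [set k : int * int | k != 0%R]) (q k + (A * lattice_weight k)%:E))%E).
  by apply: le_esum => k /= k0; exact: pq.
rewrite esumD//; last by move=> k _; rewrite lee_fin mulr_ge0// lattice_weight_ge0.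
by apply: leeD => //; exact: esum_lattice_weightZ.
Qed.

(** A lattice sum is a difference of two nonnegative sums; the positive parts of
    [u] and [v] differ by no more than [u] and [v] do, and likewise the negative
    parts. The bounds by [B] make the four sums finite. *)
Lemma lattice_sum_dist (u v : int * int -> R) (A B : R) :
  0 <= A -> 0 <= B ->
  (forall k, k != 0 -> `|u k| <= B * lattice_weight k) ->
  (forall k, k != 0 -> `|v k| <= B * lattice_weight k) ->
  (forall k, k != 0 -> `|u k - v k| <= A * lattice_weight k) ->
  `|lattice_sum u - lattice_sum v| <= 2 * A * lattice_mass.
Proof.
move=> A0 B0 uB vB uv.
pose S (f : int * int -> \bar R) : \bar R := (\esum_(k in [set k : int * int | k != 0%R]) f k)%E.
have finp (f : int * int -> R) : (forall k, k != 0 -> `|f k| <= B * lattice_weight k) ->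
    S ((EFin \o f)^\+)%E \is a fin_num /\ S ((EFin \o f)^\-)%E \is a fin_num.
  move=> fB; split; rewrite ge0_fin_numE ?esum_ge0//.
    apply: (@le_lt_trans _ _ (B * lattice_mass)%:E); last exact: ltry.
    apply: le_trans (esum_lattice_weightZ B0); apply: le_esum => k /= /fB.
    rewrite funeposE /= -EFin_max lee_fin ge_max => fk; apply/andP; split.
      by rewrite (le_trans _ fk)// ler_norm.
    by rewrite mulr_ge0// lattice_weight_ge0.
  apply: (@le_lt_trans _ _ (B * lattice_mass)%:E); last exact: ltry.
    apply: le_trans (esum_lattice_weightZ B0); apply: le_esum => k /= /fB.
  rewrite funenegE /= -EFin_max lee_fin ge_max => fk; apply/andP; split.
    by rewrite (le_trans _ fk)// -normrN ler_norm.
  by rewrite mulr_ge0// lattice_weight_ge0.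
have diff (f g : int * int -> R) : (forall k, k != 0 -> `|f k - g k| <= A * lattice_weight k) ->
    (S ((EFin \o f)^\+) <= S ((EFin \o g)^\+) + (A * lattice_mass)%:E)%E /\
    (S ((EFin \o f)^\-) <= S ((EFin \o g)^\-) + (A * lattice_mass)%:E)%E.
  move=> fg; split; apply: lattice_le => // k /fg; rewrite ler_norml => /andP[h1 h2].
    rewrite !funeposE /= -!EFin_max -EFinD lee_fin ge_max; apply/andP; split.
      have : g k <= Num.max (g k) 0 by rewrite le_max lexx.
      lra.
    by rewrite addr_ge0 ?le_max ?lexx ?orbT// mulr_ge0// lattice_weight_ge0.
  rewrite !funenegE /= -!EFin_max -EFinD lee_fin ge_max; apply/andP; split.
    have : - g k <= Num.max (- g k) 0 by rewrite le_max lexx.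
    lra.
  by rewrite addr_ge0 ?le_max ?lexx ?orbT// mulr_ge0// lattice_weight_ge0.
have [pu nu] := finp _ uB; have [pv nv] := finp _ vB.
have [d1 d2] := diff _ _ uv.
have vu k : k != 0 -> `|v k - u k| <= A * lattice_weight k by rewrite distrC; exact: uv.
have [d3 d4] := diff _ _ vu.
rewrite /lattice_sum -/(S _) -/(S _) -/(S _) -/(S _).
move: d1 d2 d3 d4; rewrite -(fineK pu) -(fineK nu) -(fineK pv) -(fineK nv).
rewrite -!EFinD !lee_fin/= => d1 d2 d3 d4.
by rewrite ler_norml; apply/andP; split; lra.
Qed.

(** The lattice correction in [Rstar], written as a sum of differences of the
    kernel between [y] and [0]: each term decays like [|k|^-3]. *)
Definition lattice_corr (i : bool) (y : R * R) : R :=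
  lattice_sum (fun k => riesz_coord i (y + ztwopi k) - riesz_coord i (ztwopi k)).

Lemma riesz_coord_ztwopi i k : riesz_coord i (ztwopi k) =
  (if i then k.2%:~R else k.1%:~R) / enorm (ztwopi k) ^+ 3 :> R.
Proof.
have [e0|e0] := eqVneq (enorm (ztwopi k) : R) 0.
  by rewrite riesz_coordE e0 expr0n/= !(mulr0, invr0).
rewrite riesz_coordE; have := pi_gt0 R; rewrite /ztwopi.
case: i => /=; move: pi (enorm _) e0 => p e e0 p0;
  by field; rewrite e0 (gt_eqF p0).
Qed.

Lemma RstarE i y : coord i (Rstar y) = riesz_coord i y + lattice_corr i y.
Proof.
rewrite /lattice_corr; have -> : (fun k => riesz_coord i (y + ztwopi k) - riesz_coord i (ztwopi k)) =
    (fun k => riesz_coord i (y + ztwopi k) -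
      (if i then k.2%:~R else k.1%:~R) / enorm (ztwopi k) ^+ 3).
  by apply/funext => k; rewrite riesz_coord_ztwopi.
by case: i.
Qed.

(** With [N] the larger of [|k1|] and [|k2|], one coordinate of [y + 2 pi k] is
    at least [2 pi N - pi >= pi N], whereas both square roots are at most
    [sqrt (2 N)]. *)
Lemma ztwopi_far y k : tbox 1 y -> k != 0 ->
  sqrt_succ `|k.1|%N * sqrt_succ `|k.2|%N <= enorm (y + ztwopi k) :> R.
Proof.
rewrite tboxE => /sqboxP; rewrite mul1r => -[y1 y2] k0.
have p2 := @pi_ge2 R.
pose N := maxn `|k.1|%N `|k.2|%N.
have N1 : (1 <= N)%N.
  rewrite leq_max !absz_gt0; move: k0; rewrite -pair_eqE /= negb_and.
  by case/orP => ->; rewrite ?orbT.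
have NR : 1 <= N%:R :> R by rewrite ler1n.
have far (z : R) (m : int) : `|z| <= pi -> `|m|%N = N -> pi * N%:R <= `|z + 2 * pi * m%:~R|.
  move=> zp mN; rewrite addrC; apply: (@le_trans _ _ (`|2 * pi * m%:~R| - `|z|)); last exact: lerB_normD.
  rewrite normrM gtr0_norm; last lra.
  by rewrite -intr_norm -abszE mN /=; nra.
apply: (@le_trans _ _ (pi * N%:R)); last first.
  have [h1 h2] := enorm_ge_coord (y + ztwopi k).
  have [kk|kk] := leqP `|k.2|%N `|k.1|%N.
    by apply: le_trans h1; apply: far => //; rewrite /N (maxn_idPl kk).
  by apply: le_trans h2; apply: far => //; rewrite /N (maxn_idPr (ltnW kk)).
have sq (n : nat) : (n <= N)%N -> sqrt_succ n ^+ 2 <= (2 * N%:R).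
  move=> nN; rewrite sqrt_succ_sqr -natr1; have : n%:R <= N%:R :> R by rewrite ler_nat.
  lra.
rewrite -(@ler_pXn2r _ 2) ?nnegrE ?mulr_ge0 ?(ltW (sqrt_succ_gt0 _)) ?(ltW (pi_gt0 _))//.
rewrite !exprMn; apply: (@le_trans _ _ ((2 * N%:R) * (2 * N%:R))).
  by apply: ler_pM; rewrite ?sqr_ge0 ?sq// /N leq_max leqnn ?orbT.
rewrite -expr2 exprMn; apply: ler_wpM2r; first exact: sqr_ge0.
by rewrite lerXn2r ?nnegrE ?(ltW (pi_gt0 _)).
Qed.

Lemma riesz_translate_lip i y z k : tbox 1 y -> tbox 1 z -> k != 0 ->
  `|riesz_coord i (y + ztwopi k) - riesz_coord i (z + ztwopi k)| <= 4 * dist1 y z * lattice_weight k.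
Proof.
move=> yT zT k0; have -> : dist1 y z = dist1 (y + ztwopi k) (z + ztwopi k) :> R.
  by move: (ztwopi k) => w; rewrite /dist1 /=; congr (_ + _); congr (Num.norm _); ring.
by apply: riesz_coord_lip; rewrite ?ztwopi_far// mulr_gt0 ?sqrt_succ_gt0.
Qed.

Lemma tbox0 n : tbox n (0 : R * R).
Proof. by rewrite tboxE; apply/sqboxP; rewrite normr0 mulr_ge0// pi_ge0. Qed.

(** The singularities [2 pi k] of the terms stay away from the box, so each term
    is Lipschitz with a constant of order [|k|^-3], which is summable. *)
Lemma lattice_corr_lip i y z : tbox 1 y -> tbox 1 z ->
  `|lattice_corr i y - lattice_corr i z| <= 8 * lattice_mass * dist1 y z.
Proof.
move=> yT zT.
have bnd (x : R * R) : tbox 1 x -> dist1 x 0 <= 2 * pi.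
  rewrite tboxE => /sqboxP; rewrite mul1r /dist1 /= !subr0 => -[? ?].
  by rewrite mulr_natl mulr2n lerD.
have ub x : tbox 1 x -> forall k, k != 0 ->
    `|riesz_coord i (x + ztwopi k) - riesz_coord i (ztwopi k)| <= 4 * (2 * pi) * lattice_weight k.
  move=> xT k k0; rewrite -[X in _ - riesz_coord i X]add0r.
  apply: (le_trans (riesz_translate_lip i xT (tbox0 1) k0)).
  by apply: ler_wpM2r; [exact: lattice_weight_ge0|rewrite ler_wpM2l// bnd].
apply: (le_trans (lattice_sum_dist (A := 4 * dist1 y z) _ _ (ub _ yT) (ub _ zT) _)).
- by rewrite mulr_ge0// dist1_ge0.
- by rewrite !mulr_ge0// pi_ge0.
- move=> k k0; rewrite (_ : _ - _ - _ = riesz_coord i (y + ztwopi k) - riesz_coord i (z + ztwopi k)).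
    exact: riesz_translate_lip.
  by move: (riesz_coord i _) (riesz_coord i _) (riesz_coord i _) => p q r; ring.
by rewrite le_eqVlt; apply/orP; left; apply/eqP; ring.
Qed.

Lemma lattice_corr0 i : lattice_corr i 0 = 0.
Proof.
rewrite /lattice_corr /lattice_sum.
have E (k : int * int) : (EFin \o (fun k => riesz_coord i (0 + ztwopi k) - riesz_coord i (ztwopi k))) k = 0%E.
  by rewrite /= add0r subrr.
by rewrite !esum1 ?sube0//= => k _; rewrite ?funeposE ?funenegE E ?oppe0 maxxx.
Qed.

Definition lattice_corr_max : R := 8 * lattice_mass * (2 * pi).

Lemma lattice_corr_max_ge0 : 0 <= lattice_corr_max.
Proof. by rewrite !mulr_ge0 ?lattice_mass_ge0 ?pi_ge0. Qed.

Lemma lattice_corr_bound i y : tbox 1 y -> `|lattice_corr i y| <= lattice_corr_max.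
Proof.
move=> yT; have := lattice_corr_lip i yT (tbox0 1); rewrite lattice_corr0 subr0 => /le_trans; apply.
apply: ler_wpM2l; first by rewrite mulr_ge0// lattice_mass_ge0.
move: yT; rewrite tboxE => /sqboxP; rewrite mul1r /dist1 /= !subr0 => -[? ?].
by rewrite mulr_natl mulr2n lerD.
Qed.

End lattice.

(** * Lipschitz functions on boxes *)

Section lipschitz.
Context {R : realType}.
Local Notation leb := (@lebesgue_measure R).
Local Notation leb2 := (leb \x leb)%E.
Implicit Types (x y : R * R) (f : R * R -> R).

(** The increments are measured in the l^1 norm, which is what the mean value
    inequality along the two axes produces. *)
Definition lipon (X : set (R * R)) f (L : R) :=
  forall a b, X a -> X b -> `|f a - f b| <= L * dist1 a b.

Lemma tboxP n y : tbox n y <-> `|y.1| <= n%:R * pi /\ `|y.2| <= n%:R * pi.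
Proof. exact: sqboxP. Qed.

Lemma tboxN n y : tbox n y -> tbox n (- y).
Proof. by move=> /tboxP h; apply/tboxP; rewrite /= !normrN. Qed.

Lemma tboxD m n x y : tbox m x -> tbox n y -> tbox (m + n) (x + y).
Proof.
move=> /tboxP[x1 x2] /tboxP[y1 y2]; apply/tboxP; rewrite natrD mulrDl /=.
by split; rewrite (le_trans (ler_normD _ _))// lerD.
Qed.

Lemma tboxD1 n x y : tbox n x -> tbox 1 y -> tbox n.+1 (x + y).
Proof. by move=> xn y1; rewrite -addn1; exact: tboxD. Qed.

Lemma lipon_continuous X f L : lipon X f L -> {within X, continuous f}.
Proof.
move=> lf; apply/subspace_continuousP => x Xx; apply/cvgrPdist_lt => e e0.
have L0 : 0 < 2 * `|L| + 1 by rewrite ltr_wpDl// mulr_ge0.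
rewrite near_withinE; apply/nbhs_ballP; exists (e / (2 * `|L| + 1)).
  by rewrite /= divr_gt0.
move=> y [/= b1 b2] Xy; apply: le_lt_trans (lf _ _ Xx Xy) _.
have d : dist1 x y <= 2 * (e / (2 * `|L| + 1)).
  by move: b1 b2; rewrite /ball/= /dist1 => /ltW ? /ltW ?; rewrite mulr_natl mulr2n lerD.
apply: le_lt_trans (_ : `|L| * (2 * (e / (2 * `|L| + 1))) < e).
  apply: (le_trans (ler_norm _)); rewrite normrM (ger0_norm (dist1_ge0 _ _)).
  exact: ler_wpM2l.
rewrite !mulrA ltr_pdivrMr// -subr_gt0.
by rewrite [ltRHS](_ : _ = e)//; ring.
Qed.

Lemma lipon_measurable n f L : lipon (tbox n) f L -> measurable_fun (tbox n) f.
Proof.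
move=> /lipon_continuous; apply: continuous_within_measurable2.
exact: measurable_tbox.
Qed.

Lemma measurable_translate (e : R) x :
  measurable_fun setT (fun y : R * R => (e * y.1 + x.1, e * y.2 + x.2)).
Proof.
apply: measurable_fun_pair.
  exact: (measurableT_comp (measurable_affine e x.1)).
exact: (measurableT_comp (measurable_affine e x.2)).
Qed.

Lemma translateE (e : R) x y : (e * y.1 + x.1, e * y.2 + x.2) = x + e *: y.
Proof. by case: x y => [a b] [c d] /=; congr pair; rewrite addrC. Qed.

Lemma measurable_shift n f x (e : R) : `|e| = 1 -> measurable_fun (tbox n.+1) f ->
  tbox n x -> measurable_fun (tbox 1) (fun y => f (x + e *: y)).
Proof.
move=> e1 mf xn.
apply: (@eq_measurable_fun _ _ _ _ _
  ((f \_ (tbox n.+1)) \o (fun y : R * R => (e * y.1 + x.1, e * y.2 + x.2)))).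
  move=> y /[!inE] y1 /=; rewrite translateE patchE ifT// inE.
  apply: tboxD1 => //; apply/tboxP; move/tboxP : y1.
  rewrite (_ : (e *: y).1 = e * y.1)// (_ : (e *: y).2 = e * y.2)//.
  by rewrite !normrM e1 !mul1r.
apply: measurable_funTS; apply: measurableT_comp; last exact: measurable_translate.
apply/(measurable_restrictT _ _).1 => //; exact: measurable_tbox.
Qed.

End lipschitz.

(** * The principal value of Lipschitz functions *)

Section principal_value.
Context {R : realType}.
Local Notation leb := (@lebesgue_measure R).
Local Notation leb2 := (leb \x leb)%E.
Implicit Types (x y : R * R) (f : R * R -> R).

Lemma measurable_lattice_corr i : measurable_fun (tbox 1) (@lattice_corr R i).
Proof.
apply: (@lipon_measurable _ _ _ (8 * lattice_mass)) => a b Xa Xb.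
exact: lattice_corr_lip.
Qed.

(** The singular part of the kernel is odd, so only the odd part of [f] around
    [x] contributes to its principal value. *)
Definition sym_integrand (i : bool) f x y : R :=
  (f (x + y) - f (x - y)) / 2 * riesz_coord i y + f (x + y) * lattice_corr i y.

Definition riesz_op (i : bool) f x : R := (\int[leb2]_(y in tbox 1) sym_integrand i f x y)%R.

(** Dominates the symmetrised integrand of a function that is [L]-Lipschitz and
    bounded by [M]. *)
Definition sym_majorant (L M : R) y : R := 2 * L * (enorm y)^-1 + M * lattice_corr_max.

Lemma dist1_opp x y : dist1 (x + y) (x - y) = 2 * (`|y.1| + `|y.2|) :> R.
Proof.
rewrite /dist1 /= mulrDr -[2](@ger0_norm R)// -!normrM.
by congr (_ + _); congr (Num.norm _); ring.
Qed.

Lemma odd_kernel_bound (a b L : R) i y : 0 <= L ->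
  `|a - b| <= L * (2 * (`|y.1| + `|y.2|)) -> `|(a - b) / 2 * riesz_coord i y| <= 2 * L * (enorm y)^-1.
Proof.
move=> L0 h; rewrite normrM; apply: (@le_trans _ _ (L * (`|y.1| + `|y.2|) * `|riesz_coord i y|)).
  apply: ler_wpM2r => //; rewrite normrM (@ger0_norm _ 2^-1)// ler_pdivrMr//.
  by rewrite (le_trans h)// [leRHS]mulrC mulrCA.
rewrite -mulrA (mulrC 2) -mulrA; apply: ler_wpM2l => //.
rewrite mulrDl mulr_natl mulr2n; apply: lerD.
  exact: (coord_mul_riesz_le i false).
exact: (coord_mul_riesz_le i true).
Qed.

Lemma odd_diff_bound n f (L : R) i x y : 0 <= L -> lipon (tbox n.+1) f L ->
  tbox n x -> tbox 1 y ->
  `|(f (x + y) - f (x - y)) / 2 * riesz_coord i y| <= 2 * L * (enorm y)^-1.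
Proof.
move=> L0 lf xn y1; apply: odd_kernel_bound => //; rewrite -(dist1_opp x).
exact: lf (tboxD1 xn y1) (tboxD1 xn (tboxN y1)).
Qed.

Lemma sym_integrand_bound n f (L M : R) i x y : 0 <= L -> lipon (tbox n.+1) f L ->
  (forall z, tbox n.+1 z -> `|f z| <= M) -> tbox n x -> tbox 1 y ->
  `|sym_integrand i f x y| <= sym_majorant L M y.
Proof.
move=> L0 lf fM xn y1; rewrite (le_trans (ler_normD _ _))// lerD//.
  exact: odd_diff_bound lf xn y1.
rewrite normrM; apply: ler_pM => //; last exact: lattice_corr_bound.
by apply: fM; exact: tboxD1.
Qed.

Lemma measurable_sym_integrand n f L i x : lipon (tbox n.+1) f L -> tbox n x ->
  measurable_fun (tbox 1) (sym_integrand i f x).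
Proof.
move=> /lipon_measurable mf xn.
have m1 : measurable_fun (tbox 1) (fun y => f (x + y)).
  have := @measurable_shift _ n f x 1 (normr1 _) mf xn.
  by apply: eq_measurable_fun => y _; rewrite scale1r.
have m2 : measurable_fun (tbox 1) (fun y => f (x - y)).
  have := @measurable_shift _ n f x (-1) (normrN1 _) mf xn.
  by apply: eq_measurable_fun => y _; rewrite scaleN1r.
apply: measurable_funD; apply: measurable_funM => //; last exact: measurable_lattice_corr.
  by apply: measurable_funM => //; exact: measurable_funB.
exact: measurable_riesz_coord.
Qed.

Lemma integrable_sym_majorant (L M : R) : leb2.-integrable (tbox 1) (EFin \o sym_majorant L M).
Proof.
have -> : EFin \o sym_majorant L M = (fun y => ((2 * L)%:E * (EFin \o (fun z => (enorm z)^-1)%R) y)%E) \+ (EFin \o cst (M * lattice_corr_max)).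
  by apply/funext => y; rewrite /= -EFinM -EFinD.
apply: integrableD; first exact: measurable_tbox.
  by apply: integrableZl; [exact: measurable_tbox|exact: integrable_inv_enorm].
apply: (@bounded_integrable _ _ _ _ _ _ `|M * lattice_corr_max|) => //; first exact: measurable_tbox.
exact: leb2_tbox_lty.
Qed.


Lemma Rintegral_opp (h : R * R -> R) : measurable_fun setT h ->
  (\int[leb2]_y h (- y))%R = (\int[leb2]_y h y)%R.
Proof.
move=> mh; rewrite /Rintegral; congr fine.
have e1 : `|-1| = 1 :> R by rewrite normrN1.
rewrite -(integral_affine2 0 e1 (measurableT_comp (@EFin_measurable R setT) mh)).
apply: eq_integral => y _; congr (EFin (h _)).
by rewrite -[LHS]add0r -scaleN1r; exact/esym/translateE.
Qed.

Lemma measurable_pv_domain (eps : R) :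
  @measurable _ (measurableTypeR R * measurableTypeR R)%type (pv_domain eps).
Proof.
apply: measurableI; first exact: measurable_tbox.
rewrite [X in measurable X](_ : _ = setT `&` @enorm R @^-1` `]eps, +oo[%classic).
  by apply: measurable_enorm => //; exact: measurable_itv.
by rewrite setTI; apply/seteqP; split=> y /=; rewrite in_itv/= andbT.
Qed.

Lemma pv_domain_sub (eps : R) : pv_domain eps `<=` tbox 1.
Proof. exact: subIsetl. Qed.

Lemma leb2_pv_domain_lty (eps : R) : (leb2 (pv_domain eps) < +oo)%E.
Proof.
apply: le_lt_trans (leb2_tbox_lty 1); apply: le_measure; rewrite ?inE.
- exact: measurable_pv_domain.
- exact: measurable_tbox.
- exact: pv_domain_sub.
Qed.

Lemma pv_domainN (eps : R) y : pv_domain eps (- y) <-> pv_domain eps y.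
Proof.
suff h z : pv_domain eps z -> pv_domain eps (- z).
  by split => [/h|/h//]; rewrite opprK.
by move=> [z1 z2]; split; [exact: tboxN|rewrite /= enormN].
Qed.

Section truncation.
Variables (n : nat) (f : R * R -> R) (L M : R) (x : R * R) (i : bool).
Hypotheses (lf : lipon (tbox n.+1) f L)
  (fM : forall z, tbox n.+1 z -> `|f z| <= M) (xn : tbox n x).

Let f_shift (e : R) : `|e| = 1 -> measurable_fun (tbox 1) (fun y => f (x + e *: y)).
Proof. by move=> e1; apply: measurable_shift xn => //; exact: lipon_measurable lf. Qed.

Let mshift : measurable_fun (tbox 1) (fun y => f (x + y)).
Proof.
by have := f_shift (normr1 _); apply: eq_measurable_fun => y _; rewrite scale1r.
Qed.

Let mshiftN : measurable_fun (tbox 1) (fun y => f (x - y)).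
Proof.
by have := f_shift (normrN1 _); apply: eq_measurable_fun => y _; rewrite scaleN1r.
Qed.

Let fM' y : tbox 1 y -> `|f (x + y)| <= M.
Proof. by move=> y1; apply: fM; exact: tboxD1. Qed.

Let M0 : 0 <= M. Proof. exact: le_trans (fM' (tbox0 1)). Qed.

Let riesz_coord_trunc (eps : R) y : 0 < eps -> pv_domain eps y -> `|riesz_coord i y| <= (eps ^+ 2)^-1.
Proof.
move=> e0 [_ /= ey]; apply: (le_trans (riesz_coord_le _ _)).
rewrite lef_pV2 ?posrE ?exprn_gt0//; last exact: lt_trans ey.
by rewrite lerXn2r ?nnegrE ?enorm_ge0 ?(ltW e0) ?(ltW ey).
Qed.

Let sub_meas (eps : R) (h : R * R -> R) : measurable_fun (tbox 1) h ->
  measurable_fun (pv_domain eps) h.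
Proof. by apply: measurable_funS; [exact: measurable_tbox|exact: pv_domain_sub]. Qed.

Let int_frz (eps : R) : 0 < eps ->
  leb2.-integrable (pv_domain eps) (EFin \o (fun y => f (x + y) * riesz_coord i y)).
Proof.
move=> e0; apply: (@bounded_integrable _ _ _ _ _ _ (M * (eps ^+ 2)^-1)).
- exact: measurable_pv_domain.
- exact: leb2_pv_domain_lty.
- by apply: sub_meas; apply: measurable_funM => //; exact: measurable_riesz_coord.
move=> y Dy; rewrite normrM; apply: ler_pM => //; last exact: riesz_coord_trunc.
by apply: fM'; exact: pv_domain_sub Dy.
Qed.

Let int_frzN (eps : R) : 0 < eps ->
  leb2.-integrable (pv_domain eps) (EFin \o (fun y => f (x - y) * riesz_coord i y)).
Proof.
move=> e0; apply: (@bounded_integrable _ _ _ _ _ _ (M * (eps ^+ 2)^-1)).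
- exact: measurable_pv_domain.
- exact: leb2_pv_domain_lty.
- by apply: sub_meas; apply: measurable_funM => //; exact: measurable_riesz_coord.
move=> y Dy; rewrite normrM; apply: ler_pM => //; last exact: riesz_coord_trunc.
by apply: fM'; apply: tboxN; exact: pv_domain_sub Dy.
Qed.

Let int_fgk (eps : R) :
  leb2.-integrable (pv_domain eps) (EFin \o (fun y => f (x + y) * lattice_corr i y)).
Proof.
apply: (@bounded_integrable _ _ _ _ _ _ (M * lattice_corr_max)).
- exact: measurable_pv_domain.
- exact: leb2_pv_domain_lty.
- by apply: sub_meas; apply: measurable_funM => //; exact: measurable_lattice_corr.
move=> y Dy; have y1 := pv_domain_sub Dy; rewrite normrM.
by apply: ler_pM => //; [exact: fM'|exact: lattice_corr_bound].
Qed.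

Lemma pv_integrable (eps : R) : 0 < eps -> leb2.-integrable (pv_domain eps)
  (fun y => (f (x + y) * (coord i \o Rstar) y)%:E).
Proof.
move=> e0; have := integrableD (measurable_pv_domain eps) (int_frz e0) (int_fgk eps).
by apply: eq_integrable; [exact: measurable_pv_domain|move=> y _ /=; rewrite RstarE mulrDr].
Qed.

(** Substitution [y |-> - y]: the domain is symmetric and the kernel odd. *)
Let reflect (eps : R) : 0 < eps ->
  (\int[leb2]_(y in pv_domain eps) (f (x - y) * riesz_coord i y))%R =
  - (\int[leb2]_(y in pv_domain eps) (f (x + y) * riesz_coord i y))%R.
Proof.
move=> e0; have mD := measurable_pv_domain eps.
rewrite -mulN1r -RintegralZl//; last exact: int_frz.
rewrite Rintegral_mkcond [RHS]Rintegral_mkcond -[RHS]Rintegral_opp; last first.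
  apply/(measurable_restrictT _ mD); apply: sub_meas.
  by apply: measurable_funM => //; apply: measurable_funM => //; exact: measurable_riesz_coord.
apply: eq_Rintegral => y _; rewrite !patchE.
have -> : (- y \in pv_domain eps) = (y \in pv_domain eps).
  by apply/idP/idP => /[!inE] /pv_domainN.
by case: ifP => // _; rewrite riesz_coordN mulrN mulN1r opprK.
Qed.

(** Averaging the integral of [f (x + y) r y] with its reflection; both converge
    since the singularity is cut off. *)
Lemma pv_trunc_sym_integrand (eps : R) : 0 < eps ->
  pv_trunc (coord i \o Rstar) f x eps =
  (\int[leb2]_(y in pv_domain eps) sym_integrand i f x y)%R.
Proof.
move=> e0; have mD := measurable_pv_domain eps.
have I1 := int_frz e0; have I2 := int_frzN e0; have I3 := int_fgk eps.
have Z (h : R * R -> R) : leb2.-integrable (pv_domain eps) (EFin \o h) ->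
    leb2.-integrable (pv_domain eps) (EFin \o (fun y => 2^-1 * h y)).
  move=> Ih; have := integrableZl mD 2^-1 Ih.
  by apply: eq_integrable => // y _ /=; rewrite EFinM.
rewrite /pv_trunc.
transitivity (\int[leb2]_(y in pv_domain eps) (f (x + y) * riesz_coord i y + f (x + y) * lattice_corr i y))%R.
  by apply: eq_Rintegral => y _; rewrite /= RstarE mulrDr.
rewrite RintegralD//; symmetry.
transitivity (\int[leb2]_(y in pv_domain eps) ((2^-1 * (f (x + y) * riesz_coord i y) -
     2^-1 * (f (x - y) * riesz_coord i y)) + f (x + y) * lattice_corr i y))%R.
  by apply: eq_Rintegral => y _; rewrite /sym_integrand; congr (_ + _); field.
rewrite RintegralD//; last first.
  have := integrableB mD (Z _ I1) (Z _ I2).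
  by apply: eq_integrable.
rewrite RintegralB//; [|exact: Z|exact: Z].
by rewrite !RintegralZl// reflect//; congr (_ + _); field.
Qed.

(** Once symmetrised, the truncated integrals have integrands dominated by a
    single integrable function, and the truncation is eventually inactive at
    each point other than the origin, where the integrand vanishes. *)
Lemma pv_cvg : pv_trunc (coord i \o Rstar) f x eps @[eps --> 0^'+] --> riesz_op i f x.
Proof.
have L0 : 0 <= `|L| by [].
have lf' : lipon (tbox n.+1) f `|L|.
  move=> a b Xa Xb; apply: (le_trans (lf Xa Xb)).
  by apply: ler_wpM2r; [exact: dist1_ge0|exact: ler_norm].
have mS := measurable_sym_integrand i lf' xn.
apply: cvg_within_seq => h h0 hc.
have -> : (fun k => pv_trunc (coord i \o Rstar) f x (h k)) =
    (fun k => \int[leb2]_(y in tbox 1) (sym_integrand i f x \_ [set z | (h k < enorm z)%R]) y)%R.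
  by apply/funext => k; rewrite pv_trunc_sym_integrand// -Rintegral_mkcondr.
rewrite /riesz_op; apply: (@Rdominated_convergence _ _ _ leb2 (tbox 1)
  (fun k => sym_integrand i f x \_ [set z | h k < enorm z]) _ (sym_majorant `|L| M)).
- exact: measurable_tbox.
- move=> k; have mE : measurable [set z : R * R | h k < enorm z].
    rewrite [X in measurable X](_ : _ = setT `&` @enorm R @^-1` `]h k, +oo[%classic).
      by apply: measurable_enorm => //; exact: measurable_itv.
    by rewrite setTI; apply/seteqP; split=> y /=; rewrite in_itv/= andbT.
  apply: (@measurable_restrict _ _ _ _ [set z | h k < enorm z] (tbox 1) (sym_integrand i f x) mE (measurable_tbox 1)).1.
  by apply: measurable_funS mS; [exact: measurable_tbox|exact: subIsetl].
- move=> y y1; have [->|y0] := eqVneq y 0.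
    apply: cvg_near_cst; apply: nearW => k; rewrite patchE.
    case: ifPn => // _; rewrite /sym_integrand lattice_corr0 mulr0 addr0 riesz_coordE.
    by case: i; rewrite /= mul0r mulr0.
  apply: cvg_near_cst; move/cvgrPdist_lt: hc => /(_ _ (enorm_gt0 y0)).
  apply: filterS => k; rewrite sub0r normrN (gtr0_norm (h0 k)) => hk.
  by rewrite patchE ifT// inE.
- exact: integrable_sym_majorant.
- move=> k y y1; rewrite patchE; case: ifPn => _.
    exact: sym_integrand_bound lf' fM xn y1.
  rewrite normr0; apply: le_trans (sym_integrand_bound i L0 lf' fM xn y1) => //.
Qed.

Lemma pv_integralE : pv_integral (coord i \o Rstar) f x = riesz_op i f x.
Proof. by apply: cvg_lim => //; exact: pv_cvg. Qed.

Lemma pv_existsP : pv_exists (coord i \o Rstar) f x.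
Proof.
split; first by move=> eps; exact: pv_integrable.
by apply/cvg_ex; exists (riesz_op i f x); exact: pv_cvg.
Qed.

End truncation.

Lemma Rtilde_riesz_op n f (L M : R) x : lipon (tbox n.+1) f L ->
  (forall z, tbox n.+1 z -> `|f z| <= M) -> tbox n x ->
  Rtilde f x = (riesz_op false f x, riesz_op true f x).
Proof.
move=> lf fM xn; congr pair.
  exact: (pv_integralE false lf fM xn).
exact: (pv_integralE true lf fM xn).
Qed.

Lemma Rtilde_well_definedP n f (L M : R) x : lipon (tbox n.+1) f L ->
  (forall z, tbox n.+1 z -> `|f z| <= M) -> tbox n x ->
  Rtilde_well_defined f x.
Proof. by move=> lf fM xn; split; [exact: (pv_existsP false lf fM xn)|exact: (pv_existsP true lf fM xn)]. Qed.

(** The integral of [sym_majorant 1 1] over the box. *)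
Definition riesz_op_const : R := 2 * \int[leb2]_(y in tbox 1) (enorm y)^-1 +
  lattice_corr_max * (2 * pi) ^+ 2.

Lemma int_inv_enorm_ge0 : 0 <= \int[leb2]_(y in tbox 1) (enorm y)^-1 :> R.
Proof. by apply: Rintegral_ge0 => y _; rewrite invr_ge0 enorm_ge0. Qed.

Lemma riesz_op_const_ge0 : 0 <= riesz_op_const.
Proof. by rewrite addr_ge0// mulr_ge0 ?lattice_corr_max_ge0 ?sqr_ge0// int_inv_enorm_ge0. Qed.

Lemma Rintegral_sym_majorant (L M : R) : (\int[leb2]_(y in tbox 1) sym_majorant L M y)%R =
  2 * L * (\int[leb2]_(y in tbox 1) (enorm y)^-1)%R + M * lattice_corr_max * (2 * pi) ^+ 2.
Proof.
rewrite /sym_majorant RintegralD//.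
- rewrite RintegralZl//; last 2 first.
    exact: measurable_tbox.
    exact: integrable_inv_enorm.
  rewrite Rintegral_cst; last exact: measurable_tbox.
  have E : fine (leb2 (tbox 1)) = (2 * pi) ^+ 2 by rewrite leb2_tbox mul1r.
  by rewrite -E.
- exact: measurable_tbox.
- have mT : @measurable _ (measurableTypeR R * measurableTypeR R)%type (tbox 1).
    exact: measurable_tbox.
  have := integrableZl mT (2 * L) integrable_inv_enorm.
  by apply: eq_integrable; [exact: measurable_tbox|move=> y _].
- apply: (@bounded_integrable _ _ _ _ _ _ `|M * lattice_corr_max|) => //; first exact: measurable_tbox.
  exact: leb2_tbox_lty.
Qed.

Lemma riesz_op_bound i f n (L M N : R) x : lipon (tbox n.+1) f L ->
  (forall z, tbox n.+1 z -> `|f z| <= M) -> tbox n x ->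
  0 <= L -> L <= N -> M <= N ->
  `|riesz_op i f x| <= riesz_op_const * N.
Proof.
move=> lf fM xn L0 LN MN; apply: (@le_trans _ _ (\int[leb2]_(y in tbox 1) sym_majorant L M y)%R).
  apply: norm_Rintegral_le.
  - exact: measurable_tbox.
  - exact: measurable_sym_integrand lf xn.
  - exact: integrable_sym_majorant.
  - by move=> y y1; exact: sym_integrand_bound lf fM xn y1.
rewrite Rintegral_sym_majorant /riesz_op_const [leRHS]mulrDl; apply: lerD.
  by rewrite mulrAC ler_wpM2l// mulr_ge0// int_inv_enorm_ge0.
move: (2 * pi) lattice_corr_max (@lattice_corr_max_ge0 R) => p g g0.
rewrite (mulrC M) -!mulrA; apply: ler_wpM2l => //.
by rewrite mulrC mulrA; apply: ler_wpM2l => //; exact: sqr_ge0.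
Qed.

End principal_value.

(** * A discrete Hilbert inequality at the half-integers *)

Section half_integer_hilbert.
Context {R : realType}.

Definition half_inv (m : nat) : R := (m%:R + 2^-1)^-1.

Lemma half_gt0 m : 0 < m%:R + 2^-1 :> R.
Proof. by rewrite ltr_wpDl. Qed.

Lemma half_inv_gt0 m : 0 < half_inv m.
Proof. by rewrite invr_gt0 half_gt0. Qed.

(** The summand is at most three times [half_inv m - half_inv m.+1], so the sum
    telescopes. *)
Lemma sum_half_inv_sqr M : \sum_(m < M) half_inv m ^+ 2 <= 6.
Proof.
suff : \sum_(m < M) half_inv m ^+ 2 <= 3 * (2 - half_inv M).
  by move/le_trans; apply; have := half_inv_gt0 M; lra.
elim: M => [|M ih].
  by rewrite big_ord0 /half_inv add0r invrK; lra.
rewrite big_ord_recr/=; apply: (le_trans (lerD ih (lexx _))).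
have -> : half_inv M.+1 = (M%:R + 1 + 2^-1)^-1 by rewrite /half_inv -natr1.
rewrite /half_inv; have : 0 <= M%:R :> R by [].
move: (M%:R : R) => u u0; rewrite -subr_ge0.
have -> : 3 * (2 - (u + 1 + 2^-1)^-1) - (3 * (2 - (u + 2^-1)^-1) + (u + 2^-1)^-1 ^+ 2)
  = 16 * u / ((2 * u + 3) * (2 * u + 1) ^+ 2).
  by field; rewrite !gt_eqF//; lra.
by rewrite divr_ge0 ?mulr_ge0 ?sqr_ge0//; lra.
Qed.

(** A Toeplitz-minus-Hankel form. The partial fractions
    [1 / (a b) = (1 / a - 1 / b) / (b - a) = (1 / a + 1 / b) / (a + b)] at the
    half-integers [a = m + 1/2], [b = n + 1/2] turn both sums, off the diagonal,
    into sums of [B d / d] over intervals of integers; all but the terms with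
    [M - m <= d <= M + m] cancel. *)
Lemma hilbert_form_identity M (B : nat -> R) :
  \sum_(m < M) \sum_(n < M) half_inv m * half_inv n * (B ((m - n) + (n - m))%N - B (m + n).+1) =
  B 0%N * \sum_(m < M) half_inv m ^+ 2 -
  2 * \sum_(m < M) half_inv m * \sum_(M - m <= d < M + m.+1) B d / d%:R.
Proof.
pose K d : R := B d / d%:R.
pose kap (m n : nat) : R := B ((m - n) + (n - m))%N / (n%:R - m%:R).
have K0 : K 0%N = 0 by rewrite /K invr0 mulr0.
have kapC m n : kap n m = - kap m n.
  by rewrite /kap addnC -(opprB m%:R) invrN mulrN opprK.
have E (m n : nat) : half_inv m * half_inv n * (B ((m - n) + (n - m))%N - B (m + n).+1) =
    (if m == n then B 0%N * half_inv m ^+ 2 else 0) +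
    ((half_inv m - half_inv n) * kap m n - (half_inv m + half_inv n) * K (m + n).+1).
  have H2 : half_inv m * half_inv n * B (m + n).+1 = (half_inv m + half_inv n) * K (m + n).+1.
    have -> : K (m + n).+1 = B (m + n).+1 / (m%:R + n%:R + 1).
      by rewrite /K -natr1 natrD.
    rewrite /half_inv; have m0 := half_gt0 m; have n0 := half_gt0 n.
    move: (B _) (m%:R : R) (n%:R : R) m0 n0 => b u v m0 n0.
    by field; rewrite !gt_eqF//; lra.
  rewrite mulrBr H2 addrA; congr (_ - _).
  have [->|mn] := eqVneq m n.
    by rewrite subnn subrr mul0r addr0 expr2 mulrC.
  have mnR : m%:R != n%:R :> R by rewrite eqr_nat.
  have -> : half_inv m * half_inv n = (half_inv m - half_inv n) / (n%:R - m%:R).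
    rewrite /half_inv; have m0 := half_gt0 m; have n0 := half_gt0 n.
    move: (m%:R : R) (n%:R : R) mnR m0 n0 => u v uv m0 n0.
    have vu : v - u != 0 by rewrite subr_eq0 eq_sym.
    by field; rewrite vu !gt_eqF//; lra.
  by rewrite add0r /kap mulrAC mulrA.
have sumE : \sum_(m < M) \sum_(n < M)
     half_inv m * half_inv n * (B ((m - n) + (n - m))%N - B (m + n).+1) =
    B 0%N * \sum_(m < M) half_inv m ^+ 2 +
    2 * \sum_(m < M) half_inv m * (\sum_(n < M) kap m n - \sum_(n < M) K (m + n).+1).
  transitivity (\sum_(m < M) (B 0%N * half_inv m ^+ 2 + (half_inv m * \sum_(n < M) kap m n
     - \sum_(n < M) half_inv n * kap m n - half_inv m * (\sum_(n < M) K (m + n).+1)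
     - \sum_(n < M) half_inv n * K (m + n).+1))).
    apply: eq_bigr => m _; under eq_bigr => n _ do rewrite E.
    rewrite big_split /=; congr (_ + _).
      rewrite (bigD1 m)//= eqxx big1 ?addr0// => n nm.
      by rewrite ifN// eq_sym.
    rewrite !mulr_sumr -!sumrB; apply: eq_bigr => n _; ring.
  rewrite big_split /= -mulr_sumr; congr (_ + _).
  rewrite !big_split /= !sumrN.
  have -> : \sum_(m < M) \sum_(n < M) half_inv n * kap m n =
      - \sum_(m < M) half_inv m * \sum_(n < M) kap m n.
    rewrite exchange_big /= -sumrN; apply: eq_bigr => m _.
    rewrite mulr_sumr -sumrN; apply: eq_bigr => n _.
    by rewrite kapC mulrN.
  have -> : \sum_(m < M) \sum_(n < M) half_inv n * K (m + n).+1 =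
      \sum_(m < M) half_inv m * \sum_(n < M) K (m + n).+1.
    rewrite exchange_big /=; apply: eq_bigr => m _.
    by rewrite mulr_sumr; apply: eq_bigr => n _; rewrite addnC.
  under [in RHS]eq_bigr => m _ do rewrite mulrBr.
  by rewrite sumrB; ring.
rewrite sumE -mulrN -sumrN; congr (_ + 2 * _); apply: eq_bigr => m _.
rewrite -mulrN; congr (_ * _).
have mM := ltn_ord m.
have -> : \sum_(n < M) kap m n = \sum_(0 <= d < M - m) K d - \sum_(0 <= d < m.+1) K d.
  rewrite -(big_mkord xpredT (fun n => kap m n)) (@big_cat_nat _ _ _ m)//=; last exact: ltnW.
  rewrite addrC; congr (_ + _).
    rewrite -{1}[nat_of_ord m]add0n big_addn; apply: eq_bigr => d _.
    rewrite /kap /K natrD addrK; congr (B _ / _).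
    by lia.
  rewrite big_nat_recl// K0 add0r -sumrN big_nat_rev /=.
  rewrite !big_nat; apply: eq_bigr => d /andP[_ dm].
  rewrite /kap /K add0n (_ : (m - (m - d.+1) + (m - d.+1 - m))%N = d.+1); last by lia.
  have -> : (m - d.+1)%:R - m%:R = - d.+1%:R :> R by rewrite natrB//; ring.
  by rewrite invrN mulrN.
have -> : \sum_(n < M) K (m + n).+1 = \sum_(0 <= d < M + m.+1) K d - \sum_(0 <= d < m.+1) K d.
  rewrite (@big_cat_nat _ _ _ m.+1 0 (M + m.+1))//=; last by lia.
  rewrite addrAC subrr add0r -{1}[m.+1]add0n big_addn addnK big_mkord.
  by apply: eq_bigr => n _; rewrite addnS addnC.
rewrite (@big_cat_nat _ _ _ (M - m) 0 (M + m.+1))//=; last by lia.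
by ring.
Qed.

(** Since [m + 1/2 + d >= M], the product [half_inv m / d] is at most
    [(half_inv m + 1 / d) / M]. The row [m] has [2 m + 1] terms, which
    compensates [half_inv m]; the value [d] occurs in at most [min (d, M)] rows,
    which compensates [1 / d]. Each half of the sum is thus at most [2]. *)
Lemma hilbert_tail_bound M :
  \sum_(m < M) half_inv m * \sum_(M - m <= d < M + m.+1) (d%:R)^-1 <= 4 :> R.
Proof.
case: M => [|M']; first by rewrite big_ord0.
set M := M'.+1; have M0 : 0 < M%:R :> R by rewrite ltr0n.
have pt (m d : nat) : (m < M)%N -> (M - m <= d)%N ->
    half_inv m * d%:R^-1 <= M%:R^-1 * (half_inv m + d%:R^-1).
  move=> mM dM; have d0 : 0 < d%:R :> R by rewrite ltr0n; lia.
  have sM : M%:R <= m%:R + d%:R :> R by rewrite -natrD ler_nat; lia.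
  have m0 := half_gt0 m; rewrite /half_inv.
  move: (M%:R : R) (m%:R : R) (d%:R : R) M0 d0 sM m0 => a u b a0 b0 ab u0.
  rewrite -subr_ge0.
  have -> : a^-1 * ((u + 2^-1)^-1 + b^-1) - (u + 2^-1)^-1 * b^-1 =
    (u + 2^-1 + b - a) / (a * (u + 2^-1) * b).
    by field; rewrite !gt_eqF//; lra.
  by rewrite divr_ge0 ?mulr_ge0//; lra.
apply: (@le_trans _ _ (\sum_(m < M) \sum_(M - m <= d < M + m.+1)
    M%:R^-1 * (half_inv m + d%:R^-1))).
  apply: ler_sum => m _; rewrite mulr_sumr !big_nat; apply: ler_sum => d /andP[dm _].
  exact: pt.
under eq_bigr => m _ do rewrite -mulr_sumr big_split /=.
rewrite -mulr_sumr big_split /= mulrC ler_pdivrMr//.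
have -> : 4 * M%:R = 2 * M%:R + 2 * M%:R :> R by ring.
apply: lerD.
  apply: (@le_trans _ _ (\sum_(m < M) (2:R))); last by rewrite sumr_const card_ord mulr_natr.
  apply: ler_sum => m _; rewrite sumr_const_nat.
  have -> : (M + m.+1 - (M - m) = m + m.+1)%N by have := ltn_ord m; lia.
  have -> : half_inv m *+ (m + m.+1) = (m%:R + (m%:R + 1)) / (m%:R + 2^-1).
    by rewrite -[LHS]mulr_natl natrD -natr1.
  by have m0 := half_gt0 m; rewrite ler_pdivrMr//; lra.
apply: (@le_trans _ _ (\sum_(m < M) \sum_(0 <= d < M + M)
    (if (M - m <= d)%N then (d%:R^-1 : R) else 0))).
  apply: ler_sum => m _; have mM := ltn_ord m.
  rewrite (big_nat_widenl _ 0)// (big_nat_widen _ _ (M + M)); last by lia.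
  rewrite [leLHS]big_mkcond /=; apply: ler_sum => d _.
  by case: ifP => [/andP[-> _]//|_]; case: ifP.
rewrite exchange_big /=.
apply: (@le_trans _ _ (\sum_(0 <= d < M + M) (1 : R))); last first.
  by rewrite sumr_const_nat subn0 natrD mulr2n mulrDl !mul1r.
apply: ler_sum => d _.
rewrite (reindex_inj rev_ord_inj) /=.
have -> : \sum_(m < M) (if (M - (M - m.+1) <= d)%N then d%:R^-1 else 0) =
    \sum_(0 <= m < M | (m < d)%N) (d%:R^-1 : R).
  rewrite big_mkord [RHS]big_mkcond /=; apply: eq_bigr => m _.
  by rewrite (_ : M - (M - m.+1) = m.+1)%N//; have := ltn_ord m; lia.
have [dM|Md] := leqP d M.
  rewrite -(big_nat_widen _ _ _ xpredT)// sumr_const_nat subn0 -[leLHS]mulr_natl.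
  have [->|d0] := eqVneq d 0%N; first by rewrite mul0r ler01.
  by rewrite divff// pnatr_eq0.
rewrite big_mkcond /=; apply: (@le_trans _ _ (\sum_(0 <= m < M) (d%:R^-1 : R))).
  by apply: ler_sum => m _; case: ifP.
rewrite sumr_const_nat subn0 -[leLHS]mulr_natl ler_pdivrMr ?ltr0n; last by lia.
by rewrite mul1r ler_nat ltnW.
Qed.

(** This is where boundedness of the Hilbert transform on L^2 comes from: the
    bound does not depend on [M]. *)
Lemma hilbert_form_bound M (B : nat -> R) (b : R) : (forall d, `|B d| <= b) ->
  \sum_(m < M) \sum_(n < M) half_inv m * half_inv n * (B ((m - n) + (n - m))%N - B (m + n).+1)
  <= 14 * b.
Proof.
move=> Bb; rewrite hilbert_form_identity.
have b0 : 0 <= b by apply: le_trans (Bb 0%N).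
have -> : 14 * b = b * 6 + 2 * (4 * b) by ring.
rewrite -mulrN; apply: lerD.
  apply: (le_trans (ler_norm _)); rewrite normrM.
  apply: ler_pM => //; rewrite ger0_norm ?sum_half_inv_sqr//.
  by apply: sumr_ge0 => m _; exact: sqr_ge0.
apply: ler_wpM2l => //; apply: (le_trans (ler_norm _)); rewrite normrN.
apply: (@le_trans _ _ (\sum_(m < M) half_inv m * \sum_(M - m <= d < M + m.+1) (d%:R)^-1 * b)).
  apply: (le_trans (ler_norm_sum _ _ _)); apply: ler_sum => m _.
  rewrite normrM (gtr0_norm (half_inv_gt0 m)); apply: ler_wpM2l; first exact/ltW/half_inv_gt0.
  apply: (le_trans (ler_norm_sum _ _ _)).
  apply: ler_sum => d _; rewrite normrM mulrC normfV normr_nat.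
  by apply: ler_wpM2l.
under eq_bigr => m _ do rewrite -mulr_suml mulrA.
by rewrite -mulr_suml; apply: ler_wpM2r => //; exact: hilbert_tail_bound.
Qed.

End half_integer_hilbert.

(** * Discretised Hilbert transforms along a direction *)

Section hilbert_translations.
Context {R : realType}.
Local Notation leb := (@lebesgue_measure R).
Local Notation leb2 := (leb \x leb)%E.
Implicit Types (x a b u v w : R * R) (f h : R * R -> R).

Lemma Rintegral_sum d (T : measurableType d) (mu : {measure set T -> \bar R})
    (D : set T) (I : Type) (s : seq I) (F : I -> T -> R) :
  measurable D -> (forall i, mu.-integrable D (EFin \o F i)) ->
  (\int[mu]_(x in D) (\sum_(i <- s) F i x))%R = \sum_(i <- s) (\int[mu]_(x in D) F i x)%R.
Proof.
move=> mD iF; elim: s => [|i s ih].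
  rewrite big_nil; under eq_Rintegral => x _ do rewrite big_nil.
  by rewrite Rintegral_cst// mul0r.
rewrite big_cons -ih; under eq_Rintegral => x _ do rewrite big_cons.
rewrite RintegralD//.
have := @integrable_sum _ _ _ mu D mD I s xpredT (fun i => EFin \o F i) (fun i _ => iF i).
by apply: eq_integrable => // x _ /=; rewrite sumEFin.
Qed.

Lemma measurable_shiftT f v : measurable_fun setT f ->
  measurable_fun setT (fun x => f (x + v)).
Proof.
move=> mf; have := measurableT_comp mf (measurable_translate 1 v).
by apply: eq_measurable_fun => x _ /=; rewrite translateE scale1r addrC.
Qed.

Lemma ge0_integral_shift (h : R * R -> \bar R) v : measurable_fun setT h ->
  (forall x, 0 <= h x)%E -> (\int[leb2]_x h (x + v)%R = \int[leb2]_x h x)%E.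
Proof.
move=> mh h0; rewrite -[RHS](ge0_integral_affine2 v (normr1 R) mh h0).
apply: eq_integral => x _; congr (h _).
by rewrite -[x in LHS]scale1r addrC; exact/esym/translateE.
Qed.

Lemma Rintegral_shift h v : measurable_fun setT h ->
  (\int[leb2]_x h (x + v))%R = (\int[leb2]_x h x)%R.
Proof.
move=> mh; rewrite /Rintegral; congr fine.
rewrite -[RHS](integral_affine2 v (normr1 R) (measurableT_comp (@EFin_measurable R setT) mh)).
apply: eq_integral => x _; congr (EFin (h _)).
by rewrite -[x in LHS]scale1r addrC; exact/esym/translateE.
Qed.

Lemma integrable_shift h v : leb2.-integrable setT (EFin \o h) ->
  leb2.-integrable setT (EFin \o (fun x => h (x + v))).
Proof.
move=> /integrableP[/measurable_EFinP mh ih]; apply/integrableP; split.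
  by apply/measurable_EFinP; exact: measurable_shiftT.
rewrite (ge0_integral_shift (h := fun x => `|(h x)%:E|%E))//.
by apply: measurableT_comp => //; exact/measurable_EFinP.
Qed.

Section autocorrelation.
Variable f : R * R -> R.
Hypotheses (mf : measurable_fun setT f)
  (if2 : leb2.-integrable setT (EFin \o (fun x => f x ^+ 2))).

Definition autocorr w : R := (\int[leb2]_x (f x * f (x + w)))%R.

Let mT : @measurable _ (measurableTypeR R * measurableTypeR R)%type setT.
Proof. exact: measurableT. Qed.

Lemma integrable_shift2 a b :
  leb2.-integrable setT (EFin \o (fun x => f (x + a) * f (x + b))).
Proof.
have i2 := integrableD mT (integrable_shift a if2) (integrable_shift b if2).
apply: (@le_norm_integrable _ _ _ leb2 setT _ (fun x => f (x + a) ^+ 2 + f (x + b) ^+ 2)).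
- exact: mT.
- by apply: measurable_funM; exact: measurable_shiftT.
- by apply: eq_integrable i2.
move=> x _; rewrite normrM -[f (x + a) ^+ 2]real_normK ?num_real//.
rewrite -[f (x + b) ^+ 2]real_normK ?num_real//.
by have := sqr_ge0 (`|f (x + a)| - `|f (x + b)|); nra.
Qed.

Lemma autocorr_shift a b : (\int[leb2]_x (f (x + a) * f (x + b)))%R = autocorr (b - a).
Proof.
rewrite /autocorr -[RHS](Rintegral_shift a); last first.
  by apply: measurable_funM => //; exact: measurable_shiftT.
by apply: eq_Rintegral => x _; rewrite -addrA (addrC a) subrK.
Qed.

Lemma autocorrN w : autocorr (- w) = autocorr w.
Proof.
rewrite -[- w]add0r -autocorr_shift /autocorr.
by apply: eq_Rintegral => x _; rewrite addr0 mulrC.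
Qed.

(** Arithmetic-geometric mean inequality and invariance under translations. *)
Lemma autocorr_bound w : `|autocorr w| <= (\int[leb2]_x (f x ^+ 2))%R.
Proof.
set I := (X in _ <= X).
have i0 : leb2.-integrable setT (EFin \o (fun x => f x ^+ 2)) := if2.
have iw := integrable_shift w if2.
have Z h : leb2.-integrable setT (EFin \o h) ->
    leb2.-integrable setT (EFin \o (fun x => 2^-1 * h x)).
  by move=> ih; have := integrableZl mT 2^-1 ih; apply: eq_integrable => // x _ /=; rewrite EFinM.
have -> : I = (\int[leb2]_x (2^-1 * f x ^+ 2 + 2^-1 * f (x + w) ^+ 2))%R.
  rewrite RintegralD//; [|exact: Z|exact: (Z (fun x => f (x + w) ^+ 2))].
  rewrite !RintegralZl//.
  rewrite (Rintegral_shift (h := fun x => f x ^+ 2)); last exact: measurable_funX.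
  by rewrite -/I; lra.
apply: norm_Rintegral_le.
- exact: mT.
- by apply: measurable_funM => //; exact: measurable_shiftT.
- have := integrableD mT (Z _ if2) (Z (fun x => f (x + w) ^+ 2) iw).
  by apply: eq_integrable.
move=> x _; rewrite normrM -[f x ^+ 2]real_normK ?num_real//.
rewrite -[f (x + w) ^+ 2]real_normK ?num_real//.
by have := sqr_ge0 (`|f x| - `|f (x + w)|); nra.
Qed.

Definition hilb_diff u (m : nat) x : R :=
  f (x + (m%:R + 2^-1) *: u) - f (x - (m%:R + 2^-1) *: u).

Definition hilb_sum u M x : R := \sum_(m < M) half_inv m * hilb_diff u m x.

Lemma measurable_hilb_diff u m : measurable_fun setT (hilb_diff u m).
Proof. by apply: measurable_funB; exact: measurable_shiftT. Qed.

Lemma measurable_hilb_sum u M : measurable_fun setT (hilb_sum u M).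
Proof.
rewrite /hilb_sum; under eq_fun do rewrite -(big_mkord xpredT (fun m => half_inv m * hilb_diff u m _)).
apply: measurable_sum => m; apply: measurable_funM => //; exact: measurable_hilb_diff.
Qed.

Lemma hilb_diff_expand u m n x : hilb_diff u m x * hilb_diff u n x =
  (f (x + (m%:R + 2^-1) *: u) * f (x + (n%:R + 2^-1) *: u) +
   f (x - (m%:R + 2^-1) *: u) * f (x - (n%:R + 2^-1) *: u)) -
  (f (x - (m%:R + 2^-1) *: u) * f (x + (n%:R + 2^-1) *: u) +
   f (x + (m%:R + 2^-1) *: u) * f (x - (n%:R + 2^-1) *: u)).
Proof. by rewrite /hilb_diff; ring. Qed.

Let iDD a b c e : leb2.-integrable setT (EFin \o (fun x => f (x + a) * f (x + b) + f (x + c) * f (x + e))).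
Proof.
have := integrableD mT (integrable_shift2 a b) (integrable_shift2 c e).
by apply: eq_integrable.
Qed.

Lemma integrable_hilb_diff2 u m n :
  leb2.-integrable setT (EFin \o (fun x => hilb_diff u m x * hilb_diff u n x)).
Proof.
have := integrableB mT
  (iDD ((m%:R + 2^-1) *: u) ((n%:R + 2^-1) *: u) (- ((m%:R + 2^-1) *: u)) (- ((n%:R + 2^-1) *: u)))
  (iDD (- ((m%:R + 2^-1) *: u)) ((n%:R + 2^-1) *: u) ((m%:R + 2^-1) *: u) (- ((n%:R + 2^-1) *: u))).
by apply: eq_integrable => // x _ /=; rewrite hilb_diff_expand EFinB.
Qed.

Lemma integral_hilb_diff2 u m n :
  (\int[leb2]_x (hilb_diff u m x * hilb_diff u n x))%R =
  2 * (autocorr (((m - n) + (n - m))%:R *: u) - autocorr ((m + n).+1%:R *: u)).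
Proof.
under eq_Rintegral => x _ do rewrite hilb_diff_expand.
rewrite RintegralB//; try exact: iDD.
rewrite !RintegralD//; try exact: integrable_shift2.
rewrite !autocorr_shift.
have E1 : autocorr (n%:R *: u - m%:R *: u) = autocorr (((m - n) + (n - m))%:R *: u).
  have [mn|nm] := leqP m n.
    have -> : n%:R *: u - m%:R *: u = (n%:R - m%:R) *: u by rewrite scalerBl.
    have -> : ((m - n) + (n - m))%N = (n - m)%N by lia.
    by rewrite natrB.
  have -> : ((m - n) + (n - m))%N = (m - n)%N by lia.
  rewrite (natrB _ (ltnW nm)) scalerBl -autocorrN.
  by congr autocorr; rewrite opprB.
have -> : (n%:R + 2^-1) *: u - (m%:R + 2^-1) *: u = n%:R *: u - m%:R *: u.
  by rewrite !scalerDl opprD addrACA subrr addr0.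
have -> : - ((n%:R + 2^-1) *: u) - - ((m%:R + 2^-1) *: u) = - (n%:R *: u - m%:R *: u).
  by rewrite !scalerDl opprK opprD addrACA addNr addr0 opprB addrC.
have H : (n%:R + 2^-1) *: u + (m%:R + 2^-1) *: u = (m + n).+1%:R *: u.
  rewrite -scalerDl; congr (_ *: _).
  have -> : (m + n).+1%:R = m%:R + n%:R + 1 :> R by rewrite -natr1 natrD.
  by field.
have -> : (n%:R + 2^-1) *: u - - ((m%:R + 2^-1) *: u) = (m + n).+1%:R *: u.
  by rewrite opprK.
have -> : - ((n%:R + 2^-1) *: u) - (m%:R + 2^-1) *: u = - ((m + n).+1%:R *: u).
  by rewrite -opprD H.
rewrite !autocorrN E1; move: (autocorr _) (autocorr _) => p q; ring.
Qed.

(** Integrating the square of the sum term by term, translation invariance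
    leaves autocorrelations of [f] at integer multiples of [u], that is the form
    of [hilbert_form_bound], with the norm of [f] as a bound on its entries. *)
Lemma hilb_sum_L2 u M : (\int[leb2]_x (hilb_sum u M x ^+ 2))%R <=
  28 * (\int[leb2]_x (f x ^+ 2))%R.
Proof.
have Z (c : R) h : leb2.-integrable setT (EFin \o h) ->
    leb2.-integrable setT (EFin \o (fun x => c * h x)).
  by move=> ih; have := integrableZl mT c ih; apply: eq_integrable => // x _ /=; rewrite EFinM.
have iZ m n := Z (half_inv m * half_inv n) _ (integrable_hilb_diff2 u m n).
have E : (\int[leb2]_x (hilb_sum u M x ^+ 2))%R =
    \sum_(m <- index_iota 0 M) \sum_(n <- index_iota 0 M) half_inv m * half_inv n *
      (\int[leb2]_x (hilb_diff u m x * hilb_diff u n x))%R.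
  have P x : hilb_sum u M x ^+ 2 = \sum_(m <- index_iota 0 M) \sum_(n <- index_iota 0 M)
      half_inv m * half_inv n * (hilb_diff u m x * hilb_diff u n x).
    rewrite expr2 /hilb_sum -(big_mkord xpredT (fun m => half_inv m * hilb_diff u m x)).
    rewrite mulr_suml; apply: eq_bigr => m _; rewrite mulr_sumr; apply: eq_bigr => n _.
    by rewrite mulrACA.
  under eq_Rintegral => x _ do rewrite P.
  rewrite Rintegral_sum//.
    apply: eq_bigr => m _; rewrite Rintegral_sum//.
    by apply: eq_bigr => n _; rewrite RintegralZl//; exact: integrable_hilb_diff2.
  move=> m; have := @integrable_sum _ _ _ leb2 setT mT nat (index_iota 0 M) xpredT
    (fun n => EFin \o (fun x => half_inv m * half_inv n * (hilb_diff u m x * hilb_diff u n x))) (fun n _ => iZ m n).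
  by apply: eq_integrable => // x _ /=; rewrite sumEFin.
rewrite E big_mkord.
under eq_bigr => m _ do rewrite big_mkord.
have -> : 28 * (\int[leb2]_x (f x ^+ 2))%R = 2 * (14 * (\int[leb2]_x (f x ^+ 2))%R) by rewrite mulrA; congr (_ * _); ring.
apply: (@le_trans _ _ (2 * \sum_(m < M) \sum_(n < M) half_inv m * half_inv n *
    (autocorr (((m - n) + (n - m))%:R *: u) - autocorr ((m + n).+1%:R *: u)))); last first.
  rewrite ler_pM2l//; apply: (hilbert_form_bound M (B := fun d => autocorr (d%:R *: u))).
  by move=> d; exact: autocorr_bound.
rewrite mulr_sumr; apply: ler_sum => m _; rewrite mulr_sumr; apply: ler_sum => n _.
by rewrite integral_hilb_diff2 mulrCA.
Qed.

Lemma integrable_hilb_sum2 u M :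
  leb2.-integrable setT (EFin \o (fun x => hilb_sum u M x ^+ 2)).
Proof.
have Z (c : R) h : leb2.-integrable setT (EFin \o h) ->
    leb2.-integrable setT (EFin \o (fun x => c * h x)).
  by move=> ih; have := integrableZl mT c ih; apply: eq_integrable => // x _ /=; rewrite EFinM.
have I m := @integrable_sum _ _ _ leb2 setT mT _ (index_iota 0 M) xpredT
  (fun n => EFin \o (fun x => half_inv m * half_inv n * (hilb_diff u m x * hilb_diff u n x)))
  (fun n _ => Z _ _ (integrable_hilb_diff2 u m n)).
have := @integrable_sum _ _ _ leb2 setT mT _ (index_iota 0 M) xpredT _ (fun m _ => I m).
apply: eq_integrable => // x _ /=; rewrite expr2 /hilb_sum.
rewrite -(big_mkord xpredT (fun m => half_inv m * hilb_diff u m x)).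
rewrite mulr_suml -sumEFin; apply: eq_bigr => m _.
by rewrite mulr_sumr -sumEFin; apply: eq_bigr => n _; rewrite mulrACA.
Qed.

End autocorrelation.
End hilbert_translations.

(** * Integration along the lines through the origin *)

Section fan_coordinates.
Context {R : realType}.
Local Notation RM := (measurableTypeR R).
Local Notation leb := (@lebesgue_measure R).
Local Notation leb2 := (leb \x leb)%E.

Lemma measurable_fan : measurable_fun setT (fun z : R * R => (z.1, z.1 * z.2)).
Proof.
apply: measurable_fun_pair; first exact: measurable_fst.
by apply: measurable_funM; [exact: measurable_fst|exact: measurable_snd].
Qed.

(** The change of variables [y = (t, t * s)], with Jacobian [|t|], sweeps the
    plane by the lines through the origin; for each [t != 0] it is an affine
    change of variable in [s], and the line [t = 0] is negligible. *)
Lemma ge0_integral_fan (F : RM * RM -> \bar R) :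
  measurable_fun setT F -> (forall z, 0 <= F z)%E ->
  (\int[leb2]_z F z = \int[leb2]_z (`|z.1|%:E * F (z.1, (z.1 * z.2)%R)))%E.
Proof.
move=> mF F0.
have mG : measurable_fun setT (fun z : RM * RM => (`|z.1|%:E * F (z.1, (z.1 * z.2)%R))%E).
  apply: emeasurable_funM; last exact: (measurableT_comp mF measurable_fan).
  by apply/measurable_EFinP; apply: measurableT_comp => //; exact: measurable_fst.
have G0 z : (0 <= `|z.1|%:E * F (z.1, (z.1 * z.2)%R))%E by rewrite mule_ge0.
have -> := @fubini_tonelli1 _ _ RM RM R leb leb _ mF F0.
have -> := @fubini_tonelli1 _ _ RM RM R leb leb _ mG G0.
apply: ge0_ae_eq_integral => //.
- exact: (@measurable_fun_fubini_tonelli_F _ _ RM RM R leb _ mF F0).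
- exact: (@measurable_fun_fubini_tonelli_F _ _ RM RM R leb _ mG G0).
- by move=> x _; exact: integral_ge0.
- by move=> x _; exact: integral_ge0.
exists [set (0:R)]; split => //; first exact: lebesgue_measure_set1.
move=> t /=; apply: contra_notP => t0 _; rewrite /fubini_F.
have mFt : measurable_fun setT (fun s : RM => F (t, s)).
  exact: measurableT_comp.
rewrite (ge0_integral_affine 0 (a := t))//; last exact/eqP.
rewrite /= ge0_integralZl_EFin//.
  by congr (_ * _)%E; apply: eq_integral => s _; rewrite addr0.
by apply: (measurableT_comp mFt).
Qed.

Lemma integral_fan (F : R * R -> R) : measurable_fun setT F ->
  (\int[leb2]_z (F z)%:E = \int[leb2]_z (`|z.1| * F (z.1, (z.1 * z.2)%R))%:E)%E.
Proof.
move=> mF; have mF' : measurable_fun setT (EFin \o F) by exact/measurable_EFinP.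
rewrite [LHS]integralE [RHS]integralE; congr (_ - _)%E.
  rewrite (ge0_integral_fan (measurable_funepos mF') (funepos_ge0 _)).
  apply: eq_integral => z _; rewrite !funeposE /= -!EFin_max -EFinM.
  by rewrite maxr_pMr// mulr0.
rewrite (ge0_integral_fan (measurable_funeneg mF') (funeneg_ge0 _)).
apply: eq_integral => z _; rewrite !funenegE /= -!EFin_max -EFinM.
by rewrite maxr_pMr// mulr0 mulrN.
Qed.

(** The kernel times the Jacobian [|t|] on the line of slope [s] is
    [line_weight i s / t] ([riesz_coord_fan]): an odd kernel on the line, with a weight
    that depends on the slope only. *)
Definition line_weight (i : bool) (s : R) : R :=
  (if i then s else 1) / (2 * pi * Num.sqrt (oneDsqr s) ^+ 3).

Lemma oneDsqr_ge0 (s : R) : 0 <= oneDsqr s. Proof. exact: le_trans (oneDsqr_ge1 s). Qed.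

Lemma enorm_fan (t s : R) : enorm (t, t * s) = `|t| * Num.sqrt (oneDsqr s).
Proof.
rewrite /enorm /=.
have -> : t ^+ 2 + (t * s) ^+ 2 = t ^+ 2 * oneDsqr s by rewrite /oneDsqr; ring.
by rewrite sqrtrM ?sqr_ge0// sqrtr_sqr.
Qed.

Lemma riesz_coord_fan i (t s : R) : `|t| * riesz_coord i (t, t * s) = line_weight i s / t.
Proof.
have [->|t0] := eqVneq t 0; first by rewrite normr0 mul0r invr0 mulr0.
rewrite riesz_coordE enorm_fan /line_weight.
have q0 : Num.sqrt (oneDsqr s) != 0 :> R by rewrite sqrtr_eq0 -ltNge (lt_le_trans ltr01)// oneDsqr_ge1.
have -> : coord i (t, t * s) = t * (if i then s else 1) by case: i; rewrite /= ?mulr1.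
have n0 : `|t| != 0 by rewrite normr_eq0.
have nt : `|t| ^+ 2 = t ^+ 2 by rewrite real_normK ?num_real.
have E : (`|t| * Num.sqrt (oneDsqr s)) ^+ 3 = `|t| * (t ^+ 2 * Num.sqrt (oneDsqr s) ^+ 3).
  by rewrite -nt; ring.
rewrite E; move: pi (pi_gt0 R) (if i then s else 1) => p p0 c.
by field; rewrite q0 n0 t0 gt_eqF.
Qed.

Lemma line_weight_bound i (s : R) : `|line_weight i s| <= (oneDsqr s)^-1.
Proof.
have q1 : 1 <= Num.sqrt (oneDsqr s).
  by rewrite -[leLHS]sqrtr1 ler_wsqrtr// oneDsqr_ge1.
have q2 : Num.sqrt (oneDsqr s) ^+ 2 = oneDsqr s by rewrite sqr_sqrtr// oneDsqr_ge0.
have c1 : `|if i then s else 1| <= Num.sqrt (oneDsqr s).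
  case: i; last by rewrite normr1.
  by rewrite -sqrtr_sqr ler_wsqrtr// /oneDsqr lerDr.
have p1 := @twopi_ge1 R.
suff : `|line_weight i s| <= (Num.sqrt (oneDsqr s) ^+ 2)^-1 by rewrite q2.
rewrite /line_weight; move: (Num.sqrt _) (if i then s else 1) q1 c1 => q c q1 c1.
have q0 : 0 < q by apply: lt_le_trans q1.
rewrite normrM normfV normrM (ger0_norm (le_trans ler01 p1)) normrX (gtr0_norm q0).
rewrite ler_pdivrMr; last by rewrite mulr_gt0 ?exprn_gt0//; lra.
have -> : (q ^+ 2)^-1 * (2 * pi * q ^+ 3) = 2 * pi * q.
  by move: (2 * pi) => p; field; rewrite gt_eqF.
by rewrite (le_trans c1)// ler_peMl// ltW.
Qed.

Lemma measurable_oneDsqrV D : measurable_fun D (fun s : R => (oneDsqr s)^-1).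
Proof.
apply: measurable_funTS; apply: continuous_measurable_fun.
exact: continuous_oneDsqrV.
Qed.

Lemma measurable_line_weight i D : measurable_fun D (line_weight i).
Proof.
apply: measurable_funTS; rewrite /line_weight; apply: measurable_funM; first by case: i.
apply: (measurableT_comp (@measurable_invr R setT)); apply: measurable_funM => //.
apply: measurable_funX; apply: (measurableT_comp (@measurable_sqrt R setT)).
by apply: continuous_measurable_fun; exact: continuous_oneDsqr.
Qed.

Lemma integrable_oneDsqrV : leb.-integrable setT (EFin \o (fun s : R => (oneDsqr s)^-1)).
Proof.
apply/integrableP; split.
  by apply/measurable_EFinP; exact: measurable_oneDsqrV.
have o0 (s : R) : 0 <= (oneDsqr s)^-1 by rewrite invr_ge0 oneDsqr_ge0.
under eq_integral => s _ do rewrite /= ger0_norm//.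
rewrite ge0_symfun_integralT//; last 2 first.
- exact: continuous_oneDsqrV.
- by move=> s; rewrite /= /oneDsqr sqrrN.
rewrite (_ : [set x | _] = `[0, +oo[%classic); last first.
  by apply/seteqP; split => x/=; rewrite in_itv/= andbT.
by rewrite integral0y_oneDsqr -EFinM ltry.
Qed.

(** The largest [t] for which [(t, t * s)] is in the box. *)
Definition ray_length (s : R) : R := pi / Num.max 1 `|s|.

Lemma ray_length_gt0 s : 0 < ray_length s.
Proof. by rewrite divr_gt0 ?pi_gt0// lt_max ltr01. Qed.

Lemma ray_length_le s : ray_length s <= pi /\ ray_length s * `|s| <= pi.
Proof.
have m0 : 0 < Num.max 1 `|s| :> R by rewrite lt_max ltr01.
have p0 := pi_ge0 R.
split; rewrite /ray_length.
  by rewrite ler_pdivrMr// ler_peMr// le_max lexx.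
by rewrite mulrAC ler_pdivrMr// ler_wpM2l// le_max lexx orbT.
Qed.

Lemma tbox1_fan (t s : R) : tbox 1 (t, t * s) <-> `|t| <= ray_length s.
Proof.
have m0 : 0 < Num.max 1 `|s| :> R by rewrite lt_max ltr01.
rewrite tboxP mul1r /= normrM /ray_length ler_pdivlMr//; split.
  move=> [h1 h2]; rewrite /Num.max; case: ifPn => _ //.
  by rewrite mulr1.
move=> h; split.
  by apply: le_trans h; rewrite ler_peMr// le_max lexx.
by apply: le_trans h; rewrite ler_wpM2l// le_max lexx orbT.
Qed.

Lemma measurable_ray_length D : measurable_fun D ray_length.
Proof.
apply: measurable_funTS; rewrite /ray_length; apply: measurable_funM => //.
apply: (measurableT_comp (@measurable_invr R setT)).
by apply: measurable_maxr => //.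
Qed.

End fan_coordinates.

(** * The midpoint rule *)

Section midpoint_rule.
Context {R : realType}.
Local Notation leb := (@lebesgue_measure R).
Variables (L C D : R) (h : R -> R).
Hypotheses (L0 : 0 < L) (hC : forall t, 0 < t <= L -> `|h t| <= C)
  (hD : forall t u, 0 < t <= L -> 0 < u <= L -> `|h t - h u| <= D * `|t - u| / t).

Let mI : @measurable _ (measurableTypeR R) `]0, L]%classic.
Proof. exact: measurable_itv. Qed.

Let Ifin : (leb `]0%R, L]%classic < +oo)%E.
Proof. by rewrite lebesgue_measure_itv/= lte_fin L0 -EFinB ltry. Qed.

Let del (M : nat) : R := L / M.+1%:R.
Let cell (M m : nat) : set R := `]m%:R * del M, m.+1%:R * del M]%classic.
Let mid (M m : nat) : R := (m%:R + 2^-1) * del M.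

Let del_gt0 M : 0 < del M. Proof. by rewrite divr_gt0. Qed.

Let M_del M : M.+1%:R * del M = L.
Proof. by rewrite /del mulrC divfK// pnatr_eq0. Qed.

Let cell_le M m : (m < M.+1)%N -> m.+1%:R * del M <= L.
Proof.
by move=> mM; rewrite -[leRHS](M_del M); apply: ler_wpM2r; [exact: ltW|rewrite ler_nat].
Qed.

Let mid_cell M m : cell M m (mid M m).
Proof.
rewrite /cell /= in_itv/= /mid -[m.+1%:R]natr1; have d0 := del_gt0 M.
by rewrite ltr_pM2r// ler_pM2r//; apply/andP; split; lra.
Qed.

Let cell_in M m t : (m < M.+1)%N -> cell M m t -> 0 < t <= L.
Proof.
move=> mM; rewrite /cell /= in_itv/= => /andP[h1 h2]; apply/andP; split.
  by apply: le_lt_trans h1; rewrite mulr_ge0// ltW.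
by apply: le_trans h2 _; exact: cell_le.
Qed.

Let cell_ex M t : 0 < t <= L -> exists2 m, (m < M.+1)%N & cell M m t.
Proof.
move=> /andP[t0 tL].
have ex : exists m, t <= m.+1%:R * del M by exists M; rewrite M_del.
have [m hm mmin] := ex_minnP ex; exists m.
  by rewrite ltnS mmin// M_del.
rewrite /cell /= in_itv/= hm andbT.
case: m mmin {hm} => [_|m mmin]; first by rewrite mul0r.
by rewrite ltNge; apply/negP => /mmin; rewrite ltnn.
Qed.

Let cell_uniq M m n t : cell M m t -> cell M n t -> m = n.
Proof.
have d0 := del_gt0 M.
wlog mn : m n / (m <= n)%N.
  by move=> H a b; have [/H->//|/ltnW/H] := leqP m n; move=> /(_ b a)/esym.
rewrite /cell /= !in_itv/= => /andP[h1 h2] /andP[h3 h4].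
have := lt_le_trans h3 h2; rewrite ltr_pM2r// ltr_nat ltnS => nm.
by apply/eqP; rewrite eqn_leq mn nm.
Qed.

Let step M t : R := \sum_(m <- index_iota 0 M.+1) h (mid M m) * \1_(cell M m) t.

Let stepE M m t : (m < M.+1)%N -> cell M m t -> step M t = h (mid M m).
Proof.
move=> mM ct; rewrite /step big_mkord (bigD1 (Ordinal mM))//= indicE mem_set// mulr1.
rewrite big1 ?addr0// => n /eqP nm; rewrite indicE memNset ?mulr0// => cn.
by apply: nm; apply: val_inj => /=; exact: cell_uniq cn ct.
Qed.

Let mcell M m : measurable (cell M m). Proof. exact: measurable_itv. Qed.

Let mstep M : measurable_fun (`]0, L]%classic : set R) (step M).
Proof.
rewrite /step; apply: measurable_sum => m; apply: measurable_funM => //.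
Qed.

Let int_cell M m : leb.-integrable `]0, L]%classic (EFin \o (\1_(cell M m) : R -> R)).
Proof.
apply: (@bounded_integrable _ _ _ leb _ _ 1).
- exact: mI.
- exact: Ifin.
- by apply: measurable_indic; exact: mcell.
- by move=> t _; rewrite indicE; case: (_ \in _); rewrite ?normr1 ?normr0.
Qed.

Let int_step M : (\int[leb]_(t in `]0%R, L]) step M t)%R =
  \sum_(m < M.+1) del M * h (mid M m).
Proof.
rewrite /step Rintegral_sum; last 2 first.
- exact: measurable_itv.
- move=> m; have := integrableZl mI (h (mid M m)) (int_cell M m).
  by apply: eq_integrable; [exact: mI|move=> x _; rewrite /= EFinM].
rewrite big_mkord; apply: eq_bigr => m _.
rewrite RintegralZl//.
rewrite mulrC; congr (_ * _).
rewrite /Rintegral integral_indic; [|exact: measurable_itv|exact: mcell].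
rewrite (_ : _ `&` _ = cell M m); last first.
  apply/seteqP; split=> [t []//|t ct]; split => //.
  by rewrite /= in_itv/=; exact: cell_in ct.
transitivity (fine (leb (`]m%:R * del M, m.+1%:R * del M]%classic : set R))) => //.
rewrite lebesgue_measure_itv/= lte_fin ltr_pM2r// ltr_nat ltnSn -EFinB /= -[m.+1%:R]natr1.
by ring.
Qed.

(** The midpoint sum is the integral of the step function with the values of [h]
    at the midpoints, to which dominated convergence applies: the oscillation of
    [h] over the cell of a fixed [t > 0] tends to [0]. The weight [1 / t] in
    [hD] lets the oscillation degenerate at the left end, as it does for the
    symmetric difference quotient of a Lipschitz function. *)
Lemma midpoint_rule :
  (\sum_(m < M.+1) L / M.+1%:R * h ((m%:R + 2^-1) * (L / M.+1%:R))) @[M --> \oo] -->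
  (\int[leb]_(t in `]0%R, L]) h t)%R.
Proof.
under eq_fun => M do rewrite -/(del M).
rewrite (_ : (fun M => _) = (fun M => (\int[leb]_(t in `]0%R, L]) step M t)%R)); last first.
  by apply/funext => M; rewrite int_step.
apply: (@Rdominated_convergence _ _ _ leb _ _ _ (cst C)).
- exact: measurable_itv.
- exact: mstep.
- move=> t; rewrite /= in_itv/= => tL; have /andP[t0 _] := tL.
  apply/cvgrPdist_le => e e0.
  have key M : `|h t - step M t| <= `|D| * del M / t.
    have [m mM ct] := cell_ex M tL.
    rewrite (stepE mM ct).
    have cm := cell_in mM (mid_cell M m).
    apply: (le_trans (hD tL cm)); apply: ler_wpM2r; first by rewrite invr_ge0 ltW.
    apply: (le_trans (ler_wpM2r _ (ler_norm D))) => //; apply: ler_wpM2l => //.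
    have := mid_cell M m; move: ct; rewrite /cell /= !in_itv/= -[m.+1%:R]natr1.
    move=> /andP[a1 a2] /andP[a3 a4]; rewrite ler_norml; apply/andP; split; lra.
  have c0 : 0 <= `|D| * L / t by apply: divr_ge0 (ltW t0); apply: mulr_ge0 (ltW L0).
  have e1 : 0 < e / (`|D| * L / t + 1) by rewrite divr_gt0// ltr_wpDl.
  near=> M; apply: (le_trans (key M)).
  have : M.+1%:R^-1 < e / (`|D| * L / t + 1).
    by near: M; exact: (near_infty_natSinv_lt (PosNum e1)).
  rewrite ltr_pdivlMr; last by rewrite ltr_wpDl.
  have -> : `|D| * del M / t = M.+1%:R^-1 * (`|D| * L / t) by rewrite /del; ring.
  move=> /ltW; apply: le_trans; apply: ler_wpM2l; first by rewrite invr_ge0.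
  by rewrite lerDl.
- apply: (@bounded_integrable _ _ _ leb _ _ `|C|) => //.
- move=> M t; rewrite /= in_itv/= => tL.
  have [m mM ct] := cell_ex M tL; rewrite (stepE mM ct).
  exact: hC (cell_in mM (mid_cell M m)).
Unshelve. all: by end_near. Qed.

End midpoint_rule.

(** * Integrals depending on a parameter *)

Section parametric_measurability.
Context d1 d2 (T1 : measurableType d1) (T2 : measurableType d2) {R : realType}.
Variable m2 : {sigma_finite_measure set T2 -> \bar R}.

Lemma measurable_fun_fine (D : set T1) (f : T1 -> \bar R) :
  measurable_fun D f -> measurable_fun D (fun x => fine (f x)).
Proof.
by move=> mf mD; exact: (measurable_comp measurableT (@subsetT _ _)
  (@fine_measurable R setT measurableT) mf mD).
Qed.

(** Tonelli's theorem for the positive and the negative parts. *)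
Lemma measurable_Rintegral_param (F : T1 * T2 -> R) : measurable_fun setT F ->
  measurable_fun setT (fun x => (\int[m2]_y F (x, y))%R).
Proof.
move=> /measurable_EFinP mF; rewrite /Rintegral; apply: measurable_fun_fine.
under eq_fun => x do rewrite integralE.
apply: emeasurable_funB.
  have := @measurable_fun_fubini_tonelli_F _ _ T1 T2 R m2 _ (measurable_funepos mF) (funepos_ge0 _).
  by apply: eq_measurable_fun => x _; apply: eq_integral => y _; rewrite !funeposE.
have := @measurable_fun_fubini_tonelli_F _ _ T1 T2 R m2 _ (measurable_funeneg mF) (funeneg_ge0 _).
by apply: eq_measurable_fun => x _; apply: eq_integral => y _; rewrite !funenegE.
Qed.

End parametric_measurability.

(** * The method of rotations *)

Section rotation.
Context {R : realType}.
Local Notation RM := (measurableTypeR R).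
Local Notation leb := (@lebesgue_measure R).
Local Notation leb2 := (leb \x leb)%E.
Implicit Types (x y : R * R) (f : R * R -> R).

Lemma integral_reflect (h : RM -> \bar R) : measurable_fun setT h ->
  (\int[leb]_t h (- t)%R = \int[leb]_t h t)%E.
Proof.
move=> mh; have e0 : -1 != 0 :> R by rewrite oppr_eq0 oner_eq0.
rewrite [LHS]integralE [RHS]integralE; congr (_ - _)%E.
  rewrite [RHS](ge0_integral_affine 0 e0 (measurable_funepos mh) (funepos_ge0 h)).
  rewrite normrN1 mul1e; apply: eq_integral => t _.
  by rewrite !funeposE addr0 mulN1r.
rewrite [RHS](ge0_integral_affine 0 e0 (measurable_funeneg mh) (funeneg_ge0 h)).
rewrite normrN1 mul1e; apply: eq_integral => t _.
by rewrite !funenegE addr0 mulN1r.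
Qed.

Section odd_part.
Variables (f : R * R -> R) (L : R).
Hypotheses (L0 : 0 <= L) (lf : lipon (tbox 2) f L).

Let g := f \_ (tbox 2).

Let mg : measurable_fun setT g.
Proof.
exact: (measurable_restrictT f (measurable_tbox 2)).1 (lipon_measurable lf).
Qed.

(** The singular part of [riesz_op]. *)
Definition riesz_op_odd (i : bool) f x : R :=
  (\int[leb2]_(y in tbox 1) ((f (x + y) - f (x - y)) / 2 * riesz_coord i y))%R.

Let odd_part i x : R * R -> R := (fun y => (g (x + y) - g (x - y)) / 2 * riesz_coord i y) \_ (tbox 1).

Section at_point.
Variables (i : bool) (x : R * R).
Hypothesis x1 : tbox 1 x.

Let gE y : tbox 1 y -> g (x + y) = f (x + y) /\ g (x - y) = f (x - y).
Proof.
move=> y1; rewrite /g !patchE !ifT// inE; apply: tboxD1 => //.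
exact: tboxN.
Qed.

Let modd : measurable_fun setT (odd_part i x).
Proof.
apply: (measurable_restrictT _ (measurable_tbox 1)).1; apply: measurable_funTS.
apply: measurable_funM; last exact: measurable_riesz_coord.
apply: measurable_funM => //; apply: measurable_funB.
  by under eq_fun => y do rewrite addrC; exact: measurable_shiftT.
have := measurableT_comp mg (measurable_translate (-1) x).
by apply: eq_measurable_fun => y _ /=; rewrite translateE scaleN1r.
Qed.

Let oddE : riesz_op_odd i f x = (\int[leb2]_y odd_part i x y)%R.
Proof.
rewrite /riesz_op_odd Rintegral_mkcond; apply: eq_Rintegral => y _; rewrite /odd_part !patchE.
by case: ifPn => // /[!inE] y1; have [-> ->] := gE y1.
Qed.

Let odd_bound y : `|odd_part i x y| <= ((fun y => 2 * L * (enorm y)^-1) \_ (tbox 1)) y.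
Proof.
rewrite /odd_part !patchE; case: ifPn => [/[!inE] y1|_]; last by rewrite normr0.
have [-> ->] := gE y1.
exact: odd_diff_bound L0 lf x1 y1.
Qed.

Let iodd : leb2.-integrable setT (EFin \o odd_part i x).
Proof.
have mT : @measurable _ (RM * RM)%type setT by exact: measurableT.
apply: (@le_norm_integrable _ _ _ leb2 setT _ ((fun y => 2 * L * (enorm y)^-1) \_ (tbox 1))) => //.
have i0 : leb2.-integrable (tbox 1) (EFin \o (fun y : R * R => 2 * L * (enorm y)^-1)).
  have mB : @measurable _ (RM * RM)%type (tbox 1) by exact: measurable_tbox.
  have := integrableZl mB (2 * L) integrable_inv_enorm.
  by apply: eq_integrable => // y _ /=; rewrite EFinM.
have mB : @measurable _ (RM * RM)%type (tbox 1) by exact: measurable_tbox.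
have := (integrable_mkcond _ mB).1 i0.
by apply: eq_integrable => // y _; rewrite /= !patchE; case: ifP.
Qed.

Let fan z : R := `|z.1| * odd_part i x (z.1, z.1 * z.2).

Let mfan : measurable_fun setT fan.
Proof.
apply: measurable_funM.
  by apply: measurableT_comp => //; exact: measurable_fst.
exact: (measurableT_comp modd measurable_fan).
Qed.

Let ifan : leb2.-integrable setT (EFin \o fan).
Proof.
apply/integrableP; split; first exact/measurable_EFinP.
have /integrableP[_] := iodd.
rewrite (ge0_integral_fan (F := fun y => `|(odd_part i x y)%:E|%E)) //; last first.
  by apply: measurableT_comp => //; apply/measurable_EFinP; exact: modd.
congr (_ < _)%E; apply: eq_integral => z _ /=.
by rewrite /fan normrM normr_id EFinM.
Qed.

Let kdiff (s t : R) := g (x + t *: ((1, s) : R * R)) - g (x - t *: ((1, s) : R * R)).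
Let hdiff (s t : R) := kdiff s t / t.
Let half (s : R) : R -> R := (fun t => line_weight i s / 2 * hdiff s t) \_ `]0, ray_length s]%classic.

Let scE (t s : R) : t *: ((1, s) : R * R) = (t, t * s).
Proof. by congr pair; exact: mulr1. Qed.

(** The integrand on a line is even in [t], hence a function on the half-line
    plus its reflection; this avoids a change of variables on [t < 0]. *)
Let fan_half t s : fan (t, s) = half s t + half s (- t).
Proof.
rewrite /fan /odd_part /half /hdiff /kdiff !patchE /= !scE.
have L_ := ray_length_gt0 s.
have -> : ((t, t * s) \in tbox 1) = (`|t| <= ray_length s).
  by apply/idP/idP => [/[!inE] /tbox1_fan|/tbox1_fan ?]; rewrite ?inE.
have memI (u l : R) : (u \in `]0, l]%classic) = (0 < u <= l).
  by apply/idP/idP => [/[!inE]|h]; rewrite ?inE /= in_itv.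
rewrite !memI.
have [->|t0] := eqVneq t 0; first by rewrite normr0 mul0r oppr0 ltxx /= addr0.
have [tp|tn|/esym/eqP] := ltgtP 0 t; last by rewrite (negbTE t0).
- rewrite oppr_gt0 ltNge (ltW tp)/= addr0 gtr0_norm//.
  case: ifPn => _; last by rewrite mulr0.
  by have := riesz_coord_fan i t s; rewrite (gtr0_norm tp) mulrCA => ->; field; exact: t0.
- rewrite oppr_gt0 tn add0r (ltr0_norm tn).
  case: ifPn => _; last by rewrite mulr0.
  have := riesz_coord_fan i t s; rewrite (ltr0_norm tn) mulrCA => ->.
  have -> : (- t, - t * s) = - (t, t * s) :> R * R by rewrite mulNr.
  rewrite opprK; field; exact: t0.
Qed.

Let C (s : R) : R := 2 * L * (1 + `|s|).

Let gLip s t u : 0 < t <= ray_length s -> 0 < u <= ray_length s ->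
  `|kdiff s t - kdiff s u| <= C s * `|t - u|.
Proof.
move=> /andP[t0 tL] /andP[u0 uL].
have t1 : tbox 1 (t *: ((1, s) : R * R)) by rewrite scE; apply/tbox1_fan; rewrite gtr0_norm.
have u1 : tbox 1 (u *: ((1, s) : R * R)) by rewrite scE; apply/tbox1_fan; rewrite gtr0_norm.
rewrite /kdiff; have [-> ->] := gE t1; have [-> ->] := gE u1.
have h1 := lf (tboxD1 x1 t1) (tboxD1 x1 u1).
have h2 := lf (tboxD1 x1 (tboxN t1)) (tboxD1 x1 (tboxN u1)).
have E1 : dist1 (x + t *: ((1, s) : R * R)) (x + u *: ((1, s) : R * R)) = (1 + `|s|) * `|t - u|.
  rewrite !scE /dist1 /= mulrDl mul1r -normrM; congr (_ + _); congr (Num.norm _); ring.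
have E2 : dist1 (x - t *: ((1, s) : R * R)) (x - u *: ((1, s) : R * R)) = (1 + `|s|) * `|t - u|.
  rewrite !scE /dist1 /= mulrDl mul1r -normrM -[`|t - u|]normrN -[`|s * _|]normrN.
  congr (_ + _); congr (Num.norm _); ring.
rewrite E1 in h1; rewrite E2 in h2.
move: h1 h2; set a := f _; set b := f _; set c := f _; set e := f _ => h1 h2.
have -> : a - c - (b - e) = (a - b) - (c - e) by ring.
rewrite (le_trans (ler_normB _ _))// /C.
have -> : 2 * L * (1 + `|s|) * `|t - u| = L * ((1 + `|s|) * `|t - u|) + L * ((1 + `|s|) * `|t - u|) by ring.
exact: lerD.
Qed.

Let kbound s t : 0 < t <= ray_length s -> `|kdiff s t| <= C s * t.
Proof.
move=> /andP[t0 tL].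
have t1 : tbox 1 (t *: ((1, s) : R * R)) by rewrite scE; apply/tbox1_fan; rewrite gtr0_norm.
rewrite /kdiff; have [-> ->] := gE t1.
have := lf (tboxD1 x1 t1) (tboxD1 x1 (tboxN t1)); rewrite dist1_opp scE /=.
rewrite normrM (gtr0_norm t0) => /le_trans; apply.
by rewrite le_eqVlt; apply/orP; left; apply/eqP; rewrite /C; ring.
Qed.

Let hbound s t : 0 < t <= ray_length s -> `|hdiff s t| <= C s.
Proof.
move=> tL; have /andP[t0 _] := tL.
by rewrite /hdiff normrM normfV (gtr0_norm t0) ler_pdivrMr// kbound.
Qed.

Let hmod s t u : 0 < t <= ray_length s -> 0 < u <= ray_length s ->
  `|hdiff s t - hdiff s u| <= 2 * C s * `|t - u| / t.
Proof.
move=> tL uL; have /andP[t0 _] := tL; have /andP[u0 _] := uL.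
have -> : hdiff s t - hdiff s u = ((kdiff s t - kdiff s u) + hdiff s u * (u - t)) / t.
  by rewrite /hdiff; field; rewrite !gt_eqF.
rewrite normrM normfV (gtr0_norm t0); apply: ler_wpM2r; first by rewrite invr_ge0 ltW.
rewrite (le_trans (ler_normD _ _))// -mulrA mulr_natl mulr2n; apply: lerD; first exact: gLip.
by rewrite normrM distrC; apply: ler_wpM2r => //; exact: hbound.
Qed.

Let mkdiff s : measurable_fun setT (kdiff s).
Proof.
have m1 (e : R) : measurable_fun setT (fun t : R => (e * t + x.1, e * s * t + x.2)).
  by apply: measurable_fun_pair; exact: measurable_affine.
apply: measurable_funB.
  have := measurableT_comp mg (m1 1); apply: eq_measurable_fun => t _ /=; congr g.
  by rewrite scE [RHS]addrC !mul1r (mulrC s).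
have := measurableT_comp mg (m1 (-1)); apply: eq_measurable_fun => t _ /=; congr g.
by rewrite scE [RHS]addrC !mulN1r mulNr (mulrC s).
Qed.

Let mhdiff s : measurable_fun setT (hdiff s).
Proof. by apply: measurable_funM => //; exact: measurable_invr. Qed.

Let mI s : @measurable _ RM `]0, ray_length s]%classic. Proof. exact: measurable_itv. Qed.

Let Ifin s : (leb `]0%R, ray_length s]%classic < +oo)%E.
Proof. by rewrite lebesgue_measure_itv/= lte_fin ray_length_gt0 -EFinB ltry. Qed.

Let ihdiff s : leb.-integrable `]0, ray_length s]%classic (EFin \o hdiff s).
Proof.
apply: (@bounded_integrable _ _ _ leb _ _ (C s)).
- exact: mI.
- exact: Ifin.
- exact: (measurable_funTS (mhdiff s)).
- by move=> t; rewrite /= in_itv/=; exact: hbound.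
Qed.

Let mhalf s : measurable_fun setT (half s).
Proof.
apply: (measurable_restrictT _ (mI s)).1; apply: measurable_funTS.
by apply: measurable_funM => //; exact: mhdiff.
Qed.

Let ihalf s : leb.-integrable setT (EFin \o half s).
Proof.
have i0 := integrableZl (mI s) (line_weight i s / 2) (ihdiff s).
have := (integrable_mkcond _ (mI s)).1 i0.
by apply: eq_integrable => // t _; rewrite /half /= !patchE; case: ifP.
Qed.

Let ihalfN s : leb.-integrable setT (fun t => (half s (- t))%:E).
Proof.
have /integrableP[_ h] := ihalf s.
apply/integrableP; split.
  apply/measurable_EFinP; apply: (measurableT_comp (mhalf s)).
  exact: oppr_measurable.
rewrite (integral_reflect (h := fun t => `|(half s t)%:E|%E))//.
by apply: measurableT_comp => //; apply/measurable_EFinP; exact: mhalf.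
Qed.

Let inner s : (\int[leb]_t (fan (t, s))%:E =
  (line_weight i s * (\int[leb]_(t in `]0%R, ray_length s]) hdiff s t)%R)%:E)%E.
Proof.
under eq_integral => t _ do rewrite fan_half EFinD.
rewrite integralD//; last exact: ihalf.
rewrite (integral_reflect (h := EFin \o half s)); last by apply/measurable_EFinP; exact: mhalf.
have -> : (\int[leb]_t (half s t)%:E = (line_weight i s / 2 * (\int[leb]_(t in `]0%R, ray_length s]) hdiff s t)%R)%:E)%E.
  rewrite -RintegralZl//.
  rewrite Rintegral_mkcond /Rintegral fineK//.
  by apply: integrable_fin_num => //; exact: ihalf.
rewrite -EFinD; congr EFin; rewrite -mulrDl; congr (_ * _); lra.
Qed.

(** Fubini in the coordinates [(t, s)]; the inner integral is a Hilbert transform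
    of the cut-off function along the line of slope [s], truncated to the box. *)
Lemma riesz_op_odd_fan : riesz_op_odd i f x = (\int[leb]_s (line_weight i s * (\int[leb]_(t in `]0%R, ray_length s])
  ((g (x + t *: (1, s)) - g (x - t *: (1, s))) / t))%R))%R.
Proof.
rewrite oddE /Rintegral; congr fine.
rewrite integral_fan//.
have <- := @integral21_prod_meas1 _ _ RM RM R leb leb _ ifan.
by apply: eq_integral => s _; rewrite /fubini_G inner.
Qed.

(** With nodes [t_m = (m + 1/2) * d], the midpoint sum of [k t / t] with step [d]
    has the coefficients [d / t_m = half_inv m]. *)
Lemma hilb_sum_cvg s : hilb_sum g ((ray_length s / M.+1%:R) *: ((1, s) : R * R)) M.+1 x @[M --> \oo] -->
  (\int[leb]_(t in `]0%R, ray_length s]) ((g (x + t *: (1, s)) - g (x - t *: (1, s))) / t))%R.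
Proof.
have := midpoint_rule (ray_length_gt0 s) (@hbound s) (@hmod s); apply: cvg_trans; apply: near_eq_cvg.
near=> M; rewrite /hilb_sum; apply: eq_bigr => m _.
rewrite /hilb_diff /hdiff /kdiff /half_inv !scalerA.
have : ray_length s / M.+1%:R != 0 by rewrite mulf_neq0// ?gt_eqF ?ray_length_gt0// invr_neq0.
have : m%:R + 2^-1 != 0 :> R by rewrite gt_eqF// half_gt0.
move: (m%:R + 2^-1) (ray_length s / M.+1%:R) => a b a0 b0.
by move: (g _ - g _) => c; field; rewrite a0 b0.
Unshelve. all: by end_near. Qed.

(** The difference quotient along the line is at most [2 * L * (1 + |s|)], a bound
    that grows with the slope, but the range of [t] shrinks like [pi / |s|]. *)
Lemma hilb_sum_bound s M :
  `|hilb_sum g ((ray_length s / M.+1%:R) *: ((1, s) : R * R)) M.+1 x| <= 4 * L * pi.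
Proof.
have E : hilb_sum g ((ray_length s / M.+1%:R) *: ((1, s) : R * R)) M.+1 x =
    \sum_(m < M.+1) ray_length s / M.+1%:R * hdiff s ((m%:R + 2^-1) * (ray_length s / M.+1%:R)).
  rewrite /hilb_sum; apply: eq_bigr => m _.
  rewrite /hilb_diff /hdiff /kdiff /half_inv !scalerA.
  have : ray_length s / M.+1%:R != 0 by rewrite mulf_neq0// ?gt_eqF ?ray_length_gt0// invr_neq0.
  have : m%:R + 2^-1 != 0 :> R by rewrite gt_eqF// half_gt0.
  move: (m%:R + 2^-1) (ray_length s / M.+1%:R) => a b a0 b0.
  by move: (g _ - g _) => c; field; rewrite a0 b0.
rewrite E; apply: (le_trans (ler_norm_sum _ _ _)).
have L_ := ray_length_gt0 s.
apply: (@le_trans _ _ (\sum_(m < M.+1) ray_length s / M.+1%:R * C s)).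
  apply: ler_sum => m _; rewrite normrM ger0_norm; last by rewrite divr_ge0// ltW.
  apply: ler_wpM2l; first by rewrite divr_ge0// ltW.
  apply: hbound; move: (ray_length s) L_ => l l0; rewrite mulr_gt0 ?half_gt0 ?divr_gt0//=.
  rewrite mulrA ler_pdivrMr// mulrC ler_pM2l//.
  have : m%:R + 1 <= M.+1%:R :> R by rewrite natr1 ler_nat.
  lra.
rewrite sumr_const card_ord.
have -> : ray_length s / M.+1%:R * C s *+ M.+1 = ray_length s * C s.
  rewrite -[LHS]mulr_natl.
  by move: (ray_length s) (C s) => l c; field; rewrite addrC natr1 pnatr_eq0.
rewrite /C; have [h1 h2] := ray_length_le s.
have -> : ray_length s * (2 * L * (1 + `|s|)) = 2 * L * (ray_length s + ray_length s * `|s|) by ring.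
have -> : 4 * L * pi = 2 * L * (pi + pi) by move: pi => p; ring.
by apply: ler_wpM2l; [rewrite mulr_ge0|rewrite lerD].
Qed.

End at_point.
End odd_part.
End rotation.

(** * Square integrability of the singular part *)

Section plane_sigma_finite.
Context {R : realType}.
Local Notation RM := (measurableTypeR R).
Local Notation leb := (@lebesgue_measure R).
Local Notation leb2 := (leb \x leb)%E.

Lemma leb2_sigma_finite : sigma_finite setT (leb2 : set (RM * RM) -> \bar R).
Proof.
exists (fun n => tbox n); last first.
  by move=> n; split; [exact: measurable_tbox|exact: leb2_tbox_lty].
apply/esym/seteqP; split => // x _.
have [n hn] : exists n : nat, `|x.1| + `|x.2| <= n%:R.
  by exists (Num.bound (`|x.1| + `|x.2|)); apply/ltW; apply: archi_boundP; exact: addr_ge0.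
exists n => //; apply/tboxP.
have hp : n%:R <= n%:R * pi :> R by rewrite ler_peMr//; have := @pi_ge2 R; lra.
split; apply: le_trans hp; apply: le_trans hn; rewrite ?lerDl ?lerDr//.
Qed.


(** A name for plane Lebesgue measure under which it is known to be sigma-finite,
    as needed for Tonelli's theorem on the product of the plane with a line or
    with another plane. *)
Definition plane_lebesgue : set (RM * RM)%type -> \bar R := leb2.
HB.instance Definition _ := Measure.copy plane_lebesgue leb2.
HB.instance Definition _ := @Measure_isSigmaFinite.Build _ (RM*RM)%type R plane_lebesgue leb2_sigma_finite.
End plane_sigma_finite.

Section odd_part_L2.
Context {R : realType}.
Local Notation RM := (measurableTypeR R).
Local Notation leb := (@lebesgue_measure R).
Local Notation leb2 := (leb \x leb)%E.
Implicit Types (x y : R * R) (f : R * R -> R).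

Variables (f : R * R -> R) (L B : R).
Hypotheses (L0 : 0 <= L) (lf : lipon (tbox 2) f L) (fB : forall z, tbox 2 z -> `|f z| <= B).

Let g := f \_ (tbox 2).

Let leb2s : {sigma_finite_measure set (RM * RM)%type -> \bar R} :=
  @plane_lebesgue R.

Let mf2 : measurable_fun (tbox 2) f. Proof. exact: lipon_measurable lf. Qed.

Lemma measurable_cut : measurable_fun setT g.
Proof. exact: (measurable_restrictT f (measurable_tbox 2)).1 mf2. Qed.

Let B0 : 0 <= B. Proof. exact: le_trans (fB (tbox0 2)). Qed.

Let gB x : `|g x| <= B.
Proof. by rewrite /g patchE; case: ifPn => [/[!inE]/fB//|_]; rewrite normr0. Qed.

Let mT : @measurable _ (RM * RM)%type setT. Proof. exact: measurableT. Qed.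
Let mB n : @measurable _ (RM * RM)%type (tbox n). Proof. exact: measurable_tbox. Qed.

Let if2 : leb2.-integrable (tbox 2) (EFin \o (fun x => f x ^+ 2)).
Proof.
apply: (@bounded_integrable _ _ _ leb2 _ _ (B ^+ 2)).
- exact: mB.
- exact: leb2_tbox_lty.
- exact: measurable_funX.
- by move=> x x2; rewrite normrX lerXn2r ?nnegrE// fB.
Qed.

Lemma integrable_cut2 : leb2.-integrable setT (EFin \o (fun x => g x ^+ 2)).
Proof.
have := (integrable_mkcond _ (mB 2)).1 if2.
apply: eq_integrable => // x _; rewrite /g /= !patchE; case: ifP => //= _.
by rewrite expr0n.
Qed.

Lemma integral_cut2 :
  (\int[leb2]_x (g x ^+ 2))%R = (\int[leb2]_(x in tbox 2) (f x ^+ 2))%R.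
Proof.
rewrite [RHS]Rintegral_mkcond; apply: eq_Rintegral => x _.
by rewrite /g !patchE; case: ifP => // _; rewrite expr0n.
Qed.

Let om (s : R) : R := (oneDsqr s)^-1.
Let om0 s : 0 < om s. Proof. by rewrite invr_gt0 (lt_le_trans ltr01)// oneDsqr_ge1. Qed.
Let mom : measurable_fun setT om. Proof. exact: measurable_oneDsqrV. Qed.

Definition oneDsqrV_mass : R := (\int[leb]_s (oneDsqr s)^-1)%R.

Let W := oneDsqrV_mass.

Lemma oneDsqrV_mass_ge0 : 0 <= W.
Proof. by apply: Rintegral_ge0 => s _; exact: ltW (om0 s). Qed.

Let iom c : leb.-integrable setT (EFin \o (fun s => c * om s)).
Proof.
have := integrableZl measurableT c integrable_oneDsqrV.
by apply: eq_integrable => // s _ /=; rewrite EFinM.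
Qed.

Let H M x s : R := hilb_sum g ((ray_length s / M.+1%:R) *: ((1, s) : R * R)) M.+1 x.

Let mH M : measurable_fun setT (fun z : (RM * RM) * RM => H M z.1 z.2).
Proof.
have mr : measurable_fun setT (fun s : R => ray_length s / M.+1%:R).
  by apply: measurable_funM => //; exact: measurable_ray_length.
have mu (c : R) : measurable_fun setT (fun z : (RM * RM) * RM => c * (ray_length z.2 / M.+1%:R)).
  apply: measurable_funM => //.
  exact: (measurableT_comp mr (@measurable_snd _ _ _ _)).
have mv (c : R) : measurable_fun setT (fun z : (RM * RM) * RM =>
    z.1 + c *: ((ray_length z.2 / M.+1%:R) *: ((1, z.2) : R * R))).
  have e : (fun z : (RM * RM) * RM => (z.1.1 + c * (ray_length z.2 / M.+1%:R), z.1.2 + c * (ray_length z.2 / M.+1%:R) * z.2)) =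
      (fun z => z.1 + c *: ((ray_length z.2 / M.+1%:R) *: ((1, z.2) : R * R))).
    apply/funext => -[[a b] s]; rewrite scalerA; congr pair; congr (_ + _).
    by rewrite /= -[LHS]mulr1.
  rewrite -e; apply: measurable_fun_pair; apply: measurable_funD.
  - exact: (measurableT_comp (@measurable_fst _ _ RM RM) (@measurable_fst _ _ (RM * RM)%type RM)).
  - exact: mu.
  - exact: (measurableT_comp (@measurable_snd _ _ RM RM) (@measurable_fst _ _ (RM * RM)%type RM)).
  - apply: measurable_funM; first exact: mu.
    exact: measurable_snd.
rewrite /H /hilb_sum.
under eq_fun do rewrite -(big_mkord xpredT (fun m => half_inv m * hilb_diff g _ m _)).
apply: measurable_sum => m; apply: measurable_funM => //; apply: measurable_funB.
  exact: (measurableT_comp measurable_cut (mv _)).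
have := measurableT_comp measurable_cut (mv (- (m%:R + 2^-1))).
by apply: eq_measurable_fun => z _ /=; rewrite scaleNr.
Qed.

Let K (M : nat) : R := \sum_(m < M.+1) half_inv m * (B + B).

Let HK M x s : `|H M x s| <= K M.
Proof.
apply: (le_trans (ler_norm_sum _ _ _)); apply: ler_sum => m _.
rewrite normrM (gtr0_norm (half_inv_gt0 m)); apply: ler_wpM2l; first exact: ltW (half_inv_gt0 m).
by apply: (le_trans (ler_normB _ _)); exact: lerD.
Qed.

Section component.
Variable i : bool.

Let A M x : R := (\int[leb]_s (line_weight i s * H M x s))%R.

Let mHx M x : measurable_fun setT (H M x).
Proof. exact: (measurableT_comp (mH M) (@measurable_pair1 _ _ (RM * RM)%type RM x)). Qed.

Let mwH M x : measurable_fun setT (fun s => line_weight i s * H M x s).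
Proof. by apply: measurable_funM; [exact: measurable_line_weight|exact: mHx]. Qed.

Let mA M : measurable_fun setT (A M).
Proof.
apply: (@measurable_Rintegral_param _ _ (RM * RM)%type RM R leb
  (fun z => line_weight i z.2 * H M z.1 z.2)).
apply: measurable_funM; last exact: mH.
exact: (measurableT_comp (measurable_line_weight i (D := setT)) (@measurable_snd _ _ _ _)).
Qed.

Let wH_le M x s : tbox 1 x -> `|line_weight i s * H M x s| <= 4 * L * pi * om s.
Proof.
move=> x1; rewrite normrM mulrC; apply: ler_pM => //; last exact: line_weight_bound.
exact: (hilb_sum_bound L0 lf x1 s M).
Qed.

Let A_cvg x : tbox 1 x -> A M x @[M --> \oo] --> riesz_op_odd i f x.
Proof.
move=> x1; rewrite (riesz_op_odd_fan L0 lf i x1).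
apply: (@Rdominated_convergence _ RM _ leb setT (fun M s => line_weight i s * H M x s) _
  (fun s => 4 * L * pi * om s)).
- exact: measurableT.
- by move=> M; exact: mwH.
- move=> s _; by apply: cvgM; [exact: cvg_cst|apply: (hilb_sum_cvg lf x1)].
- exact: iom.
- by move=> M s _; exact: wH_le.
Qed.

Let A_le M x : tbox 1 x -> `|A M x| <= 4 * L * pi * W.
Proof.
move=> x1; rewrite -[leRHS]RintegralZl//; last exact: integrable_oneDsqrV.
apply: (@norm_Rintegral_le _ RM _ leb setT).
- exact: measurableT.
- exact: mwH.
- exact: iom.
by move=> s _; exact: wH_le.
Qed.

Let iH2 M x : leb.-integrable setT (EFin \o (fun s => om s * H M x s ^+ 2)).
Proof.
apply: (@le_norm_integrable _ RM _ leb setT _ (fun s => K M ^+ 2 * om s)).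
- exact: measurableT.
- by apply: measurable_funM => //; apply: measurable_funX; exact: mHx.
- exact: iom.
- move=> s _; rewrite normrM (gtr0_norm (om0 s)) mulrC ler_pM2r ?om0//.
  by rewrite normrX lerXn2r ?nnegrE ?HK// (le_trans _ (HK M x s)).
Qed.

(** Cauchy-Schwarz in the slope, for the weight [1 / (1 + s^2)] that dominates
    [line_weight]. *)
Let A_sqr M x : A M x ^+ 2 <= W * (\int[leb]_s (om s * H M x s ^+ 2))%R.
Proof.
have q1 s : `|line_weight i s / om s| <= 1.
  rewrite normrM normfV (gtr0_norm (om0 s)) ler_pdivrMr ?om0// mul1r.
  exact: line_weight_bound.
have -> : A M x = (\int[leb]_s (om s * (line_weight i s / om s * H M x s)))%R.
  apply: eq_Rintegral => s _; move: (om0 s) (line_weight _ _) (H _ _ _) => /lt0r_neq0.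
  by move: (om s) => o o0 w h; field.
have h_le s : `|line_weight i s / om s * H M x s| <= `|H M x s|.
  by rewrite normrM ler_piMl.
have mh : measurable_fun setT (fun s => line_weight i s / om s * H M x s).
  apply: measurable_funM => //; apply: measurable_funM; first exact: measurable_line_weight.
  exact: (measurableT_comp (@measurable_invr R setT) mom).
apply: (le_trans (@Rintegral_weighted_square _ RM _ leb setT om _ measurableT mom mh _ integrable_oneDsqrV _)).
- by move=> s _; exact: ltW (om0 s).
- by exists (K M) => s _; exact: le_trans (h_le s) (HK M x s).
apply: ler_wpM2l; first exact: oneDsqrV_mass_ge0.
apply: le_Rintegral => //.
- apply: (@le_norm_integrable _ RM _ leb setT _ (fun s => om s * H M x s ^+ 2)).
  + exact: measurableT.
  + by apply: measurable_funM => //; exact: measurable_funX.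
  + exact: iH2.
  + move=> s _; rewrite normrM (gtr0_norm (om0 s)) ler_pM2l ?om0//.
    rewrite normrX -[leRHS]real_normK ?num_real//.
    by rewrite lerXn2r ?nnegrE ?h_le.
move=> s _; rewrite ler_pM2l ?om0// -[leLHS]real_normK ?num_real//.
rewrite -[leRHS]real_normK ?num_real//.
by rewrite lerXn2r ?nnegrE ?h_le.
Qed.

Let I2 := (\int[leb2]_(x in tbox 2) (f x ^+ 2))%R.

Let H_L2 M s : (\int[leb2]_x (H M x s ^+ 2)%:E <= (28 * I2)%:E)%E.
Proof.
have i2 := integrable_hilb_sum2 measurable_cut integrable_cut2 ((ray_length s / M.+1%:R) *: ((1, s) : R * R)) M.+1.
have := hilb_sum_L2 measurable_cut integrable_cut2 ((ray_length s / M.+1%:R) *: ((1, s) : R * R)) M.+1.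
rewrite integral_cut2 -lee_fin /Rintegral fineK//.
exact: integrable_fin_num i2.
Qed.

(** Tonelli: for each slope the discretised Hilbert transform is bounded on L^2
    with the same constant. *)
Let A_L2 M : (\int[leb2]_x (A M x ^+ 2)%:E <= (28 * W ^+ 2 * I2)%:E)%E.
Proof.
pose F (z : (RM * RM) * RM) : \bar R := (om z.2 * H M z.1 z.2 ^+ 2)%:E.
have mF : measurable_fun setT F.
  apply/measurable_EFinP; apply: measurable_funM; last by apply: measurable_funX; exact: mH.
  exact: (measurableT_comp mom (@measurable_snd _ _ _ _)).
have F0 z : (0 <= F z)%E by rewrite lee_fin mulr_ge0 ?sqr_ge0// (ltW (om0 _)).
have mFF := @measurable_fun_fubini_tonelli_F _ _ (RM * RM)%type RM R leb _ mF F0.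
apply: (@le_trans _ _ (\int[leb2]_x (W%:E * \int[leb]_s F (x, s)))%E).
  apply: ge0_le_integral => //.
  - by move=> x _; rewrite lee_fin sqr_ge0.
  - by apply/measurable_EFinP; apply: measurable_funX; exact: mA.
  - by apply: measurable_funeM.
  - move=> x _; apply: (@le_trans _ _ (W * (\int[leb]_s (om s * H M x s ^+ 2))%R)%:E).
      by rewrite lee_fin; exact: A_sqr.
    by rewrite EFinM /Rintegral [X in (_ * X <= _)%E]fineK//; exact: integrable_fin_num (iH2 M x).
rewrite ge0_integralZl_EFin//; last 2 first.
- by move=> x _; exact: integral_ge0.
- exact: oneDsqrV_mass_ge0.
have -> := @fubini_tonelli _ _ (RM * RM)%type RM R leb2s leb _ mF F0.
rewrite (_ : 28 * W ^+ 2 * I2 = W * (W * (28 * I2))); last by ring.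
rewrite EFinM; apply: lee_wpmul2l; first by rewrite lee_fin oneDsqrV_mass_ge0.
have I0 : 0 <= 28 * I2 by rewrite mulr_ge0//; apply: Rintegral_ge0 => x _; exact: sqr_ge0.
apply: (@le_trans _ _ (\int[leb]_s ((28 * I2)%:E * (om s)%:E))%E).
  apply: ge0_le_integral => //.
  - by move=> s _; exact: integral_ge0.
  - exact: (@measurable_fun_fubini_tonelli_G _ _ (RM * RM)%type RM R leb2s _ mF F0).
  - by apply: measurable_funeM; exact/measurable_EFinP.
  - move=> s _; rewrite /F /=.
    under eq_integral => x _ do rewrite EFinM.
    rewrite ge0_integralZl_EFin//; last 3 first.
    + by move=> x _; rewrite lee_fin sqr_ge0.
    + apply/measurable_EFinP; apply: measurable_funX.
      exact: measurable_hilb_sum measurable_cut _ _.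
    + exact: ltW (om0 s).
    by rewrite muleC; apply: lee_wpmul2r; [rewrite lee_fin (ltW (om0 s))|exact: H_L2].
rewrite ge0_integralZl_EFin//; last 2 first.
- by move=> s _; rewrite lee_fin (ltW (om0 s)).
- exact/measurable_EFinP.
rewrite (mulrC W) [leRHS]EFinM; apply: lee_wpmul2l; first by rewrite lee_fin.
rewrite /W /oneDsqrV_mass /Rintegral fineK//.
exact: integrable_fin_num integrable_oneDsqrV.
Qed.

Lemma measurable_riesz_op_odd : measurable_fun (tbox 1) (riesz_op_odd i f).
Proof.
apply: (@measurable_fun_cvg _ _ _ (tbox 1) A) => [M|x x1]; last exact: A_cvg.
exact: measurable_funTS.
Qed.

(** The discretised operators converge pointwise and boundedly on the box, so
    their uniform L^2 bound passes to the limit. *)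
Lemma riesz_op_odd_L2 : (\int[leb2]_(x in tbox 1) (riesz_op_odd i f x ^+ 2))%R <=
  28 * W ^+ 2 * (\int[leb2]_(x in tbox 2) (f x ^+ 2))%R.
Proof.
have c0 : 0 <= 4 * L * pi * W by rewrite !mulr_ge0// ?pi_ge0// oneDsqrV_mass_ge0.
have iA M : leb2.-integrable (tbox 1) (EFin \o (fun x => A M x ^+ 2)).
  apply: (@bounded_integrable _ _ _ leb2 _ _ ((4 * L * pi * W) ^+ 2)).
  - exact: mB.
  - exact: leb2_tbox_lty.
  - by apply: measurable_funTS; apply: measurable_funX; exact: mA.
  - by move=> x x1; rewrite normrX lerXn2r ?nnegrE// A_le.
have C : (\int[leb2]_(x in tbox 1) (A M x ^+ 2))%R @[M --> \oo] -->
    (\int[leb2]_(x in tbox 1) (riesz_op_odd i f x ^+ 2))%R.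
  apply: (@Rdominated_convergence _ _ _ leb2 (tbox 1) (fun M x => A M x ^+ 2) _
    (cst ((4 * L * pi * W) ^+ 2))).
  - exact: mB.
  - by move=> M; apply: measurable_funTS; apply: measurable_funX; exact: mA.
  - move=> x x1; rewrite expr2; under eq_fun do rewrite expr2.
    by apply: cvgM; exact: A_cvg.
  - apply: (@bounded_integrable _ _ _ leb2 _ _ `|(4 * L * pi * W) ^+ 2|) => //.
    exact: leb2_tbox_lty.
  - by move=> M x x1; rewrite normrX lerXn2r ?nnegrE// A_le.
rewrite -(cvg_lim _ C)//; apply: limr_le; first by apply/cvg_ex; eexists; exact: C.
apply: nearW => M; rewrite -lee_fin /Rintegral fineK; last exact: integrable_fin_num (iA M).
apply: le_trans (A_L2 M); apply: ge0_subset_integral => //.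
- by apply/measurable_EFinP; apply: measurable_funX; exact: mA.
- by move=> x _; rewrite lee_fin sqr_ge0.
Qed.

End component.
End odd_part_L2.

(** * The L^2 bound *)

Section riesz_L2.
Context {R : realType}.
Local Notation RM := (measurableTypeR R).
Local Notation leb := (@lebesgue_measure R).
Local Notation leb2 := (leb \x leb)%E.
Implicit Types (x y : R * R) (f h : R * R -> R).

Lemma Lpnorm2E (X : set (R * R)) h :
  @measurable _ (RM * RM)%type X ->
  leb2.-integrable X (EFin \o (fun x => h x ^+ 2)) ->
  Lpnorm 2%:E X h = (Num.sqrt (\int[leb2]_(x in X) (h x ^+ 2))%R)%:E.
Proof.
move=> mX ih; rewrite /Lpnorm unlock.
have -> : (\int[leb2]_x (`|(EFin \o h \_ X) x| `^ 2) =
    (\int[leb2]_(x in X) (h x ^+ 2))%:E)%E.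
  rewrite Rintegral_mkcond /Rintegral fineK; last first.
    apply: integrable_fin_num => //.
    have := (integrable_mkcond _ mX).1 ih.
    by apply: eq_integrable => // x _; rewrite /= !patchE; case: ifP.
  apply: eq_integral => x _; rewrite [(_ \o _) x]/= !patchE.
  by case: ifP => _ /=; rewrite powR_mulrn// real_normK ?num_real// expr0n.
by rewrite poweR_EFin powR12_sqrt//; apply: Rintegral_ge0 => x _; exact: sqr_ge0.
Qed.

(** The part of [riesz_op] with the bounded kernel. *)
Definition riesz_op_reg (i : bool) f x : R := (\int[leb2]_(y in tbox 1) (f (x + y) * lattice_corr i y))%R.

Section bounded_lipschitz.
Variables (f : R * R -> R) (L B : R).
Hypotheses (L0 : 0 <= L) (lf : lipon (tbox 2) f L) (fB : forall z, tbox 2 z -> `|f z| <= B).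

Let g := f \_ (tbox 2).
Let mg : measurable_fun setT g := measurable_cut lf.
Let mT : @measurable _ (RM * RM)%type setT. Proof. exact: measurableT. Qed.
Let mB n : @measurable _ (RM * RM)%type (tbox n). Proof. exact: measurable_tbox. Qed.
Let B0 : 0 <= B. Proof. exact: le_trans (fB (tbox0 2)). Qed.
Let gB x : `|g x| <= B.
Proof. by rewrite /g patchE; case: ifPn => [/[!inE]/fB//|_]; rewrite normr0. Qed.

Let I2 := (\int[leb2]_(x in tbox 2) (f x ^+ 2))%R.
Let I2_ge0 : 0 <= I2. Proof. by apply: Rintegral_ge0 => x _; exact: sqr_ge0. Qed.

Lemma riesz_op_split i x : tbox 1 x -> riesz_op i f x = riesz_op_odd i f x + riesz_op_reg i f x.
Proof.
move=> x1; rewrite /riesz_op /sym_integrand RintegralD//.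
- have mS : measurable_fun (tbox 1) (fun y => (f (x + y) - f (x - y)) / 2 * riesz_coord i y).
    have mf := lipon_measurable lf.
    apply: measurable_funM; last exact: measurable_riesz_coord.
    apply: measurable_funM => //; apply: measurable_funB.
      have := measurable_shift (normr1 _) mf x1.
      by apply: eq_measurable_fun => y _; rewrite scale1r.
    have := measurable_shift (normrN1 _) mf x1.
    by apply: eq_measurable_fun => y _; rewrite scaleN1r.
  apply: (@le_norm_integrable _ _ _ leb2 (tbox 1) _ (fun y => 2 * L * (enorm y)^-1)) => //.
  + have := integrableZl (mB 1) (2 * L) integrable_inv_enorm.
    by apply: eq_integrable => // y _ /=; rewrite EFinM.
  + by move=> y y1; exact: odd_diff_bound L0 lf x1 y1.
- have mS : measurable_fun (tbox 1) (fun y => f (x + y)).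
    have := measurable_shift (normr1 _) (lipon_measurable lf) x1.
    by apply: eq_measurable_fun => y _; rewrite scale1r.
  apply: (@bounded_integrable _ _ _ leb2 _ _ (B * lattice_corr_max)).
  + exact: mB.
  + exact: leb2_tbox_lty.
  + by apply: measurable_funM => //; exact: measurable_lattice_corr.
  + move=> y y1; rewrite normrM; apply: ler_pM => //; last exact: lattice_corr_bound.
    by apply: fB; exact: tboxD1.
Qed.

Let corr1 i : R * R -> R := lattice_corr i \_ (tbox 1).
Let mcorr1 i : measurable_fun setT (corr1 i).
Proof. exact: (measurable_restrictT _ (measurable_tbox 1)).1 (measurable_lattice_corr i). Qed.

Let regE i x : tbox 1 x -> riesz_op_reg i f x = (\int[leb2]_y (g (x + y) * corr1 i y))%R.
Proof.
move=> x1; rewrite /riesz_op_reg Rintegral_mkcond; apply: eq_Rintegral => y _.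
rewrite /corr1 /g !patchE; case: ifPn => [/[!inE] y1|_]; last by rewrite mulr0.
by rewrite ifT// inE; exact: tboxD1.
Qed.

Lemma measurable_riesz_op_reg i : measurable_fun (tbox 1) (riesz_op_reg i f).
Proof.
apply: (@eq_measurable_fun _ _ _ _ _ (fun x => (\int[leb2]_y (g (x + y) * corr1 i y))%R)).
  by move=> x /[!inE] x1; rewrite regE.
apply: measurable_funTS.
apply: (@measurable_Rintegral_param _ _ (RM * RM)%type (RM * RM)%type R (@plane_lebesgue R)
  (fun z => g (z.1 + z.2) * corr1 i z.2)).
apply: measurable_funM; last exact: (measurableT_comp (mcorr1 i) (@measurable_snd _ _ _ _)).
have ma : measurable_fun setT (fun z : (RM * RM) * (RM * RM) => (z.1.1 + z.2.1, z.1.2 + z.2.2)).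
  apply: measurable_fun_pair; apply: measurable_funD.
  - exact: (measurableT_comp (@measurable_fst _ _ RM RM) (@measurable_fst _ _ (RM * RM)%type (RM * RM)%type)).
  - exact: (measurableT_comp (@measurable_fst _ _ RM RM) (@measurable_snd _ _ (RM * RM)%type (RM * RM)%type)).
  - exact: (measurableT_comp (@measurable_snd _ _ RM RM) (@measurable_fst _ _ (RM * RM)%type (RM * RM)%type)).
  - exact: (measurableT_comp (@measurable_snd _ _ RM RM) (@measurable_snd _ _ (RM * RM)%type (RM * RM)%type)).
exact: (measurableT_comp mg ma).
Qed.

(** Cauchy-Schwarz on the box, whose area is [(2 * pi) ^ 2]. *)
Lemma riesz_op_reg_sqr i x : tbox 1 x -> riesz_op_reg i f x ^+ 2 <= (2 * pi * lattice_corr_max) ^+ 2 * I2.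
Proof.
move=> x1.
have mS : measurable_fun (tbox 1) (fun y => g (x + y)).
  apply: measurable_funTS.
  by under eq_fun => y do rewrite addrC; exact: measurable_shiftT.
have one : leb2.-integrable (tbox 1) (EFin \o cst 1).
  apply: (@bounded_integrable _ _ _ leb2 _ _ 1) => //; first exact: leb2_tbox_lty.
  by move=> y _; rewrite normr1.
have h_le y : tbox 1 y -> `|g (x + y) * lattice_corr i y| <= B * lattice_corr_max.
  by move=> y1; rewrite normrM; apply: ler_pM => //; exact: lattice_corr_bound.
have -> : riesz_op_reg i f x = (\int[leb2]_(y in tbox 1) (1 * (g (x + y) * lattice_corr i y)))%R.
  apply: eq_Rintegral => y /[!inE] y1; rewrite mul1r /g patchE ifT// inE.
  exact: tboxD1.
apply: (le_trans (@Rintegral_weighted_square _ _ _ leb2 (tbox 1) (cst 1) _ (mB 1) _ _ _ one _)) => //.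
- by apply: measurable_funM => //; exact: measurable_lattice_corr.
- by exists (B * lattice_corr_max).
rewrite Rintegral_cst//.
have -> : fine (leb2 (tbox 1)) = (2 * pi) ^+ 2 by rewrite leb2_tbox mul1r.
rewrite [1 * _]mul1r.
have -> : (2 * pi * lattice_corr_max) ^+ 2 * I2 = (2 * pi) ^+ 2 * (lattice_corr_max ^+ 2 * I2).
  by rewrite [(2 * pi * lattice_corr_max) ^+ 2]exprMn mulrA.
apply: ler_wpM2l; first exact: sqr_ge0.
have ig2 := integrable_shift x (integrable_cut2 lf fB).
have ig2' : leb2.-integrable (tbox 1) (EFin \o (fun y => lattice_corr_max ^+ 2 * g (y + x) ^+ 2)).
  have := integrableZl mT (lattice_corr_max ^+ 2) ig2.
  by move=> /(integrableS mT (mB 1) (@subsetT _ _)); apply: eq_integrable => // y _ /=; rewrite EFinM.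
apply: (@le_trans _ _ (\int[leb2]_(y in tbox 1) (lattice_corr_max ^+ 2 * g (y + x) ^+ 2))%R).
  apply: (@le_trans _ _ `|\int[leb2]_(y in tbox 1) (cst 1 y * (g (x + y) * lattice_corr i y) ^+ 2)|%R).
    exact: ler_norm.
  apply: norm_Rintegral_le.
  - exact: mB.
  - by apply: measurable_funM => //; apply: measurable_funX; apply: measurable_funM => //; exact: measurable_lattice_corr.
  - exact: ig2'.
  - move=> y y1; rewrite mul1r ger0_norm ?sqr_ge0// exprMn mulrC addrC.
    apply: ler_wpM2r; first exact: sqr_ge0.
    rewrite -[leLHS]real_normK ?num_real// lerXn2r ?nnegrE ?lattice_corr_max_ge0//.
    exact: lattice_corr_bound.
rewrite RintegralZl//; last exact: integrableS mT (mB 1) (@subsetT _ _) ig2.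
apply: ler_wpM2l; first exact: sqr_ge0.
rewrite /I2 -(integral_cut2 f) -(Rintegral_shift (h := fun x => g x ^+ 2) x); last exact: measurable_funX.
rewrite -lee_fin /Rintegral !fineK.
- apply: ge0_subset_integral => //.
  + by have /integrableP[] := ig2.
  + by move=> y _; rewrite lee_fin sqr_ge0.
- exact: integrable_fin_num ig2.
- by apply: integrable_fin_num => //; exact: integrableS mT (mB 1) (@subsetT _ _) ig2.
Qed.

Definition riesz_L2_const : R :=
  4 * (28 * (@oneDsqrV_mass R) ^+ 2) + 4 * ((2 * pi * lattice_corr_max) ^+ 2 * (2 * pi) ^+ 2).

Lemma measurable_riesz_op i : measurable_fun (tbox 1) (riesz_op i f).
Proof.
apply: (@eq_measurable_fun _ _ _ _ _ (fun x => riesz_op_odd i f x + riesz_op_reg i f x)).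
  by move=> x /[!inE] x1; rewrite riesz_op_split.
apply: measurable_funD; [exact: measurable_riesz_op_odd L0 lf i|exact: measurable_riesz_op_reg].
Qed.

Lemma measurable_Rtilde : measurable_fun (tbox 1) (Rtilde f).
Proof.
have mr i : measurable_fun setT (riesz_op i f \_ (tbox 1)).
  exact: (measurable_restrictT _ (measurable_tbox 1)).1 (measurable_riesz_op i).
apply: (@eq_measurable_fun _ _ _ _ _
    (fun x => ((riesz_op false f \_ (tbox 1)) x, (riesz_op true f \_ (tbox 1)) x))).
  move=> x /[!inE] x1; have q i : (riesz_op i f \_ (tbox 1)) x = riesz_op i f x by rewrite patchE ifT// inE.
  exact: etrans (congr2 pair (q false) (q true)) (esym (Rtilde_riesz_op lf fB x1)).
by apply: measurable_funTS; apply: measurable_fun_pair; exact: mr.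
Qed.

Let iop2 i : leb2.-integrable (tbox 1) (EFin \o (fun x => riesz_op i f x ^+ 2)).
Proof.
apply: (@bounded_integrable _ _ _ leb2 _ _ ((riesz_op_const * (L + B)) ^+ 2)).
- exact: mB.
- exact: leb2_tbox_lty.
- by apply: measurable_funX; exact: measurable_riesz_op.
- move=> x x1; rewrite normrX lerXn2r ?nnegrE ?mulr_ge0 ?riesz_op_const_ge0 ?addr_ge0//.
  by apply: (riesz_op_bound i lf fB x1); rewrite ?lerDl ?lerDr.
Qed.

Let iodd2 i : leb2.-integrable (tbox 1) (EFin \o (fun x => 2 * riesz_op_odd i f x ^+ 2)).
Proof.
have m0 : measurable_fun (tbox 1) (riesz_op_odd i f) := measurable_riesz_op_odd L0 lf i.
pose c : R := (2 * pi * lattice_corr_max) ^+ 2 * I2.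
have c0 : 0 <= c by rewrite mulr_ge0 ?sqr_ge0.
apply: (@bounded_integrable _ _ _ leb2 _ _ (4 * (riesz_op_const * (L + B)) ^+ 2 + 4 * c)).
- exact: mB.
- exact: leb2_tbox_lty.
- by apply: measurable_funM => //; exact: measurable_funX.
- move=> x x1; have h1 := riesz_op_reg_sqr i x1.
  have h2 : `|riesz_op i f x| <= riesz_op_const * (L + B).
    by apply: (riesz_op_bound i lf fB x1); rewrite ?lerDl ?lerDr.
  have h3 : riesz_op i f x ^+ 2 <= (riesz_op_const * (L + B)) ^+ 2.
    rewrite -[leLHS]real_normK ?num_real// lerXn2r ?nnegrE//.
    exact: le_trans h2.
  rewrite ger0_norm; last by rewrite mulr_ge0// sqr_ge0.
  have -> : riesz_op_odd i f x = riesz_op i f x - riesz_op_reg i f x by rewrite riesz_op_split// addrK.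
  move: h1 h3; rewrite -/c; move: (riesz_op i f x) (riesz_op_reg i f x) (riesz_op_const * (L + B)) c {c0} => a b r c h1 h3.
  have := sqr_ge0 (a + b); nra.
Qed.

Lemma riesz_op_L2 i : (\int[leb2]_(x in tbox 1) (riesz_op i f x ^+ 2))%R <=
  (2 * (28 * (@oneDsqrV_mass R) ^+ 2) + 2 * ((2 * pi * lattice_corr_max) ^+ 2 * (2 * pi) ^+ 2)) * I2.
Proof.
pose c : R := 2 * ((2 * pi * lattice_corr_max) ^+ 2 * I2).
have ic : leb2.-integrable (tbox 1) (EFin \o cst c).
  apply: (@bounded_integrable _ _ _ leb2 _ _ `|c|) => //; exact: leb2_tbox_lty.
apply: (@le_trans _ _ (\int[leb2]_(x in tbox 1) (2 * riesz_op_odd i f x ^+ 2 + cst c x))%R).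
  apply: le_Rintegral => //.
  - by have := integrableD (mB 1) (iodd2 i) ic; apply: eq_integrable.
  - move=> x x1 /=; have := riesz_op_reg_sqr i x1; rewrite riesz_op_split// /c.
    move: (riesz_op_odd i f x) (riesz_op_reg i f x) (_ * I2) => a b r.
    by have := sqr_ge0 (a - b); nra.
rewrite RintegralD//.
rewrite Rintegral_cst; last exact: mB.
have -> : fine (leb2 (tbox 1)) = (2 * pi) ^+ 2 by rewrite leb2_tbox mul1r.
have -> : (\int[leb2]_(x in tbox 1) (2 * riesz_op_odd i f x ^+ 2))%R =
    2 * (\int[leb2]_(x in tbox 1) (riesz_op_odd i f x ^+ 2))%R.
  have i0 : leb2.-integrable (tbox 1) (EFin \o (fun x => riesz_op_odd i f x ^+ 2)).
    have := integrableZl (mB 1) 2^-1 (iodd2 i).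
    by apply: eq_integrable => // x _ /=; rewrite -EFinM mulrA mulVf ?mul1r// pnatr_eq0.
  by rewrite RintegralZl.
have := riesz_op_odd_L2 L0 lf fB i; rewrite -/I2 /c.
move: (\int[leb2]_(x in tbox 1) _)%R (28 * (@oneDsqrV_mass R) ^+ 2) ((2 * pi * lattice_corr_max) ^+ 2) ((2 * pi) ^+ 2) => a w p q h.
have -> : (2 * w + 2 * (p * q)) * I2 = 2 * (w * I2) + 2 * (p * I2) * q by ring.
by rewrite lerD2r ler_pM2l.
Qed.

Lemma Rtilde_L2 : (Lpnorm 2%:E (tbox 1) (fun x => enorm (Rtilde f x))
  <= (Num.sqrt riesz_L2_const)%:E * Lpnorm 2%:E (tbox 2) f)%E.
Proof.
have ie : leb2.-integrable (tbox 1) (EFin \o (fun x => enorm (Rtilde f x) ^+ 2)).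
  have := integrableD (mB 1) (iop2 false) (iop2 true).
  apply: eq_integrable => // x /[!inE] x1.
  by rewrite /= (Rtilde_riesz_op lf fB x1) enorm_sqr.
have if2 : leb2.-integrable (tbox 2) (EFin \o (fun x => f x ^+ 2)).
  apply: (@bounded_integrable _ _ _ leb2 _ _ (B ^+ 2)).
  - exact: mB.
  - exact: leb2_tbox_lty.
  - by apply: measurable_funX; exact: lipon_measurable lf.
  - by move=> x x2; rewrite normrX lerXn2r ?nnegrE// fB.
rewrite !Lpnorm2E// -EFinM lee_fin -sqrtrM; last first.
  apply: addr_ge0; first by rewrite mulr_ge0// mulr_ge0// sqr_ge0.
  by rewrite mulr_ge0// mulr_ge0 ?sqr_ge0.
apply: ler_wsqrtr.
have -> : (\int[leb2]_(x in tbox 1) (enorm (Rtilde f x) ^+ 2))%R =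
    (\int[leb2]_(x in tbox 1) (riesz_op false f x ^+ 2))%R +
    (\int[leb2]_(x in tbox 1) (riesz_op true f x ^+ 2))%R.
  rewrite -RintegralD//.
  apply: eq_Rintegral => x /[!inE] x1.
  by rewrite (Rtilde_riesz_op lf fB x1) enorm_sqr.
have := lerD (riesz_op_L2 false) (riesz_op_L2 true); rewrite /riesz_L2_const -/I2.
move: (28 * (@oneDsqrV_mass R) ^+ 2) ((2 * pi * lattice_corr_max) ^+ 2 * (2 * pi) ^+ 2) => w p /le_trans; apply.
by rewrite le_eqVlt; apply/orP; left; apply/eqP; ring.
Qed.

End bounded_lipschitz.
End riesz_L2.

(** * One-sided derivatives on boxes *)

Section slopes.
Context {R : realType}.
Implicit Types (X : set (R * R)) (x z v : R * R) (f : R * R -> R) (i j : bool).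

(** First-order expansions along a direction; unlike the difference quotient
    this form makes sense at the increment zero and adds up without fuss. *)
Definition slope X f x v (l : R) := forall e : R, 0 < e ->
  exists2 d : R, 0 < d & forall h : R, `|h| < d -> X (x + h *: v) ->
    `|f (x + h *: v) - f x - l * h| <= e * `|h|.

Lemma within_quotientP X f x v (l : R) :
  within_quotient X f x v --> l <-> slope X f x v l.
Proof.
have quot (h : R) : h != 0 -> `|l - h^-1 *: (f (x + h *: v) - f x)| * `|h| =
    `|f (x + h *: v) - f x - l * h|.
  move=> h0; rewrite -normrM -normrN; congr (Num.norm _).
  rewrite /GRing.scale /=; move: (f _ - f x) => w; by field.
split=> [/cvgrPdist_le H e e0|H].
  have := H e e0; rewrite near_withinE near_withinE => /nbhs_ballP[d /= d0 hd].
  exists d => // h hd' Xh; have [->|h0] := eqVneq h 0.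
    by rewrite scale0r addr0 subrr mulr0 subr0 normr0 mulr0.
  rewrite -quot//; apply: ler_wpM2r => //; apply: hd => //.
  by rewrite /ball/= sub0r normrN.
apply/cvgrPdist_le => e e0; have [d d0 hd] := H e e0.
rewrite near_withinE near_withinE; apply/nbhs_ballP; exists d => //= h.
rewrite /ball/= sub0r normrN => hd' h0 Xh.
have hp : 0 < `|h| by rewrite normr_gt0.
by rewrite -(ler_pM2r hp) quot//; exact: hd.
Qed.

Lemma eq_slope X f g x v l : (forall z, X z -> f z = g z) -> X x ->
  slope X f x v l -> slope X g x v l.
Proof.
move=> fg Xx H e e0; have [d d0 hd] := H e e0; exists d => // h h1 h2.
by rewrite -!fg//; exact: hd.
Qed.

Lemma axisE i (x : R * R) (h : R) :
  x + h *: axis i = if i then (x.1, x.2 + h) else (x.1 + h, x.2).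
Proof.
case: x i => a b [] /=; congr pair; rewrite /= ?addr0//.
- by rewrite -[RHS]addr0; congr (_ + _); exact: mulr0.
- by congr (_ + _); exact: mulr1.
- by congr (_ + _); exact: mulr1.
- by rewrite -[RHS]addr0; congr (_ + _); exact: mulr0.
Qed.

Lemma tbox_axis_convex n x i (h s : R) : tbox n x -> tbox n (x + h *: axis i) ->
  Num.min 0 h <= s <= Num.max 0 h -> tbox n (x + s *: axis i).
Proof.
rewrite !tboxP !axisE => -[h1 h2].
case: i => /= -[h3 h4] /andP[h5 h6]; split => //; apply/ler_normlP;
  move/ler_normlP: h1 => [h1 h1']; move/ler_normlP: h2 => [h2 h2'];
  move/ler_normlP: h3 => [h3 h3']; move/ler_normlP: h4 => [h4 h4'];
  move: h5 h6; rewrite ge_min le_max => /orP[?|?] /orP[?|?]; split; lra.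
Qed.

(** From any point of a box one can move by one unit along each axis, in one
    of the two orientations, without leaving the box. *)
Lemma tbox_room n x i : (0 < n)%N -> tbox n x ->
  exists2 e : R, `|e| = 1 & forall y : R * R, forall h : R,
    coord i y = coord i x -> tbox n y -> 0 <= h <= 1 -> tbox n (y + (e * h) *: axis i).
Proof.
move=> n0; rewrite tboxP => -[x1 x2].
have np : 1 <= n%:R * pi :> R.
  have n1 : 1 <= n%:R :> R by rewrite ler1n.
  have := @pi_ge2 R; nra.
exists (if coord i x <= 0 then 1 else -1); first by case: ifP; rewrite ?normrN1 ?normr1.
move=> y h yx; rewrite !tboxP axisE => -[y1 y2] /andP[h0 h1].
case: i yx => /= yx; split => //; rewrite yx; apply/ler_normlP;
  move/ler_normlP: x1 => [x1 x1']; move/ler_normlP: x2 => [x2 x2'];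
  case: ifPn; rewrite -?ltNge => ?; split; lra.
Qed.

(** Without this a limit of difference quotients would not be unique. *)
Lemma within_tbox_proper n x i : (0 < n)%N -> tbox n x ->
  ProperFilter (within [set h : R | tbox n (x + h *: axis i)] 0^').
Proof.
move=> n0 xn; apply: Build_ProperFilter_ex => P H.
have /nbhs_ballP[d /= d0 hd] :
  nbhs (0 : R) (fun h => h != 0 -> tbox n (x + h *: axis i) -> P h) by exact: H.
have [e e1 he] := tbox_room i n0 xn.
have m0 : 0 < Num.min 1 (d / 2) by rewrite lt_min ltr01 divr_gt0.
exists (e * Num.min 1 (d / 2)); apply: hd.
- rewrite /ball/= sub0r normrN normrM e1 mul1r gtr0_norm//.
  by rewrite gt_min; apply/orP; right; lra.
- by rewrite mulf_neq0 ?(gt_eqF m0)// -normr_eq0 e1 oner_eq0.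
- by apply: he => //; rewrite (ltW m0) ge_min lexx.
Qed.

Lemma slope_derive n f x i (l : R) : (0 < n)%N -> tbox n x ->
  slope (tbox n) f x (axis i) l ->
  derivable_in (tbox n) f x (axis i) /\ derive_in (tbox n) f x (axis i) = l.
Proof.
move=> n0 xn /within_quotientP h; have pf := within_tbox_proper i n0 xn.
split; first by apply/cvg_ex; exists l.
exact: (cvg_lim (@Rhausdorff R) h).
Qed.

Lemma derivable_slope X f x v : derivable_in X f x v ->
  slope X f x v (derive_in X f x v).
Proof. by move=> h; apply/within_quotientP. Qed.

(** Mean value inequality on a segment for a function with one-sided
    derivatives at the ends. *)
Lemma mean_value_segment (u l : R -> R) (a b K : R) : a <= b ->
  (forall s, a <= s <= b -> `|l s| <= K) ->
  (forall s, a <= s <= b -> forall e, 0 < e -> exists2 d, 0 < d &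
     forall h, `|h| < d -> a <= s + h <= b -> `|u (s + h) - u s - l s * h| <= e * `|h|) ->
  `|u b - u a| <= K * (b - a).
Proof.
move=> ab lK sl.
have [c cab ->] : exists2 c, c \in `[a, b]%R & u b - u a = l c * (b - a).
  apply: MVT_segment => //.
    move=> s; rewrite in_itv/= => /andP[as_ sb].
    have sab : a <= s <= b by rewrite !ltW.
    have C : (fun h => h^-1 *: ((u \o shift s) (h *: (1 : R)) - u s)) @ 0^' --> l s.
      apply/cvgrPdist_le => e e0; have [d d0 hd] := sl s sab e e0.
      rewrite near_withinE; apply/nbhs_ballP.
      exists (Num.min d (Num.min (s - a) (b - s))).
        by rewrite /= !lt_min d0 !subr_gt0 as_.
      move=> h; rewrite /ball/= sub0r normrN !lt_min => /and3P[h1 h2 h3] h0.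
      have hp : 0 < `|h| by rewrite normr_gt0.
      rewrite -(ler_pM2r hp); apply: le_trans (hd h h1 _); last first.
        have := ler_norm h; have := ler_norm (- h); rewrite normrN => ? ?.
        by apply/andP; split; lra.
      have -> : h *: (1 : R) = h by rewrite -[RHS]mulr1.
      rewrite -normrM -normrN le_eqVlt; apply/orP; left; apply/eqP; congr (Num.norm _).
      rewrite (addrC h) /GRing.scale /=; move: (u (s + h) - u s) => w; by field.
    apply: DeriveDef; first by apply/cvg_ex; exists (l s).
    by apply: cvg_lim => //; exact: Rhausdorff.
  apply/subspace_continuousP => s; rewrite /= in_itv/= => sab.
  apply/cvgrPdist_le => e e0; have [d d0 hd] := sl s sab 1 ltr01.
  have c0 : 0 < 1 + `|l s| by rewrite ltr_pwDl.
  rewrite near_withinE; apply/nbhs_ballP; exists (Num.min d (e / (1 + `|l s|))).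
    by rewrite /= lt_min d0 divr_gt0.
  move=> t; rewrite /ball/= distrC lt_min in_itv/= => /andP[h1 h2] tab.
  have := hd (t - s) h1; rewrite addrC subrK => /(_ tab); rewrite mul1r => h3.
  rewrite distrC; have -> : u t - u s = (u t - u s - l s * (t - s)) + l s * (t - s) by ring.
  apply: (le_trans (ler_normD _ _)); rewrite normrM.
  move: h2; rewrite ltr_pdivlMr//; lra.
rewrite normrM (ger0_norm (_ : 0 <= b - a)) ?subr_ge0//.
by apply: ler_wpM2r; [rewrite subr_ge0|apply: lK; move: cab; rewrite in_itv].
Qed.

(** The scalar [c] makes room for a second value of [f], with [c = 1] for the
    oscillation of difference quotients, and [m] for an affine correction, as in
    the second differences of [mixed_slopes]. *)
Lemma axis_mean_value n f (df : R * R -> R) i z z' (h c m K : R) :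
  tbox n z -> tbox n (z + h *: axis i) -> tbox n z' -> tbox n (z' + h *: axis i) ->
  (forall x, tbox n x -> slope (tbox n) f x (axis i) (df x)) ->
  (forall s, Num.min 0 h <= s <= Num.max 0 h ->
     `|df (z + s *: axis i) - c * df (z' + s *: axis i) - m| <= K) ->
  `|(f (z + h *: axis i) - c * f (z' + h *: axis i)) - (f z - c * f z') - m * h| <= K * `|h|.
Proof.
move=> X1 X2 X3 X4 sl bd.
pose u s := f (z + s *: axis i) - c * f (z' + s *: axis i) - m * s.
pose l s := df (z + s *: axis i) - c * df (z' + s *: axis i) - m.
have ab : Num.min 0 h <= Num.max 0 h by rewrite ge_min le_max lexx.
have := @mean_value_segment u l _ _ K ab bd.
have -> : K * (Num.max 0 h - Num.min 0 h) = K * `|h|.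
  congr (K * _); have [h0|h0] := leP 0 h.
    by rewrite ger0_norm// subr0.
  by rewrite ltr0_norm// sub0r.
have -> : `|u (Num.max 0 h) - u (Num.min 0 h)| = `|u h - u 0|.
  by have [h0|h0] := leP 0 h; rewrite // distrC.
have -> : u h - u 0 = f (z + h *: axis i) - c * f (z' + h *: axis i) - (f z - c * f z') - m * h.
  by rewrite /u !scale0r !addr0 mulr0; ring.
apply=> s sab e e0.
have Xs := tbox_axis_convex X1 X2 sab; have Xs' := tbox_axis_convex X3 X4 sab.
have c0 : 0 < 1 + `|c| by rewrite ltr_pwDl.
have e1 : 0 < e / (1 + `|c|) by rewrite divr_gt0.
have [d d0 hd] := sl _ Xs _ e1; have [d' d'0 hd'] := sl _ Xs' _ e1.
exists (Num.min d d'); first by rewrite lt_min d0.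
move=> t; rewrite lt_min => /andP[td td'] sab'.
have A w : w + (s + t) *: axis i = (w + s *: axis i) + t *: axis i :> R * R.
  by rewrite scalerDl addrA.
have Ys := tbox_axis_convex X1 X2 sab'; have Ys' := tbox_axis_convex X3 X4 sab'.
rewrite A in Ys; rewrite A in Ys'.
have := hd t td Ys; have := hd' t td' Ys'; rewrite /u /l !A.
set p := f _; set q := f _; set p' := f _; set q' := f _ => h1 h2.
have -> : p' - c * p - m * (s + t) - (q' - c * q - m * s) -
    (df (z + s *: axis i) - c * df (z' + s *: axis i) - m) * t =
    (p' - q' - df (z + s *: axis i) * t) - c * (p - q - df (z' + s *: axis i) * t) by ring.
apply: (le_trans (ler_normB _ _)); rewrite normrM.
have -> : e * `|t| = e / (1 + `|c|) * `|t| + `|c| * (e / (1 + `|c|) * `|t|).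
  by field; rewrite gt_eqF.
by apply: lerD => //; exact: ler_wpM2l.
Qed.

Lemma axis_lipschitz n f (df : R * R -> R) i z (h K : R) :
  tbox n z -> tbox n (z + h *: axis i) ->
  (forall x, tbox n x -> slope (tbox n) f x (axis i) (df x)) ->
  (forall x, tbox n x -> `|df x| <= K) ->
  `|f (z + h *: axis i) - f z| <= K * `|h|.
Proof.
move=> X1 X2 sl bd.
have := @axis_mean_value n f df i z z h 0 0 K X1 X2 X1 X2 sl.
rewrite !mul0r !subr0; apply=> s sab; rewrite mul0r !subr0.
by apply: bd; exact: tbox_axis_convex X1 X2 sab.
Qed.

(** Two points of a box are joined, inside it, by two segments parallel to the
    axes, so bounded partial derivatives give a Lipschitz constant. *)
Lemma slope_lipon n f (df : bool -> R * R -> R) (K : R) :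
  (forall i x, tbox n x -> slope (tbox n) f x (axis i) (df i x)) ->
  (forall i x, tbox n x -> `|df i x| <= K) -> lipon (tbox n) f K.
Proof.
move=> sl bd a b Xa Xb.
have Xm : tbox n (a.1, b.2) by move: Xa Xb => [? ?] [? ?].
have E1 : b + (a.1 - b.1) *: axis false = (a.1, b.2) by rewrite axisE /= addrC subrK.
have E2 : (a.1, b.2) + (a.2 - b.2) *: axis true = a.
  by rewrite axisE /= addrC subrK; case: (a).
have h1 := axis_lipschitz (i := false) (h := a.1 - b.1) Xb _ (sl false) (bd false).
have h2 := axis_lipschitz (i := true) (h := a.2 - b.2) Xm _ (sl true) (bd true).
rewrite E1 in h1; rewrite E2 in h2; have := h1 Xm; have := h2 Xa => {}h2 {}h1.
have -> : f a - f b = (f a - f (a.1, b.2)) + (f (a.1, b.2) - f b) by ring.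
by rewrite (le_trans (ler_normD _ _))// /dist1 mulrDr addrC lerD.
Qed.

(** Both mixed derivatives are the limit of the normalised second difference over
    shrinking squares with a corner at the point; the squares are taken inside
    the box, also when the point is on its boundary. *)
Lemma mixed_slopes n f (p : bool -> R * R -> R) (q : bool -> R * R -> R) x :
  (0 < n)%N -> tbox n x ->
  (forall i z, tbox n z -> slope (tbox n) f z (axis i) (p i z)) ->
  (forall i z, tbox n z -> slope (tbox n) (p i) z (axis (~~ i)) (q i z)) ->
  (forall i, {within tbox n, continuous (q i)}) ->
  q true x = q false x.
Proof.
move=> n0 xn sp sq cq; apply/eqP; rewrite -subr_eq0 -normr_le0; apply/ler_addgt0Pr => e e0.
rewrite add0r; have e2 : 0 < e / 2 by rewrite divr_gt0.
have near_q i : exists2 d, 0 < d & forall z, tbox n z ->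
    `|x.1 - z.1| < d -> `|x.2 - z.2| < d -> `|q i z - q i x| <= e / 2.
  have /subspace_continuousP/(_ _ xn)/cvgrPdist_le/(_ _ e2) := cq i.
  rewrite near_withinE => /nbhs_ballP[d /= d0 hd]; exists d => // z Xz z1 z2.
  by rewrite distrC; apply: hd.
have [d0 d0p h0] := near_q false; have [d1 d1p h1] := near_q true.
have [a a1 ha] := tbox_room false n0 xn; have [b b1 hb] := tbox_room true n0 xn.
pose d := Num.min 1 (Num.min d0 d1) / 2.
have dp : 0 < d by rewrite divr_gt0// !lt_min ltr01 d0p.
have [dle1 [dd0 dd1]] : d <= 1 /\ d < d0 /\ d < d1.
  have : Num.min 1 (Num.min d0 d1) <= 1 by rewrite ge_min lexx.
  have : Num.min 1 (Num.min d0 d1) <= d0 by rewrite !ge_min lexx !orbT.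
  have : Num.min 1 (Num.min d0 d1) <= d1 by rewrite !ge_min lexx !orbT.
  by rewrite /d => ? ? ?; split; [lra|split; lra].
pose s i := (if i then b else a) * d.
have sn i : `|s i| = d by rewrite normrM (gtr0_norm dp); case: i; rewrite ?a1 ?b1 mul1r.
have Xi i y : coord i y = coord i x -> tbox n y -> tbox n (y + s i *: axis i).
  by move=> yx Xy; case: i yx => yx; [apply: hb|apply: ha] => //; rewrite (ltW dp).
have co i : coord (~~ i) (x + s i *: axis i) = coord (~~ i) x by rewrite axisE; case: i.
have X1 i : tbox n (x + s i *: axis i) by exact: Xi.
have X2 i : tbox n (x + s i *: axis i + s (~~ i) *: axis (~~ i)) by apply: Xi.
have comm i : x + s (~~ i) *: axis (~~ i) + s i *: axis i = x + s i *: axis i + s (~~ i) *: axis (~~ i).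
  by rewrite addrAC.
pose D := f (x + s true *: axis true + s false *: axis false) -
  f (x + s true *: axis true) - f (x + s false *: axis false) + f x.
have inn i t : Num.min 0 (s i) <= t <= Num.max 0 (s i) -> `|t| <= d.
  rewrite -(sn i); have [h|h] := leP 0 (s i) => /andP[t1 t2].
    by rewrite !ger0_norm.
  by rewrite !ler0_norm ?(ltW h)// lerN2.
have key i : `|D - q i x * s true * s false| <= e / 2 * (d * d).
  have H : `|(f (x + s (~~ i) *: axis (~~ i) + s i *: axis i) - 1 * f (x + s i *: axis i)) -
      (f (x + s (~~ i) *: axis (~~ i)) - 1 * f x) - q i x * s (~~ i) * s i| <=
      (e / 2 * d) * `|s i|.
    apply: (axis_mean_value (df := p i)) => //.
    - by rewrite comm.
    - by move=> z; exact: sp.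
    - move=> t ti.
      have Xt : tbox n (x + t *: axis i) := tbox_axis_convex xn (X1 i) ti.
      have Xt' : tbox n (x + t *: axis i + s (~~ i) *: axis (~~ i)).
        by apply: Xi => //; rewrite axisE; case: (i).
      have := @axis_mean_value n (p i) (q i) (~~ i) (x + t *: axis i) (x + t *: axis i)
        (s (~~ i)) 0 (q i x) (e / 2) Xt Xt' Xt Xt' (sq i).
      rewrite (addrAC x (s (~~ i) *: axis (~~ i)) (t *: axis i)) !mul0r !subr0 mul1r sn; apply=> r ri.
      rewrite mul0r subr0.
      have Xr := tbox_axis_convex Xt Xt' ri.
      have t_d := inn _ _ ti; have r_d := inn _ _ ri.
      have t0 : `|t| < d0 /\ `|t| < d1 by split; lra.
      have r0 : `|r| < d0 /\ `|r| < d1 by split; lra.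
      have dist : `|x.1 - (x + t *: axis i + r *: axis (~~ i)).1| = (if i then `|r| else `|t|) /\
        `|x.2 - (x + t *: axis i + r *: axis (~~ i)).2| = (if i then `|t| else `|r|).
        by rewrite !axisE; case: (i) => /=; rewrite !opprD !addrA !subrr !sub0r !normrN.
      case: dist => dist1 dist2.
      by case: (i) dist1 dist2 Xr => dist1 dist2 Xr; [apply: h1|apply: h0] => //; rewrite ?dist1 ?dist2; case: t0 r0 => ? ? [].
  have E : (f (x + s (~~ i) *: axis (~~ i) + s i *: axis i) - 1 * f (x + s i *: axis i)) -
      (f (x + s (~~ i) *: axis (~~ i)) - 1 * f x) - q i x * s (~~ i) * s i =
      D - q i x * s true * s false.
    by rewrite comm /D; case: (i) => /=; rewrite ?(comm true) /=; ring.
  by rewrite E sn in H; rewrite [leRHS]mulrA.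
have dd : 0 < d * d by rewrite mulr_gt0.
rewrite -(ler_pM2r dd).
have -> : `|q true x - q false x| * (d * d) =
    `|(D - q false x * s true * s false) - (D - q true x * s true * s false)|.
  rewrite -{1}(sn true) -(sn false) -!normrM; congr (Num.norm _); ring.
apply: (le_trans (ler_normB _ _)).
have -> : e * (d * d) = e / 2 * (d * d) + e / 2 * (d * d) by field.
by apply: lerD.
Qed.

End slopes.

(** * Derivatives of the operator *)

Section riesz_derivatives.
Context {R : realType}.
Local Notation RM := (measurableTypeR R).
Local Notation leb := (@lebesgue_measure R).
Local Notation leb2 := (leb \x leb)%E.
Implicit Types (X : set (R * R)) (x y z v : R * R) (f : R * R -> R) (i j : bool).

Lemma slope_seq X f x v (l : R) (h : nat -> R) : slope X f x v l ->
  (forall k, h k != 0) -> (forall k, X (x + h k *: v)) -> h k @[k --> \oo] --> 0 ->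
  (h k)^-1 * (f (x + h k *: v) - f x) @[k --> \oo] --> l.
Proof.
move=> sl h0 hX hc; apply/cvgrPdist_le => e e0; have [d d0 hd] := sl e e0.
move/cvgrPdist_lt : hc => /(_ d d0); apply: filterS => k; rewrite sub0r normrN => kd.
have hp : 0 < `|h k| by rewrite normr_gt0.
rewrite -(ler_pM2r hp) -normrM; apply: le_trans (hd _ kd (hX k)).
rewrite -normrN le_eqVlt; apply/orP; left; apply/eqP; congr (Num.norm _).
by move: (h0 k); move: (h k) (f _ - f x) => t w t0; field.
Qed.

Lemma within_quotientE X f x v (P : set R) : within_quotient X f x v P <->
  nbhs (0 : R) (fun h => h != 0 -> X (x + h *: v) -> P (h^-1 *: (f (x + h *: v) - f x))).
Proof. by []. Qed.

Section differentiation.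
Variables (f g : R * R -> R) (j : bool) (Lf Mf L M : R).
Hypotheses (lf : lipon (tbox 2) f Lf) (fM : forall z, tbox 2 z -> `|f z| <= Mf)
  (L0 : 0 <= L) (lg : lipon (tbox 2) g L) (gM : forall z, tbox 2 z -> `|g z| <= M)
  (sl : forall z, tbox 2 z -> slope (tbox 2) f z (axis j) (g z)).

Let mB n : @measurable _ (RM * RM)%type (tbox n). Proof. exact: measurable_tbox. Qed.

Let isym i x : tbox 1 x -> leb2.-integrable (tbox 1) (EFin \o sym_integrand i f x).
Proof.
move=> x1; have lf' : lipon (tbox 2) f `|Lf|.
  move=> a b Xa Xb; apply: (le_trans (lf Xa Xb)).
  by apply: ler_wpM2r; [exact: dist1_ge0|exact: ler_norm].
apply: (@le_norm_integrable _ _ _ leb2 (tbox 1) _ (sym_majorant `|Lf| Mf)) => //.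
- exact: measurable_sym_integrand lf' x1.
- exact: integrable_sym_majorant.
- by move=> y y1; exact: sym_integrand_bound (normr_ge0 _) lf' fM x1 y1.
Qed.

(** Translating the point by [h] along an axis translates [f], so that the
    difference quotient of [riesz_op i f] is [riesz_op i] of the difference quotient of
    [f], to which dominated convergence applies: by the mean value inequality
    the quotients of [f] are bounded and Lipschitz uniformly in [h]. *)
Lemma riesz_op_slope i x : tbox 1 x ->
  slope (tbox 1) (riesz_op i f) x (axis j) (riesz_op i g x).
Proof.
move=> x1; apply/within_quotientP.
pose S : set R := [set h | h != 0 /\ tbox 1 (x + h *: axis j)].
suff H : h^-1 *: (riesz_op i f (x + h *: axis j) - riesz_op i f x) @[h --> within S (nbhs (0 : R))] --> riesz_op i g x.
  apply: cvg_trans H => P HP; apply/within_quotientE.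
  have HS : nbhs (0 : R) (fun h => S h -> P (h^-1 *: (riesz_op i f (x + h *: axis j) - riesz_op i f x))).
    exact: HP.
  by apply: filterS HS => h H h0 Ah; exact: H.
apply: cvg_within_seq => h hS hc.
have h0 k : h k != 0 by have [] := hS k.
have hx k : tbox 1 (x + h k *: axis j) by have [] := hS k.
pose F k y := (h k)^-1 * (sym_integrand i f (x + h k *: axis j) y - sym_integrand i f x y).
have -> : (fun k => (h k)^-1 *: (riesz_op i f (x + h k *: axis j) - riesz_op i f x)) =
    (fun k => (\int[leb2]_(y in tbox 1) F k y)%R).
  apply/funext => k; have i1 := isym i (hx k); have i2 := isym i x1.
  transitivity ((h k)^-1 * (riesz_op i f (x + h k *: axis j) - riesz_op i f x)) => //.
  rewrite /riesz_op -RintegralB// -RintegralZl//.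
  by have := integrableB (mB 1) i1 i2; apply: eq_integrable.
have shift k y : tbox 1 y -> tbox 2 (x + y + h k *: axis j).
  by move=> y1; rewrite addrAC; exact: tboxD1.
pose q k z := (h k)^-1 * (f (z + h k *: axis j) - f z).
have FE k y : F k y = (q k (x + y) - q k (x - y)) / 2 * riesz_coord i y + q k (x + y) * lattice_corr i y.
  rewrite /F /q /sym_integrand (addrAC x _ y) (addrAC x _ (- y)).
  move: (f _) (f _) (f _) (f _) (h k)^-1 (riesz_coord i y) (lattice_corr i y) => a b c e t r s.
  by field.
have q_le k z : tbox 2 z -> tbox 2 (z + h k *: axis j) -> `|q k z| <= M.
  move=> z2 zh2; have hp : 0 < `|h k| by rewrite normr_gt0.
  rewrite /q normrM normfV mulrC ler_pdivrMr//.
  exact: axis_lipschitz z2 zh2 sl gM.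
have q_lip k z z' : tbox 2 z -> tbox 2 (z + h k *: axis j) -> tbox 2 z' ->
    tbox 2 (z' + h k *: axis j) -> `|q k z - q k z'| <= L * dist1 z z'.
  move=> z2 zh2 z2' zh2'; have hp : 0 < `|h k| by rewrite normr_gt0.
  have := @axis_mean_value _ 2 f g j z z' (h k) 1 0 (L * dist1 z z') z2 zh2 z2' zh2' sl.
  have -> : q k z - q k z' = ((f (z + h k *: axis j) - 1 * f (z' + h k *: axis j)) -
      (f z - 1 * f z') - 0 * h k) / h k.
    by rewrite /q; move: (f _) (f _) (f _) (f _) => a b c e; field.
  rewrite [`|_ / h k|]normrM normfV ler_pdivrMr//; apply=> s sab.
  rewrite mul1r subr0; apply: le_trans (lg _ _) _.
  - exact: tbox_axis_convex z2 zh2 sab.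
  - exact: tbox_axis_convex z2' zh2' sab.
  - rewrite le_eqVlt; apply/orP; left; apply/eqP; rewrite /dist1 !axisE.
    by case: (j) => /=; congr (_ * (_ + _)); congr (Num.norm _); ring.
rewrite /riesz_op; apply: (@Rdominated_convergence _ _ _ leb2 (tbox 1) F _ (sym_majorant L M)).
- exact: mB.
- move=> k; apply: measurable_funM => //; apply: measurable_funB.
    exact: measurable_sym_integrand lf (hx k).
  exact: measurable_sym_integrand lf x1.
- move=> y y1; under eq_fun do rewrite FE.
  have c1 : q k (x + y) @[k --> \oo] --> g (x + y).
    by apply: slope_seq hc => //; [apply: sl; exact: tboxD1|move=> k; exact: shift].
  have c2 : q k (x - y) @[k --> \oo] --> g (x - y).
    apply: slope_seq hc => //; first by apply: sl; apply: tboxD1 => //; exact: tboxN.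
    by move=> k; apply: shift; exact: tboxN.
  rewrite /sym_integrand; apply: cvgD; last by apply: cvgM; [exact: c1|exact: cvg_cst].
  apply: cvgM; last exact: cvg_cst.
  apply: cvgM; last exact: cvg_cst.
  exact: cvgB.
- exact: integrable_sym_majorant.
- move=> k y y1; rewrite FE.
  have yN := tboxN y1.
  have b1 := q_le k _ (tboxD1 x1 y1) (shift k _ y1).
  have b2 := q_lip k _ _ (tboxD1 x1 y1) (shift k _ y1) (tboxD1 x1 yN) (shift k _ yN).
  rewrite dist1_opp in b2.
  apply: (le_trans (ler_normD _ _)); apply: lerD; first exact: odd_kernel_bound.
  by rewrite normrM; apply: ler_pM => //; exact: lattice_corr_bound.
Qed.

End differentiation.

Lemma eq_derive_in X f f' x v : (forall z, X z -> f z = f' z) -> X x ->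
  derive_in X f x v = derive_in X f' x v.
Proof.
move=> ff Xx; rewrite /derive_in; congr (lim _).
apply/seteqP; split => P /within_quotientE H; apply/within_quotientE;
  by apply: filterS H => h H h0 Ah; have := H h0 Ah; rewrite !ff.
Qed.

Section smooth.
Variables (n k : nat) (f : R * R -> R).
Hypotheses (n0 : (0 < n)%N) (cf : Ck k (tbox n) f).

Local Notation "'d' s" := (partials (tbox n) f s) (at level 10, s at level 8).

Lemma Ck_slope s i x : (size s < k)%N -> tbox n x ->
  slope (tbox n) (d s) x (axis i) (d (i :: s) x).
Proof.
move=> sk xn; have [[_ /(_ _ xn) h] _ _] := cf (s := i :: s) sk.
exact: derivable_slope.
Qed.

Lemma Ck_lipon s (r : R) : (size s < k)%N ->
  (forall i x, tbox n x -> `|d (i :: s) x| <= r) -> lipon (tbox n) (d s) r.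
Proof.
move=> sk; apply: (slope_lipon (df := fun i => d (i :: s))) => i x xn.
exact: Ck_slope.
Qed.

Lemma Ck_bounded s : (size s <= k)%N ->
  exists2 M, 0 <= M & forall x, tbox n x -> `|d s x| <= M.
Proof.
move=> sk; have [_ _ [M hM]] := cf sk; exists M => //.
exact: le_trans (hM _ (tbox0 n)).
Qed.

Lemma Ck_lipschitz s : (size s < k)%N ->
  exists2 L, 0 <= L & lipon (tbox n) (d s) L.
Proof.
move=> sk; have [M0 p0 h0] := Ck_bounded (s := false :: s) sk.
have [M1 p1 h1] := Ck_bounded (s := true :: s) sk.
exists (M0 + M1); first exact: addr_ge0.
apply: Ck_lipon => // -[] x xn.
  by apply: le_trans (h1 _ xn) _; rewrite lerDr.
by apply: le_trans (h0 _ xn) _; rewrite lerDl.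
Qed.

(** One more derivative in the second variable, moved to its place among those
    that a multi-index prescribes. *)
Lemma partials_swap a t x : (size t + a < k)%N -> tbox n x ->
  d (true :: nseq a false ++ t) x = d (nseq a false ++ true :: t) x.
Proof.
elim: a x => [//|a ih] x tk xn.
have sz : size (nseq a false ++ t) = (size t + a)%N by rewrite size_cat size_nseq addnC.
set w := nseq a false ++ t in sz ih *.
transitivity (d (false :: true :: w) x).
  apply: esym; apply: (@mixed_slopes _ n (d w) (fun i => d (i :: w))
    (fun i => d (~~ i :: i :: w)) x n0 xn).
  - by move=> i z zn; apply: Ck_slope => //; lia.
  - by move=> i z zn; apply: Ck_slope => //=; lia.
  - by move=> i; have [] := cf (s := ~~ i :: i :: w) ltac:(rewrite /=; lia).
rewrite -cat1s /=; apply: eq_derive_in => // z zn.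
by apply: ih => //; lia.
Qed.

End smooth.

Section word_derivatives.
Variables (k : nat) (f : R * R -> R).
Hypothesis cf : Ck k (tbox 2) f.

(** Stated for any [F] that agrees with [riesz_op i f] on the box, since one-sided
    derivatives on the box only see the values there. *)
Lemma riesz_op_partials i (F : R * R -> R) s : (size s < k)%N ->
  (forall x, tbox 1 x -> F x = riesz_op i f x) ->
  partials_exist (tbox 1) F s /\
  forall x, tbox 1 x -> partials (tbox 1) F s x = riesz_op i (partials (tbox 2) f s) x.
Proof.
move=> sk FE; elim: s sk => [//|j s ih] sk.
have [es Es] := ih (ltnW sk).
have [Lf Lf0 lf] := Ck_lipschitz cf (ltnW sk).
have [Mf _ fM] := Ck_bounded cf (ltnW (ltnW sk)).
have [L L0 lg] := Ck_lipschitz cf (s := j :: s) sk.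
have [M _ gM] := Ck_bounded cf (s := j :: s) (ltnW sk).
have sl x : tbox 1 x -> slope (tbox 1) (partials (tbox 1) F s) x (axis j)
    (riesz_op i (partials (tbox 2) f (j :: s)) x).
  move=> x1; apply: (eq_slope (f := riesz_op i (partials (tbox 2) f s))) => //.
    by move=> z z1; rewrite Es.
  apply: (riesz_op_slope lf fM L0 lg gM) => // z z2.
  by apply: (Ck_slope cf) => //; exact: ltnW.
split.
  split => // x x1; have [] := slope_derive (n := 1) isT x1 (sl x x1); by [].
by move=> x x1; have [_] := slope_derive (n := 1) isT x1 (sl x x1).
Qed.

End word_derivatives.

(** The supremum of a continuous function on a box is an essential supremum:
    each point of the box is a corner of arbitrarily small squares of positive
    measure inside the box. *)
Lemma le_Lpnorm_oo n f x : (0 < n)%N -> {within tbox n, continuous f} ->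
  tbox n x -> (`|f x|%:E <= Lpnorm +oo%E (tbox n) f)%E.
Proof.
move=> n0 cf xn.
have np : 1 <= n%:R * pi :> R.
  have n1 : 1 <= n%:R :> R by rewrite ler1n.
  have := @pi_ge2 R; nra.
have square (d : R) : 0 < d -> exists Q : set (R * R),
    [/\ @measurable _ (RM * RM)%type Q, (0 < leb2 Q)%E, Q `<=` tbox n &
        forall z, Q z -> `|x.1 - z.1| < d /\ `|x.2 - z.2| < d].
  move=> d0; pose e := Num.min 1 d / 2.
  have m0 : 0 < Num.min 1 d by rewrite lt_min ltr01.
  have e0 : 0 < e by rewrite divr_gt0.
  have [e1 ed] : e < 1 /\ e < d.
    have : Num.min 1 d <= 1 by rewrite ge_min lexx.
    have : Num.min 1 d <= d by rewrite ge_min lexx orbT.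
    by rewrite /e => ? ?; split; lra.
  pose lo (t : R) := if t <= 0 then t else t - e.
  have lo_in t s : `|t| <= n%:R * pi -> lo t <= s <= lo t + e -> `|s| <= n%:R * pi /\ `|t - s| < d.
    move=> /ler_normlP[t1 t2]; rewrite /lo; case: ifPn; rewrite -?ltNge => t0 /andP[s1 s2].
      by split; [apply/ler_normlP; split; lra|rewrite ltr_norml; apply/andP; split; lra].
    by split; [apply/ler_normlP; split; lra|rewrite ltr_norml; apply/andP; split; lra].
  have mi (t : R) : leb (`[lo t, lo t + e]%classic : set R) = e%:E.
    rewrite lebesgue_measure_itv/= lte_fin ltrDl e0 -EFinD; congr EFin; ring.
  exists (`[lo x.1, lo x.1 + e]%classic `*` `[lo x.2, lo x.2 + e]%classic); split.
  - by apply: measurableX; exact: measurable_itv.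
  - rewrite product_measure1E; [|exact: measurable_itv|exact: measurable_itv].
    by rewrite /= !mi -EFinM lte_fin mulr_gt0.
  - move=> z [/=]; rewrite !in_itv/= => z1 z2; move: xn => /tboxP[x1 x2]; apply/tboxP.
    by have [? _] := lo_in _ _ x1 z1; have [? _] := lo_in _ _ x2 z2.
  - move=> z [/=]; rewrite !in_itv/= => z1 z2; move: xn => /tboxP[x1 x2].
    by have [_ ?] := lo_in _ _ x1 z1; have [_ ?] := lo_in _ _ x2 z2.
have muT : (0 < leb2 setT)%E.
  have [Q [mQ Q0 _ _]] := square 1 ltr01.
  by apply: lt_le_trans Q0 _; apply: le_measure; rewrite ?inE//; exact: measurableT.
rewrite /Lpnorm unlock muT; set E := ess_sup _ _.
rewrite leNgt; apply/negP => Efx.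
have [r Er rfx] : exists2 r : R, (E <= r%:E)%E & r < `|f x|.
  move: Efx; case: (E) => [r| |]; rewrite ?lte_fin//.
    by exists r.
  by exists (`|f x| - 1); rewrite ?leNye// ltrBlDr ltrDl.
have [d d0 hd] : exists2 d, 0 < d & forall z, tbox n z ->
    `|x.1 - z.1| < d -> `|x.2 - z.2| < d -> r < `|f z|.
  have e0 : 0 < `|f x| - r by rewrite subr_gt0.
  have /subspace_continuousP/(_ _ xn)/cvgrPdist_lt/(_ _ e0) := cf.
  rewrite near_withinE => /nbhs_ballP[d /= d0 hd]; exists d => // z Xz z1 z2.
  have : `|f x - f z| < `|f x| - r by apply: hd.
  by have := ler_norm (`|f x| - `|f z|); have := ler_dist_dist (f x) (f z); lra.
have [Q [mQ Q0 QX Qd]] := square d d0.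
have [N [mN N0 hN]] := ess_sup_ge leb2 (abse \o (EFin \o (f \_ (tbox n)))).
have : (leb2 Q <= leb2 N)%E.
  apply: le_measure; rewrite ?inE// => z Qz; apply: hN => /=; rewrite -/E.
  have [z1 z2] := Qd z Qz; have := hd z (QX z Qz) z1 z2 => rz0 h.
  have := le_trans h Er; rewrite patchE ifT ?inE; last exact: QX.
  by rewrite lee_fin leNgt rz0.
by rewrite N0 leNgt Q0.
Qed.

Lemma le_Winfnorm k f a b x : Ck k (tbox 2) f -> (a + b <= k)%N -> tbox 2 x ->
  (`|Dmulti (tbox 2) f (a, b) x|%:E <= Winfnorm k (tbox 2) f)%E.
Proof.
move=> cf abk x2.
have [ak bk] : (a < k.+1)%N /\ (b < k.+1)%N by lia.
have sz : (size (word (a, b)) <= k)%N by rewrite /word size_cat !size_nseq.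
have [_ cw _] := cf _ sz.
apply: le_trans (le_Lpnorm_oo _ cw x2) _ => //.
exact: (@le_bigmax_cond _ _ _ 0%E (Ordinal ak, Ordinal bk) (fun alpha : 'I_k.+1 * 'I_k.+1 => (alpha.1 + alpha.2 <= k)%N)
  (fun alpha => Lpnorm +oo%E (tbox 2) (Dmulti (tbox 2) f (alpha.1 : nat, alpha.2 : nat)))).
Qed.

(** [D^alpha f] is bounded and Lipschitz with constants among the terms of the
    norm: its first derivative in either variable is a derivative of [f] of order
    at most [k + 1], up to the order of differentiation. *)
Lemma riesz_op_derivative_bound k a b f i x : (a + b)%N = k -> Ck k.+1 (tbox 2) f -> tbox 1 x ->
  (`|riesz_op i (Dmulti (tbox 2) f (a, b)) x|%:E <= riesz_op_const%:E * Winfnorm k.+1 (tbox 2) f)%E \/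
  Winfnorm k.+1 (tbox 2) f = +oo%E.
Proof.
move=> abk cf x1; case E : (Winfnorm _ _ _) => [r| |]; [left|by right|]; last first.
  by have := @le_Winfnorm k.+1 f 0 0 0 cf isT (tbox0 2); rewrite E leeNy_eq.
have sz : size (word (a, b)) = k by rewrite /word size_cat !size_nseq.
have W p q z : (p + q <= k.+1)%N -> tbox 2 z -> `|Dmulti (tbox 2) f (p, q) z| <= r.
  by move=> pq z2; rewrite -lee_fin -E; exact: le_Winfnorm.
have r0 : 0 <= r by apply: le_trans (W 0 0 0 _ (tbox0 2)).
have L : lipon (tbox 2) (Dmulti (tbox 2) f (a, b)) r.
  apply: (Ck_lipon cf); first by rewrite sz.
  move=> [] z z2.
    have ab1 : (size (nseq b true) + a < k.+1)%N by rewrite size_nseq; lia.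
    have -> := partials_swap (n := 2) isT cf ab1 z2.
    by apply: (W a b.+1) => //; lia.
  by apply: (W a.+1 b) => //; lia.
rewrite -EFinM lee_fin; apply: (riesz_op_bound i L _ x1 r0) => // z z2.
by apply: W => //; lia.
Qed.

Lemma riesz_op_Dmulti k alpha f i (F : R * R -> R) : (alpha.1 + alpha.2)%N = k ->
  Ck k.+1 (tbox 2) f -> (forall x, tbox 1 x -> F x = riesz_op i f x) ->
  Dmulti_exists (tbox 1) F alpha /\
  forall x, tbox 1 x -> Dmulti (tbox 1) F alpha x = riesz_op i (Dmulti (tbox 2) f alpha) x.
Proof.
move=> ak cf; apply: (riesz_op_partials cf).
by rewrite /word size_cat !size_nseq ak.
Qed.

Lemma riesz_op_Dmulti_bound k alpha f (F G : R * R -> R) : (alpha.1 + alpha.2)%N = k ->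
  Ck k.+1 (tbox 2) f -> (forall x, tbox 1 x -> F x = riesz_op false f x) ->
  (forall x, tbox 1 x -> G x = riesz_op true f x) ->
  [/\ Dmulti_exists (tbox 1) F alpha, Dmulti_exists (tbox 1) G alpha &
    forall x, tbox 1 x ->
      ((enorm (Dmulti (tbox 1) F alpha x, Dmulti (tbox 1) G alpha x))%:E <=
       (2 * @riesz_op_const R + 1)%:E * Winfnorm k.+1 (tbox 2) f)%E].
Proof.
move=> ak cf FE GE; have [e1 E1] := riesz_op_Dmulti ak cf FE; have [e2 E2] := riesz_op_Dmulti ak cf GE.
split=> // x x1; rewrite (E1 x x1) (E2 x x1).
have C0 : 0 < 2 * @riesz_op_const R + 1 by rewrite ltr_wpDl// mulr_ge0// riesz_op_const_ge0.
case: alpha ak {FE GE e1 e2 E1 E2} => a b ak.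
have := riesz_op_derivative_bound true ak cf x1.
have := riesz_op_derivative_bound false ak cf x1.
have := @le_Winfnorm _ f 0 0 _ cf isT (tbox0 2).
move: (Winfnorm _ _ _) (riesz_op false _ x) (riesz_op true _ x) (Dmulti _ _ _ _) (@riesz_op_const R) C0.
move=> W A B D c C0; case: W => [r| |].
- rewrite -!EFinM !lee_fin => r0 [h1|//] [h2|//].
  have {}r0 : 0 <= r by exact: le_trans r0.
  apply: (le_trans (enorm_le_sum _)) => /=.
  apply: (le_trans (lerD h1 h2)).
  have -> : (2 * c + 1) * r = c * r + c * r + r by ring.
  by rewrite lerDl.
- by move=> _ _ _; rewrite gt0_muley ?lte_fin// leey.
- by rewrite leeNy_eq.
Qed.

End riesz_derivatives.

Theorem theorem3p2 (R : realType) :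
  [/\ (forall (n : nat) (phi : R * R -> R), (1 <= n)%N ->
         Ck 1 (tbox n.+1) phi ->
         forall x : R * R, tbox n x -> Rtilde_well_defined phi x),
      (exists2 C : R, 0 < C &
         forall (k : nat) (alpha : nat * nat), (alpha.1 + alpha.2 = k)%N ->
         forall phi : R * R -> R, Ck k.+1 (tbox 2) phi ->
           [/\ Dmulti_exists (tbox 1) (fun z => (Rtilde phi z).1) alpha,
               Dmulti_exists (tbox 1) (fun z => (Rtilde phi z).2) alpha &
               forall x : R * R, tbox 1 x ->
                 ((enorm (Dmulti (tbox 1) (fun z => (Rtilde phi z).1) alpha x,
                          Dmulti (tbox 1) (fun z => (Rtilde phi z).2) alpha x)
                  )%:E <= C%:E * Winfnorm k.+1 (tbox 2) phi)%E]) &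
      (exists2 C : R, 0 < C &
         forall phi : R * R -> R, Ck 1 (tbox 2) phi ->
           measurable_fun (tbox 1) (Rtilde phi) /\
           (Lpnorm 2%:E (tbox 1) (fun x => enorm (Rtilde phi x))
              <= C%:E * Lpnorm 2%:E (tbox 2) phi)%E)].
Proof.
have bounds n (phi : R * R -> R) k : Ck k.+1 (tbox n) phi ->
    exists L M : R, [/\ 0 <= L, lipon (tbox n) phi L & forall z, tbox n z -> `|phi z| <= M].
  move=> cphi; have [L L0 lphi] := Ck_lipschitz cphi (s := [::]) isT.
  by have [M _ phiM] := Ck_bounded cphi (s := [::]) isT; exists L, M.
split.
- move=> n phi _ cphi x xn; have [L [M [_ lphi phiM]]] := bounds _ _ _ cphi.
  exact: Rtilde_well_definedP lphi phiM xn.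
- exists (2 * @riesz_op_const R + 1); first by rewrite ltr_wpDl// mulr_ge0// riesz_op_const_ge0.
  move=> k alpha ak phi cphi; have [L [M [_ lphi phiM]]] := bounds _ _ _ cphi.
  apply: riesz_op_Dmulti_bound ak cphi _ _ => x x1.
    by rewrite (Rtilde_riesz_op lphi phiM x1).
  by rewrite (Rtilde_riesz_op lphi phiM x1).
- exists (Num.sqrt (@riesz_L2_const R) + 1); first by rewrite ltr_wpDl ?sqrtr_ge0.
  move=> phi cphi; have [L [M [L0 lphi phiM]]] := bounds _ _ _ cphi.
  split; first exact: measurable_Rtilde L0 lphi phiM.
  apply: le_trans (Rtilde_L2 L0 lphi phiM) _; apply: lee_wpmul2r.
    exact: Lnorm_ge0.
  by rewrite lee_fin lerDl.
Qed.
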